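(* Let $\mathbb{H}$ be a real separable Hilbert space with norm $\|\cdot\|$, and let $\xi$ and $\eta$ be Gaussian random elements of $\mathbb{H}$ with zero mean and covariance operators $\Sigma_{\xi}$ and $\Sigma_{\eta}$ respectively. Then for any $a \in \mathbb{H}$, \[ \sup_{x>0}\bigl|\mathbb{P}(\|\xi - a\| \le x) - \mathbb{P}(\|\eta\|\le x)\bigr| \le C\,\bigl\{\varkappa(\Sigma_{\xi}) + \varkappa(\Sigma_{\eta})\bigr\}\Bigl(\|\lambda_{\xi}-\lambda_{\eta}\|_1 + \|a\|^2\Bigr), \] where $C$ is an absolute constant.
   Context: For the covariance operator $\Sigma$ of a Gaussian element of $\mathbb{H}$ (a nonnegative self-adjoint nuclear operator), let $\lambda_1 \ge \lambda_2 \ge \dots \ge 0$ be its eigenvalues in non-increasing order (with multiplicity, padded with zeros), $\lambda_{\Sigma} = \mathrm{diag}(\lambda_1,\lambda_2,\dots)$, and $\Lambda_k^2 = \sum_{j\ge k}\lambda_j^2$ for $k=1,2$. Define $\varkappa(\Sigma) = \Lambda_1^{-1}$ if $3\lambda_1^2 \le \Lambda_1^2$; $\varkappa(\Sigma) = (\lambda_1\Lambda_2)^{-1/2}$ if $3\lambda_1^2 > \Lambda_1^2$ and $3\lambda_2^2 \le \Lambda_2^2$; and $\varkappa(\Sigma) = (\lambda_1\lambda_2)^{-1/2}$ if $3\lambda_1^2 > \Lambda_1^2$ and $3\lambda_2^2 > \Lambda_2^2$ (interpreted as $+\infty$ when the denominator vanishes). Write $\varkappa(\Sigma_\xi),\lambda_\xi$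 etc. for these quantities for $\Sigma_\xi$. For the diagonal sequences, $\|\lambda_\xi - \lambda_\eta\|_1 = \sum_{j\ge1}|\lambda_{j\xi}-\lambda_{j\eta}|$. *)

(* Defs.v *)
From HB Require Import structures.
From mathcomp Require Import all_boot all_order all_algebra.
From mathcomp Require Import all_classical all_reals all_analysis.
Set Implicit Arguments. Unset Strict Implicit. Unset Printing Implicit Defensive.
Import Order.TTheory GRing.Theory Num.Theory.
Local Open Scope classical_set_scope.
Local Open Scope ring_scope.

Section Hilbert.
Variables (R : realType) (H : lmodType R) (ip : H -> H -> R).

Definition hnorm (x : H) : R := Num.sqrt (ip x x).

Definition is_separable_hilbert : Prop :=
  [/\ (forall x y, ip x y = ip y x),
      (forall a x y z, ip (a *: x + y) z = a * ip x z + ip y z),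
      ((forall x, 0 <= ip x x) /\ (forall x, ip x x = 0 -> x = 0)),
      (forall u : nat -> H,
         (forall e : R, 0 < e -> exists N, forall m n, (N <= m)%N -> (N <= n)%N ->
              hnorm (u m - u n) < e) ->
         exists l, forall e : R, 0 < e -> exists N, forall n, (N <= n)%N -> hnorm (u n - l) < e)
    &
      (exists d : nat -> H, forall x (e : R), 0 < e -> exists n, hnorm (x - d n) < e)].

Variables (dd : measure_display) (Omega : measurableType dd) (P : probability Omega R).

Definition centered_gaussian_rv (X : Omega -> R) : Prop :=
  measurable_fun setT X /\
  exists s : R, 0 <= s /\
    forall B : set R, measurable B ->
      P (X @^-1` B) = (if s == 0 then \d_(0 : R) B else normal_prob 0 s B).

(** zero-mean Gaussian random element of H: every coordinate <xi, h> is
    a centered real Gaussian random variable (this includes (weak)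
    measurability, equivalent to Borel measurability in separable H). *)
Definition centered_gaussian_elt (xi : Omega -> H) : Prop :=
  forall h : H, centered_gaussian_rv (fun w => ip (xi w) h).

Definition covariance_operator (xi : Omega -> H) (Sigma : H -> H) : Prop :=
  forall h g : H,
    (ip (Sigma h) g)%:E = (\int[P]_w (ip (xi w) h * ip (xi w) g)%:E)%E.
End Hilbert.

Section Eigen.
Variables (R : realType) (H : lmodType R) (ip : H -> H -> R).

(** lam is the sequence of eigenvalues of the nonnegative self-adjoint
    operator Sigma, in non-increasing order, counted with multiplicity
    (multiplicity of mu = dimension of the eigenspace, i.e. the size of an
    orthonormal basis of it), padded with zeros. *)
Definition eigen_seq (Sigma : H -> H) (lam : nat -> R) : Prop :=
  (forall j, 0 <= lam j) /\ (forall i j, (i <= j)%N -> lam j <= lam i) /\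
  exists e : nat -> H,
    [/\ (forall i j, 0 < lam i -> 0 < lam j -> ip (e i) (e j) = (i == j)%:R),
        (forall j, 0 < lam j -> Sigma (e j) = lam j *: e j)
      & (forall (mu : R) (v : H), 0 < mu -> Sigma v = mu *: v ->
           (forall j, lam j = mu -> ip v (e j) = 0) -> v = 0)].
End Eigen.

Section Kappa.
Variable R : realType.
Local Open Scope ereal_scope.

(** Lambda_k^2 = sum_{j >= k} lambda_j^2 (k = 1, 2; index shift: lambda_1 = lam 0) *)
Definition Lambda_sq (lam : nat -> R) (k : nat) : \bar R :=
  \sum_(k.-1 <= j <oo) ((lam j) ^+ 2)%:E.

Definition inv_or_oo (x : R) : \bar R := if (x == 0)%R then +oo else (x^-1)%:E.

Definition varkappa (lam : nat -> R) : \bar R :=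
  let l1 := lam 0%N in let l2 := lam 1%N in
  let L1 := Num.sqrt (fine (Lambda_sq lam 1)) in
  let L2 := Num.sqrt (fine (Lambda_sq lam 2)) in
  if ((3 * l1 ^+ 2)%:E <= Lambda_sq lam 1) then inv_or_oo L1
  else if ((3 * l2 ^+ 2)%:E <= Lambda_sq lam 2) then inv_or_oo (Num.sqrt (l1 * L2))
  else inv_or_oo (Num.sqrt (l1 * l2)).

Definition l1dist (lam mu : nat -> R) : \bar R :=
  \sum_(0 <= j <oo) (`|lam j - mu j|%R)%:E.
End Kappa.

(* Main.v *)
Require Import Defs.
From HB Require Import structures.
From mathcomp Require Import all_boot all_order all_algebra.
From mathcomp Require Import all_classical all_reals all_analysis.
From mathcomp Require Import measurable_realfun ring lra.
Set Implicit Arguments. Unset Strict Implicit. Unset Printing Implicit Defensive.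
Import Order.TTheory GRing.Theory Num.Theory.
Import numFieldNormedType.Exports.
Local Open Scope classical_set_scope.
Local Open Scope ring_scope.

(** By the spectral decomposition, ||xi - a||^2 is almost surely
    c + sum_j (sqrt(lam_j) Z_j - a_j)^2 with independent standard normal Z_j and
    c + sum_j a_j^2 <= ||a||^2, and likewise for eta.  Both sums are compared with the
    centered one with variances nu_j = max(lam_j, mu_j) + a_j^2, coordinate by coordinate.
    Replacing (sqrt(lam) Z - a)^2 by t^2 Z^2, where t^2 = lam + h and a^2 <= h, changes a
    tail ]y, oo[ by at most a constant times P(y <= (2 t Z)^2 <= y + h): the error is
    controlled by the mass that a slightly larger coordinate gives to an interval of
    length h.  Convolving with the other coordinates turns this into h times a bound on
    the concentration of a sum whose variances dominate lam_j, and this concentration is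
    O(varkappa): for two large coordinates directly, and for many small ones from the
    decay of the characteristic function (a product of (1 + 4 s^2 lam_j^2)^(-1/2) for
    a symmetrized sum). *)

(** * Gaussian integrals *)

(** A single squared Gaussian has an unbounded density near 0, so the error of one replacement
    cannot be bounded in isolation by O(h): it has to remain the probability of an interval until
    the other coordinates are convolved in. The doubled scale in (2 t Z)^2 allows this. With u =
    sqrt y / t, the error is of order exp (- u^2 / 4), while the enlarged coordinate decays like exp
    (- u^2 / 8), which leaves room for factors polynomial in u. The replacement passes through mixed
    sums, so concentration is proved for every sequence that [dominates] the variances, with
    arbitrary shifts. For small coordinates, a squared Gaussian minus an independent copy is, after
    a rotation, normal given one variable, so only real Gaussian integrals occur. This controls X -
    X' rather than X, and returning to X takes two independent groups of coordinates. On the Hilbert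
    side, [eigen_seq] exhausts the eigenspaces of positive eigenvalues; that xi has no component
    outside their span is derived from a compactness that the Gaussian law itself provides. *)

Section Density.
Context d (T : measurableType d) (R : realType).
Variables (nu mu : {measure set T -> \bar R}) (g : T -> R).
Hypotheses (mg : measurable_fun setT g) (g0 : forall x, 0 <= g x).
Hypothesis nuE : forall A, measurable A -> nu A = (\int[mu]_(x in A) (g x)%:E)%E.
Local Open Scope ereal_scope.
Import HBNNSimple.

Let dens_indic A : measurable A ->
  \int[nu]_x (\1_A x)%:E = \int[mu]_x ((\1_A x)%:E * (g x)%:E).
Proof.
move=> mA; rewrite integral_indic// setIT nuE// integral_mkcond.
apply: eq_integral => x _; rewrite patchE indicE.
by case: ifPn => _; rewrite ?mul1e ?mul0e.
Qed.

Let dens_nnsfun (f : {nnsfun T >-> R}) :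
  \int[nu]_x (f x)%:E = \int[mu]_x ((f x)%:E * (g x)%:E).
Proof.
under [LHS]eq_integral do rewrite fimfunE -fsumEFin//.
rewrite [LHS]ge0_integral_fsum//; last 2 first.
  - by move=> r; exact/measurable_EFinP/measurableT_comp.
  - by move=> n x _; rewrite EFinM nnfun_muleindic_ge0.
under [RHS]eq_integral.
  move=> x xD; rewrite fimfunE -fsumEFin// ge0_mule_fsuml; last first.
    by move=> r; rewrite EFinM nnfun_muleindic_ge0.
  over.
rewrite [RHS]ge0_integral_fsum//; last 2 first.
  - move=> r; apply: emeasurable_funM; last exact/measurable_EFinP.
    by apply/measurable_EFinP; do 2 apply/measurableT_comp => //.
  - by move=> n x _; rewrite mule_ge0 ?lee_fin// -lee_fin EFinM nnfun_muleindic_ge0.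
apply: eq_fsbigr => r _.
under [RHS]eq_integral do rewrite EFinM -muleA.
have [r0|r0] := leP 0%R r.
  rewrite ge0_integralZl//; last 2 first.
  - by apply: emeasurable_funM; apply/measurable_EFinP => //; exact: measurable_indic.
  - by move=> x _; rewrite mule_ge0 ?lee_fin.
  by rewrite !integralZl_indic_nnsfun//= dens_indic.
have -> : f @^-1` [set r] = set0.
  rewrite -subset0 => x /= fxr; have : (0 <= f x)%R by [].
  by rewrite fxr leNgt r0.
rewrite integral0_eq; last by move=> x _; rewrite indic0 mulr0.
by rewrite integral0_eq// => x _; rewrite indic0 mul0e mule0.
Qed.

Lemma ge0_integral_density (f : T -> \bar R) :
  measurable_fun setT f -> (forall x, 0 <= f x) ->
  \int[nu]_x f x = \int[mu]_x (f x * (g x)%:E).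
Proof.
move=> mf f0.
pose f_ := nnsfun_approx measurableT mf.
transitivity (lim (\int[nu]_x (f_ n x)%:E @[n --> \oo])).
  rewrite -monotone_convergence//=.
  - apply: eq_integral => ? /[!inE] xD; apply/esym/cvg_lim => //=.
    exact: cvg_nnsfun_approx.
  - by move=> n; exact/measurable_EFinP/measurable_funTS.
  - by move=> n ? _; rewrite lee_fin.
  - by move=> ? _ ? ? mn; rewrite lee_fin; exact/lefP/nd_nnsfun_approx.
transitivity (lim (\int[mu]_x ((f_ n x)%:E * (g x)%:E) @[n --> \oo])).
  by apply: congr_lim; apply/funext => n; exact: dens_nnsfun.
rewrite -monotone_convergence//=.
- apply: eq_integral => x _; apply/cvg_lim => //=.
  apply: cvgeZr => //.
  by apply: cvg_nnsfun_approx.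
- move=> n; apply: emeasurable_funM; last exact/measurable_EFinP.
  exact/measurable_EFinP/measurable_funTS.
- by move=> n ? _; rewrite mule_ge0 ?lee_fin.
- move=> ? _ ? ? mn; rewrite lee_pmul ?lee_fin//; exact/lefP/nd_nnsfun_approx.
Qed.
End Density.

Section Affine.
Context {R : realType}.
Notation leb := (@lebesgue_measure R).
Notation TR := (measurableTypeR R).

Definition affine (a b : R) : TR -> TR := fun x : R => a * x + b.

Lemma measurable_affine (a b : R) : measurable_fun [set: TR] (affine a b).
Proof. by apply: measurable_funD => //; exact: measurable_funM. Qed.

(** Uniqueness of Lebesgue measure: [a] times the pushforward by the affine map takes the right
    value on half-open intervals, so the change of variables is an identity of measures. *)
Lemma ge0_integral_affine (a b : R) (f : TR -> \bar R) : 0 < a ->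
  measurable_fun setT f -> (forall x, 0 <= f x)%E ->
  (\int[leb]_x f (a * x + b)%R = a^-1%:E * \int[leb]_x f x)%E.
Proof.
move=> a0 mf f0.
pose nu_ : {measure set TR -> \bar R} :=
  mscale (NngNum (ltW a0)) (pushforward leb (affine a b)).
pose nu := nu_ (measurable_affine a b).
have nuE A : measurable A -> leb A = nu A.
  apply: lebesgue_measure_unique => _ [[u v] _ <-] /=.
  rewrite /mscale/= /pushforward/=.
  have -> : affine a b @^-1` `]u, v] = `](u - b) / a, (v - b) / a]%classic.
    apply/seteqP; split => x /=; rewrite !in_itv/= /affine ltr_pdivrMr// ler_pdivlMr//.
      by move=> /andP[ux xv]; apply/andP; split; nra.
    by move=> /andP[ux xv]; apply/andP; split; nra.
  rewrite !lebesgue_measure_itv/= !lte_fin ltr_pM2r ?invr_gt0// ltrD2r.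
  case: ifPn => uv; last by rewrite mule0.
  by rewrite -!EFinB -EFinM; congr EFin; field; rewrite gt_eqF.
rewrite [in RHS](eq_measure_integral nu)//; last by move=> A mA _; exact: nuE.
rewrite ge0_integral_mscale//= ge0_integral_pushforward//.
rewrite muleA -EFinM mulVf ?gt_eqF// mul1e.
  by rewrite preimage_setT.
exact: measurable_affine.
Qed.

Lemma ge0_integral_subst_affine (a b : R) (f : TR -> \bar R) : 0 < a ->
  measurable_fun setT f -> (forall x, 0 <= f x)%E ->
  (\int[leb]_x f x = a%:E * \int[leb]_x f (a * x + b)%R)%E.
Proof.
move=> a0 mf f0; rewrite ge0_integral_affine// muleA -EFinM.
by rewrite divff ?gt_eqF// mul1e.
Qed.

End Affine.

Section GaussianIntegrals.
Context {R : realType}.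
Notation leb := (@lebesgue_measure R).
Notation TR := (measurableTypeR R).

Definition gam : probability TR R := normal_prob 0 1.

Definition cpi : R := (Num.sqrt (2 * pi))^-1.

Lemma cpi_gt0 : 0 < cpi.
Proof. by rewrite invr_gt0 sqrtr_gt0 mulr_gt0// pi_gt0. Qed.

Lemma cpi_lt1 : cpi < 1.
Proof.
rewrite invf_lt1 ?sqrtr_gt0 ?mulr_gt0 ?pi_gt0// -[ltLHS]sqrtr1 ltr_sqrt.
  by have := @pi_ge2 R; lra.
by rewrite mulr_gt0 ?pi_gt0.
Qed.

Lemma normal_pdf_cpi (m s x : R) : 0 < s ->
  normal_pdf m s x = cpi / s * expR (- (x - m) ^+ 2 / (2 * s ^+ 2)).
Proof.
move=> s0; rewrite normal_pdfE ?gt_eqF// /normal_peak /normal_fun.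
congr (_ * expR _); last by rewrite -mulr_natl.
rewrite -mulrnAr -[pi *+ 2]mulr_natl sqrtrM ?sqr_ge0// sqrtr_sqr gtr0_norm//.
by rewrite invfM mulrC.
Qed.

Lemma normal_pdf01 (x : R) : normal_pdf 0 1 x = cpi * expR (- x ^+ 2 / 2).
Proof. by rewrite normal_pdf_cpi// divr1 subr0 expr1n mulr1. Qed.

Lemma integral_normal_probE (m s : R) (f : TR -> \bar R) :
  measurable_fun setT f -> (forall x, 0 <= f x)%E ->
  (\int[normal_prob m s]_x f x = \int[leb]_x (f x * (normal_pdf m s x)%:E))%E.
Proof.
move=> mf f0; apply: (@ge0_integral_density _ TR R (normal_prob m s) leb) => //.
- exact: measurable_normal_pdf.
- by move=> x; exact: normal_pdf_ge0.
Qed.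

Lemma integral_gamE (f : TR -> \bar R) :
  measurable_fun setT f -> (forall x, 0 <= f x)%E ->
  (\int[gam]_x f x = \int[leb]_x (f x * (cpi * expR (- x ^+ 2 / 2))%:E))%E.
Proof.
move=> mf f0; rewrite integral_normal_probE//.
by apply: eq_integral => x _; rewrite normal_pdf01.
Qed.

Lemma integral_normal_prob_scale (s : R) (f : TR -> \bar R) : 0 < s ->
  measurable_fun setT f -> (forall x, 0 <= f x)%E ->
  (\int[normal_prob 0 s]_x f x = \int[gam]_x f (s * x)%R)%E.
Proof.
move=> s0 mf f0; rewrite integral_normal_probE// integral_gamE//; last first.
  by apply: (measurableT_comp mf); exact: measurable_funM.
have mg : measurable_fun [set: TR] (fun x : TR => (f x * (normal_pdf 0 s x)%:E)%E).
  by apply: emeasurable_funM => //; apply/measurable_EFinP; exact: measurable_normal_pdf.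
have g0 x : (0 <= f x * (normal_pdf 0 s x)%:E)%E.
  by rewrite mule_ge0// lee_fin normal_pdf_ge0.
rewrite (@ge0_integral_subst_affine _ s 0)// -ge0_integralZl//; last 2 first.
- exact: (measurableT_comp mg (measurable_affine s 0)).
- by rewrite lee_fin ltW.
apply: eq_integral => x _; rewrite addr0 normal_pdf_cpi// muleCA -EFinM.
congr (_ * EFin _)%E; rewrite subr0.
have -> : - (s * x) ^+ 2 / (2 * s ^+ 2) = - x ^+ 2 / 2 by field; rewrite gt_eqF.
by field; rewrite gt_eqF.
Qed.

Lemma tonelli d1 d2 (T1 : measurableType d1) (T2 : measurableType d2)
    (m1 : {sigma_finite_measure set T1 -> \bar R})
    (m2 : {sigma_finite_measure set T2 -> \bar R}) (f : T1 * T2 -> \bar R) :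
  measurable_fun setT f -> (forall p, 0 <= f p)%E ->
  (\int[m1]_x \int[m2]_y f (x, y) = \int[m2]_y \int[m1]_x f (x, y))%E.
Proof. by move=> mf f0; exact: fubini_tonelli. Qed.

Definition phi (x : TR) : R := cpi * expR (- x ^+ 2 / 2).

Lemma measurable_phi : measurable_fun setT phi.
Proof.
apply: measurable_funM => //; apply: measurableT_comp => //.
by apply: measurable_funM => //; apply: measurableT_comp => //; exact: measurable_funX.
Qed.

Lemma phi_gt0 x : 0 < phi x.
Proof. by rewrite mulr_gt0 ?expR_gt0// cpi_gt0. Qed.

Lemma phi_ge0 x : 0 <= phi x. Proof. exact/ltW/phi_gt0. Qed.

Lemma measurable_phi2 (f : TR * TR -> \bar R) : measurable_fun setT f ->
  measurable_fun setT (fun p : TR * TR => f p * (phi p.1 * phi p.2)%:E)%E.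
Proof.
move=> mf; apply: emeasurable_funM => //; apply/measurable_EFinP.
by apply: measurable_funM; apply: (measurableT_comp measurable_phi).
Qed.

Lemma integral2_gamE (f : TR * TR -> \bar R) :
  measurable_fun setT f -> (forall p, 0 <= f p)%E ->
  (\int[gam]_x \int[gam]_y f (x, y) =
   \int[leb]_x \int[leb]_y (f (x, y) * (phi x * phi y)%:E))%E.
Proof.
move=> mf f0; rewrite integral_gamE; last 2 first.
- exact: measurable_fun_fubini_tonelli_F.
- by move=> y; exact: integral_ge0.
apply: eq_integral => x _.
have mfx : measurable_fun setT (fun y : TR => f (x, y)).
  by apply: (measurableT_comp mf); exact: pair1_measurable.
rewrite integral_gamE// -/(phi _) -ge0_integralZr; first last.
- by rewrite lee_fin phi_ge0.
- by move=> y _; rewrite mule_ge0// lee_fin phi_ge0.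
- by apply: emeasurable_funM => //; apply/measurable_EFinP; exact: measurable_phi.
- exact: measurableT.
by apply: eq_integral => y _; rewrite -muleA -EFinM [(phi x * _)%R]mulrC.
Qed.

(** The rotation by 45 degrees is factored into two one-dimensional affine substitutions under
    Tonelli, with Jacobians sqrt 2 and 1 / sqrt 2. It is the source of the symmetry of the normal
    law, of its characteristic function, and of the decoupling of a difference of squares. *)
Lemma gam_rotation (f : TR * TR -> \bar R) :
  measurable_fun setT f -> (forall p, 0 <= f p)%E ->
  (\int[gam]_x \int[gam]_y f (x, y) =
   \int[gam]_u \int[gam]_v f ((v + u) / Num.sqrt 2, (v - u) / Num.sqrt 2)%R)%E.
Proof.
move=> mf f0.
pose r2 : R := Num.sqrt 2.
have r20 : 0 < r2 by rewrite sqrtr_gt0.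
have r22 : r2 ^+ 2 = 2 by rewrite sqr_sqrtr.
pose rot (p : TR * TR) : TR * TR := ((p.2 + p.1) / r2, (p.2 - p.1) / r2).
have mrot : measurable_fun setT rot.
  apply: measurable_fun_pair => /=; apply: measurable_funM => //.
    by apply: measurable_funD.
  by apply: measurable_funB.
have mfrot : measurable_fun setT (f \o rot) by exact: measurableT_comp.
rewrite integral2_gamE//; apply/esym.
etransitivity; first exact: (integral2_gamE mfrot (fun p => f0 _)).
apply/esym.
pose F (p : TR * TR) := (f p * (phi p.1 * phi p.2)%:E)%E.
have mF : measurable_fun setT F by exact: measurable_phi2.
have F0 p : (0 <= F p)%E by rewrite mule_ge0// lee_fin mulr_ge0// phi_ge0.
rewrite (tonelli leb leb mF F0).
(* With [y] fixed, x becomes sqrt 2 u + y; afterwards, with [u] fixed, y becomes (v - u) / sqrt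
   2. *)
pose G (p : TR * TR) := (r2%:E * F (r2 * p.1 + p.2, p.2)%R)%E.
have mG : measurable_fun setT G.
  apply: measurable_funeM; apply: (measurableT_comp mF).
  apply: measurable_fun_pair => //=; apply: measurable_funD => //.
  by apply: measurable_funM.
have G0 p : (0 <= G p)%E by rewrite mule_ge0// lee_fin ltW.
transitivity (\int[leb]_y \int[leb]_u G (u, y))%E.
  apply: eq_integral => y _.
  have mFy : measurable_fun setT (fun x : TR => F (x, y)).
    by apply: (measurableT_comp mF); exact: pair2_measurable.
  rewrite (ge0_integral_subst_affine y r20 mFy (fun x => F0 (x, y))).
  rewrite -ge0_integralZl//.
  - exact: (measurableT_comp mFy (measurable_affine r2 y)).
  - by rewrite lee_fin ltW.
rewrite -(tonelli leb leb mG G0).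
apply: eq_integral => u _.
have mGu : measurable_fun setT (fun y : TR => G (u, y)).
  by apply: (measurableT_comp mG); exact: pair1_measurable.
have ir20 : 0 < r2^-1 by rewrite invr_gt0.
rewrite (ge0_integral_subst_affine (- (u / r2)) ir20 mGu (fun y => G0 (u, y))).
rewrite -ge0_integralZl//; last 2 first.
- exact: (measurableT_comp mGu (measurable_affine r2^-1 _)).
- by rewrite lee_fin ltW.
apply: eq_integral => v _; rewrite /G/= muleA -EFinM mulVf ?gt_eqF// mul1e.
have e1 : r2 * u + (r2^-1 * v - u / r2) = (v + u) / r2.
  have -> : r2 * u = 2 * u / r2 by rewrite -r22; field; rewrite gt_eqF.
  by field; rewrite gt_eqF.
have e2 : r2^-1 * v - u / r2 = (v - u) / r2 by field; rewrite gt_eqF.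
rewrite e1 e2 /F /=; congr (_ * EFin _)%E.
rewrite /phi mulrACA [RHS]mulrACA -!expRD; congr (_ * expR _).
by rewrite !exprMn !exprVn r22; field.
Qed.

End GaussianIntegrals.

Ltac mfun := cbv beta; simpl fst; simpl snd; lazymatch goal with
  | |- measurable_fun _ (fun x => EFin _) => apply/measurable_EFinP; mfun
  | |- measurable_fun _ (EFin \o _) => apply/measurable_EFinP; mfun
  | |- measurable_fun _ (fun x => expR (@?f x)) =>
      refine (measurableT_comp (@measurable_expR _) (_ : measurable_fun _ f)); mfun
  | |- measurable_fun _ (fun x => - (@?f x)) =>
      refine (measurableT_comp (oppr_measurable (D:=setT)) (_ : measurable_fun _ f)); mfun
  | |- measurable_fun _ (fun x => (@?f x) + (- (@?g x))) =>
      refine (measurable_funB (_ : measurable_fun _ f) (_ : measurable_fun _ g)); mfun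
  | |- measurable_fun _ (fun x => (@?f x) + (@?g x)) =>
      refine (measurable_funD (_ : measurable_fun _ f) (_ : measurable_fun _ g)); mfun
  | |- measurable_fun _ (fun x => (@?f x) * (@?g x)) =>
      refine (measurable_funM (_ : measurable_fun _ f) (_ : measurable_fun _ g)); mfun
  | |- measurable_fun _ (fun x => (@?f x) ^+ _) =>
      refine (measurable_funX _ (_ : measurable_fun _ f)); mfun
  | |- measurable_fun _ (fun x => ((@?f x) * (@?g x))%E) =>
      refine (emeasurable_funM (_ : measurable_fun _ f) (_ : measurable_fun _ g)); mfun
  | |- measurable_fun _ (fun x => ((@?f x) , (@?g x))) =>
      refine (measurable_fun_pair (_ : measurable_fun _ f) (_ : measurable_fun _ g)); mfun
  | |- measurable_fun _ (fun x => x) => exact: measurable_id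
  | |- _ => first [exact: measurable_cst | exact: measurable_id | done | exact: measurable_fst | exact: measurable_snd | assumption | idtac]
  end.

Section GaussianIntegrals2.
Context {R : realType}.
Notation leb := (@lebesgue_measure R).
Notation TR := (measurableTypeR R).

Lemma integral_gauss_bump (m s : R) : 0 < s ->
  (\int[leb]_x (expR (- (x - m) ^+ 2 / (2 * s ^+ 2)))%:E = (s / cpi)%:E)%E.
Proof.
move=> s0; have c0 := @cpi_gt0 R.
under eq_integral => x _.
  have -> : expR (- (x - m) ^+ 2 / (2 * s ^+ 2)) = s / cpi * normal_pdf m s x.
    by rewrite normal_pdf_cpi//; field; rewrite !gt_eqF.
  rewrite EFinM; over.
rewrite ge0_integralZl//.
- by rewrite integral_normal_pdf mule1.
- apply/measurable_EFinP; exact: measurable_normal_pdf.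
- by move=> x _; rewrite lee_fin normal_pdf_ge0.
- by rewrite lee_fin divr_ge0// ltW.
Qed.

Lemma integral_leb_gauss (t : R) : 0 < t ->
  (\int[leb]_x (expR (- (t * x ^+ 2) / 2))%:E = (cpi * Num.sqrt t)^-1%:E)%E.
Proof.
move=> t0; have st : 0 < Num.sqrt t by rewrite sqrtr_gt0.
transitivity (\int[leb]_x (expR (- (x - 0) ^+ 2 / (2 * (Num.sqrt t)^-1 ^+ 2)))%:E)%E.
  apply: eq_integral => x _; congr (EFin (expR _)).
  by rewrite exprVn sqr_sqrtr ?ltW// subr0; field; rewrite gt_eqF.
rewrite integral_gauss_bump ?invr_gt0//; congr EFin.
by rewrite invfM mulrC.
Qed.

(** Negative values of [b] supply the exponential moments of c Z^2 for c < 1/2. *)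
Lemma integral_gam_gauss (b : R) : -1 < b ->
  (\int[gam]_z (expR (- (b * z ^+ 2) / 2))%:E = (Num.sqrt (1 + b))^-1%:E)%E.
Proof.
move=> b1; have b0 : 0 < 1 + b by lra.
have st : 0 < Num.sqrt (1 + b) by rewrite sqrtr_gt0.
have c0 := @cpi_gt0 R.
rewrite integral_gamE; last 2 first.
- mfun.
- by move=> x; rewrite lee_fin expR_ge0.
transitivity (cpi%:E * \int[leb]_x (expR (- ((1 + b) * x ^+ 2) / 2))%:E)%E.
  rewrite -ge0_integralZl//; last 2 first.
  - mfun.
  - by rewrite lee_fin ltW.
  apply: eq_integral => x _; rewrite -!EFinM mulrCA -expRD.
  by congr (EFin (_ * expR _)); field.
rewrite integral_leb_gauss// -EFinM; congr EFin.
by rewrite invfM mulrA divff ?gt_eqF// mul1r.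
Qed.

(* The density of N(0,t) up to the constant [cpi]; it dominates an indicator near 0 and is
   stable under Gaussian averaging. *)
Definition kt (t y : R) : R := (Num.sqrt t)^-1 * expR (- y ^+ 2 / (2 * t)).

Lemma kt_ge0 t y : 0 <= kt t y.
Proof. by rewrite mulr_ge0 ?expR_ge0// invr_ge0. Qed.

Lemma measurable_kt t : measurable_fun [set: TR] (kt t).
Proof. rewrite /kt; mfun. Qed.

(** Completing the square in the product of two Gaussian exponents: variances add, as in a
    convolution of normal laws. *)
Lemma integral_gam_kt (t m a : R) : 0 < t ->
  (\int[gam]_z (kt t (m + a * z)%R)%:E = (kt (t + a ^+ 2) m)%:E)%E.
Proof.
move=> t0; have t1 : 0 < t + a ^+ 2 by rewrite ltr_pwDl// sqr_ge0.
have c0 := @cpi_gt0 R.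
have st : 0 < Num.sqrt t by rewrite sqrtr_gt0.
have st1 : 0 < Num.sqrt (t + a ^+ 2) by rewrite sqrtr_gt0.
rewrite integral_gamE; last 2 first.
- apply/measurable_EFinP; apply: (measurableT_comp (measurable_kt t)).
  by apply: measurable_funD => //; exact: measurable_funM.
- by move=> x; rewrite lee_fin kt_ge0.
pose s := Num.sqrt t / Num.sqrt (t + a ^+ 2).
have s0 : 0 < s by rewrite divr_gt0.
have s2 : s ^+ 2 = t / (t + a ^+ 2).
  by rewrite /s expr_div_n !sqr_sqrtr// ltW.
pose K := (Num.sqrt t)^-1 * expR (- m ^+ 2 / (2 * (t + a ^+ 2))) * cpi.
have K0 : 0 <= K by rewrite !mulr_ge0 ?expR_ge0 ?invr_ge0// ltW.
transitivity (K%:E * \int[leb]_x (expR (- (x - (- (m * a / (t + a ^+ 2)))) ^+ 2 / (2 * s ^+ 2)))%:E)%E.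
  rewrite -ge0_integralZl//; last by mfun.
  apply: eq_integral => x _; rewrite -!EFinM /kt /K; congr EFin.
  set e1 := expR (- (m + a * x) ^+ 2 / _); set e2 := expR (- x ^+ 2 / 2).
  set e3 := expR (- m ^+ 2 / _); set e4 := expR _.
  have e12 : e1 * e2 = e3 * e4.
    rewrite /e1 /e2 /e3 /e4 -!expRD; congr expR; rewrite s2; field.
    by rewrite !gt_eqF.
  transitivity ((Num.sqrt t)^-1 * cpi * (e1 * e2)); first by field; rewrite gt_eqF.
  by rewrite e12; field; rewrite gt_eqF.
rewrite integral_gauss_bump// -EFinM; congr EFin; rewrite /K /kt /s.
by field; rewrite !gt_eqF.
Qed.

End GaussianIntegrals2.

Section BoundedIntegrals.
Context d (T : measurableType d) (R : realType) (P : probability T R).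
Implicit Types f g : T -> R.

Lemma integrable_bounded f (M : R) : measurable_fun setT f ->
  (forall x, `|f x| <= M) -> P.-integrable setT (EFin \o f).
Proof.
move=> mf fM; apply: measurable_bounded_integrable => //.
  by rewrite (le_lt_trans (probability_le1 _ _))// ltry.
exists M; split; first exact: num_real.
by move=> x Mx y _ /=; apply: (le_trans (fM y)); exact: ltW.
Qed.

Lemma EFin_Rintegral f : P.-integrable setT (EFin \o f) ->
  (\int[P]_x (f x)%:E)%E = (\int[P]_x f x)%:E.
Proof. by move=> If; rewrite fineK//; exact: integrable_fin_num. Qed.

Lemma Rintegral_prob_cst (r : R) : \int[P]_x r = r.
Proof.
rewrite Rintegral_cst//; have := @probability_setT _ _ _ P => /= ->.
by rewrite mulr1.
Qed.

Lemma Rintegral_norm_le f g : P.-integrable setT (EFin \o f) ->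
  P.-integrable setT (EFin \o g) -> (forall x, `|f x| <= g x) ->
  `|\int[P]_x f x| <= \int[P]_x g x.
Proof.
move=> If Ig fg; apply: le_trans (le_normr_Rintegral measurableT If) _.
by apply: le_Rintegral => //; exact: integrable_norm.
Qed.

End BoundedIntegrals.

(** * Taylor bounds for the cosine and the exponential *)

Section ElementaryInequalities.
Context {R : realType}.
Implicit Types x y : R.

(** One integration step by the mean value theorem. Each bound of the chain below, from sin x <= x
    to the fourth-order bound on cos, has the previous one as its derivative. *)
Lemma derive_ge0_ge0 (f g : R -> R) : (forall x, is_derive x 1 f (g x)) ->
  (forall x, 0 <= x -> 0 <= g x) -> f 0 = 0 -> forall x, 0 <= x -> 0 <= f x.
Proof.
move=> df g0 f0 x; rewrite le_eqVlt => /predU1P[<-|x0]; first by rewrite f0.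
have [c /[!in_itv]/= /andP[c0 cx]] := @MVT_segment _ f g 0 x (ltW x0) (fun y _ => df y)
  (continuous_subspaceT (fun y => differentiable_continuous (proj1 (derivable1_diffP _ _) (@ex_derive _ _ _ _ _ _ _ (df y))))).
by rewrite f0 !subr0 => ->; rewrite mulr_ge0// ?g0// ltW.
Qed.

Let dD (f g : R -> R) x a b : is_derive x 1 f a -> is_derive x 1 g b ->
  is_derive x 1 (fun y => f y + g y) (a + b).
Proof. by move=> df dg; exact: is_deriveD. Qed.

Let dN (f : R -> R) x a : is_derive x 1 f a -> is_derive x 1 (fun y => - f y) (- a).
Proof. by move=> df; exact: is_deriveN. Qed.

Let dC (c : R) x : is_derive x 1 (fun _ : R => c) (0 : R).
Proof. exact: is_derive_cst. Qed.

Let dI x : is_derive x 1 (fun y : R => y) (1 : R).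
Proof. exact: is_derive_id. Qed.

Let dXn (n : nat) (c : R) x :
  is_derive x 1 (fun y => y ^+ n.+1 / c) (n.+1%:R * x ^+ n / c).
Proof.
have -> : (fun y : R => y ^+ n.+1 / c) = c^-1 *: (@id R) ^+ n.+1.
  by apply/funext => y; rewrite /= fctE mulrC.
apply: is_derive_eq; rewrite scaler1 -mulr_natl.
by rewrite /GRing.scale/= mulrC.
Qed.

Lemma subr_sin_ge0 x : 0 <= x -> 0 <= x - sin x.
Proof.
apply: (@derive_ge0_ge0 (fun y => y - sin y) (fun y => 1 - cos y)).
- by move=> y _; rewrite subr_ge0 cos_le1.
- by rewrite sin0 subr0.
Qed.

Lemma cos_ge x : 0 <= x ^+ 2 / 2 + (cos x - 1).
Proof.
wlog x0 : x / 0 <= x.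
  move=> H; have [/H//|x0] := leP 0 x.
  by rewrite -cosN -sqrrN H// oppr_ge0 ltW.
move: x x0; apply: (@derive_ge0_ge0 _ (fun y => y - sin y)).
- move=> y; rewrite (_ : y - sin y = 2%:R * y ^+ 1 / 2 + (- sin y + - 0)).
    exact: (dD (dXn 1 2 y) (dD (is_derive_cos y) (dN (dC 1 y)))).
  by rewrite expr1; field.
- by move=> y; exact: subr_sin_ge0.
- by rewrite cos0 expr0n/=; lra.
Qed.

Lemma sin_ge x : 0 <= x -> 0 <= x ^+ 3 / 6 + (sin x - x).
Proof.
move: x; apply: (@derive_ge0_ge0 _ (fun y => y ^+ 2 / 2 + (cos y - 1))).
- move=> y; rewrite (_ : _ + (_ - 1) = 3%:R * y ^+ 2 / 6 + (cos y + - 1)).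
    exact: (dD (dXn 2 6 y) (dD (is_derive_sin y) (dN (dI y)))).
  by field.
- by move=> y _; exact: cos_ge.
- by rewrite sin0 expr0n/=; lra.
Qed.

Lemma cos_le x : 0 <= x ^+ 4 / 24 + (- (x ^+ 2 / 2) + (1 - cos x)).
Proof.
wlog x0 : x / 0 <= x.
  move=> H; have [/H//|x0] := leP 0 x.
  have := H (- x); rewrite cosN sqrrN (_ : (- x) ^+ 4 = x ^+ 4); last by ring.
  apply.
  by rewrite oppr_ge0 ltW.
move: x x0; apply: (@derive_ge0_ge0 _ (fun y => y ^+ 3 / 6 + (sin y - y))).
- move=> y; rewrite (_ : _ + (sin y - y) =
      4%:R * y ^+ 3 / 24 + (- (2%:R * y ^+ 1 / 2) + (0 + - - sin y))).
    exact: (dD (dXn 3 24 y) (dD (dN (dXn 1 2 y))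
      (dD (dC 1 y) (dN (is_derive_cos y))))).
  by rewrite expr1; field.
- by move=> y; exact: sin_ge.
- by rewrite cos0 expr0n/=; lra.
Qed.

Lemma cos_taylor x : `|cos x - 1 + x ^+ 2 / 2| <= x ^+ 4.
Proof.
have := cos_ge x; have := cos_le x; have : 0 <= x ^+ 4 by rewrite exprn_even_ge0.
set a := x ^+ 4; set b := x ^+ 2 => a0 h1 h2.
by rewrite ler_norml; apply/andP; split; lra.
Qed.

Lemma expRN_taylor x : 0 <= x -> `|expR (- x) - 1 + x| <= x ^+ 2.
Proof.
move=> x0; rewrite ger0_norm; last first.
  by have := expR_ge1Dx (- x); lra.
suff : expR (- x) <= 1 + x ^+ 2 - x by lra.
(* exp x >= (1 + x / 2)^2 turns the claim into a polynomial inequality. *)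
have e0 := expR_gt0 x; have e1 : (1 + x / 2) ^+ 2 <= expR x.
  have -> : expR x = expR (x / 2) ^+ 2 by rewrite -expRM_natl; congr expR; field.
  by rewrite ler_pXn2r ?nnegrE ?expR_ge0 ?addr_ge0 ?divr_ge0// expR_ge1Dx.
rewrite expRN -[leLHS]mul1r ler_pdivrMr//.
have h : 0 <= 1 + x ^+ 2 - x by nra.
have h2 : 1 <= (1 + x ^+ 2 - x) * (1 + x / 2) ^+ 2.
  rewrite (_ : _ * _ = 1 + (x ^+ 2 / 4 + 3 / 4 * x ^+ 3 + x ^+ 4 / 4)); last by field.
  by rewrite lerDl !addr_ge0// ?mulr_ge0// exprn_ge0.
by apply: (le_trans h2); rewrite ler_wpM2l.
Qed.
End ElementaryInequalities.

Section IntegrableReal.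
Context d (T : measurableType d) (R : realType) (mu : {measure set T -> \bar R}).
Implicit Types f g : T -> R.

Lemma integrable_EFinD f g : mu.-integrable setT (EFin \o f) ->
  mu.-integrable setT (EFin \o g) -> mu.-integrable setT (EFin \o (fun x => f x + g x)).
Proof. by move=> If Ig; have := integrableD measurableT If Ig; apply: eq_integrable. Qed.

Lemma integrable_EFinB f g : mu.-integrable setT (EFin \o f) ->
  mu.-integrable setT (EFin \o g) -> mu.-integrable setT (EFin \o (fun x => f x - g x)).
Proof. by move=> If Ig; have := integrableB measurableT If Ig; apply: eq_integrable. Qed.

Lemma integrable_EFinZ (c : R) f : mu.-integrable setT (EFin \o f) ->
  mu.-integrable setT (EFin \o (fun x => c * f x)).
Proof. by move=> If; have := integrableZl measurableT c If; apply: eq_integrable. Qed.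

End IntegrableReal.

Arguments gam {R} : simpl never.

(** * Moments and characteristic function of the standard normal law *)

Section GaussianMoments.
Context {R : realType}.
Notation TR := (measurableTypeR R).
Notation gam := (@gam R).

(** Two uses of [gam_rotation]: the first turns g of the second coordinate into g ((v - u) / sqrt
    2), the second turns this into g (- u). *)
Lemma gam_sym (g : TR -> \bar R) : measurable_fun setT g -> (forall x, 0 <= g x)%E ->
  (\int[gam]_x g x = \int[gam]_x g (- x)%R)%E.
Proof.
move=> mg g0.
have E0 (h : TR -> \bar R) : (\int[gam]_x h x = \int[gam]_u \int[gam]_v (h u))%E.
  apply: eq_integral => x _; rewrite integral_cst//.
  by have := @probability_setT _ _ _ gam => /= ->; rewrite mule1.
have mN : measurable_fun [set: TR] (fun x : TR => g (- x)%R).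
  by apply: (measurableT_comp mg); mfun.
have mF1 : measurable_fun setT (fun p : TR * TR => g p.1) by exact: (measurableT_comp mg).
rewrite E0 (tonelli gam gam mF1 (fun p => g0 _)) /=.
have mF : measurable_fun setT (fun p : TR * TR => g p.2) by exact: (measurableT_comp mg).
rewrite (gam_rotation mF (fun p => g0 _)) /=.
pose G (p : TR * TR) : \bar R := g ((p.2 - p.1) / Num.sqrt 2)%R.
have mG : measurable_fun setT G.
  by apply: (measurableT_comp mg); mfun.
rewrite (gam_rotation mG (fun p => g0 _)) /= [RHS]E0.
apply: eq_integral => u _; apply: eq_integral => v _; rewrite /G/=; congr g.
have r20 : 0 < Num.sqrt 2 :> R by rewrite sqrtr_gt0.
have r22 : Num.sqrt 2 ^+ 2 = 2 :> R by rewrite sqr_sqrtr.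
apply: (@mulIf _ (Num.sqrt 2 ^+ 2)); first by rewrite r22.
by rewrite {2}r22; field; rewrite gt_eqF.
Qed.

Lemma gam_integrable_pow4 : gam.-integrable setT (fun z => (z ^+ 4)%:E).
Proof.
apply/integrableP; split; first by mfun.
(* z^4 = 16 (z^2 / 4)^2, and w^2 <= 2 exp w for w = z^2 / 4. *)
apply: (@le_lt_trans _ _ (\int[gam]_z (32%:E * (expR (- (- (1/2) * z ^+ 2) / 2))%:E)))%E.
  apply: ge0_le_integral => //; [by apply: measurableT_comp => //; mfun|by mfun|].
  move=> z _; rewrite abse_EFin -EFinM lee_fin ger0_norm ?exprn_even_ge0//.
  have z0 : 0 <= z ^+ 2 / 4 by rewrite mulr_ge0// sqr_ge0.
  have := expR_ge1Dxn 1 z0; rewrite (_ : - (- (1/2) * z ^+ 2) / 2 = z ^+ 2 / 4); last by field.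
  set w := expR _; rewrite (_ : (2`!)%:R = 2)//.
  rewrite (_ : z ^+ 4 = (z ^+ 2 / 4) ^+ 2 * 16); last by field.
  by lra.
rewrite ge0_integralZl//; last by mfun.
by rewrite integral_gam_gauss ?ltrN2//; [rewrite -EFinM ltry | lra].
Qed.

Definition gM4 : R := \int[gam]_z (z ^+ 4).

Lemma gM4_ge0 : 0 <= gM4.
Proof. by apply: Rintegral_ge0 => z _; rewrite exprn_even_ge0. Qed.

Lemma gam_integrable_pow2 : gam.-integrable setT (fun z => (z ^+ 2)%:E).
Proof.
have I1 : gam.-integrable setT (fun z : R => (1 + z ^+ 4)%:E).
  apply: (@integrable_EFinD _ _ _ gam (cst 1)); last exact: gam_integrable_pow4.
  by apply: (@integrable_bounded _ _ _ _ _ 1) => // x; rewrite normr1.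
apply: (le_integrable measurableT _ _ I1); first by mfun.
move=> z _; rewrite !abse_EFin lee_fin !ger0_norm ?addr_ge0 ?exprn_even_ge0//.
by rewrite (_ : z ^+ 4 = (z ^+ 2) ^+ 2); [nra | ring].
Qed.

(** The identity E exp (- b Z^2 / 2) = (1 + b)^(-1/2) is expanded to first order in b on both sides,
    with errors O(b^2); the coefficients of b must agree. *)
Lemma gam_var : \int[gam]_z (z ^+ 2) = 1.
Proof.
set v := \int[_]_z _.
have key (b : R) : 0 < b -> `|(Num.sqrt (1 + b))^-1 - 1 + b / 2 * v| <= b ^+ 2 * gM4.
  move=> b0.
  have i1 : gam.-integrable setT (EFin \o (fun z : R => expR (- (b * z ^+ 2) / 2))).
    apply: (@integrable_bounded _ _ _ _ _ 1); first by mfun.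
    move=> z; rewrite ger0_norm ?expR_ge0// expR_le1 mulNr oppr_le0 divr_ge0//.
    by rewrite mulr_ge0 ?sqr_ge0// ltW.
  have i2 : gam.-integrable setT (EFin \o (fun z : R => 1)).
    by apply: (@integrable_bounded _ _ _ _ _ 1) => // z; rewrite normr1.
  have i3 : gam.-integrable setT (EFin \o (fun z : R => b / 2 * z ^+ 2)).
    exact: (integrable_EFinZ _ gam_integrable_pow2).
  have -> : (Num.sqrt (1 + b))^-1 - 1 + b / 2 * v =
      \int[gam]_z (expR (- (b * z ^+ 2) / 2) - 1 + b / 2 * z ^+ 2).
    rewrite RintegralD//; last by apply: integrable_EFinB.
    rewrite RintegralB// RintegralZl//; last exact: gam_integrable_pow2.
    by rewrite Rintegral_prob_cst /Rintegral integral_gam_gauss//; lra.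
  have -> : b ^+ 2 * gM4 = \int[gam]_z (b ^+ 2 * z ^+ 4).
    by rewrite RintegralZl//; exact: gam_integrable_pow4.
  apply: Rintegral_norm_le.
  - by apply: integrable_EFinD => //; apply: integrable_EFinB.
  - exact: (integrable_EFinZ _ gam_integrable_pow4).
  - move=> z; have z0 : 0 <= b / 2 * z ^+ 2.
      by rewrite mulr_ge0 ?sqr_ge0// divr_ge0// ltW.
    have := expRN_taylor z0; rewrite (_ : - (b / 2 * z ^+ 2) = - (b * z ^+ 2) / 2); last by field.
    move=> /le_trans; apply; rewrite exprMn -exprM ler_wpM2r ?exprn_even_ge0//.
    by rewrite expr_div_n; have := sqr_ge0 b; lra.
have sq (b : R) : 0 < b -> `|(Num.sqrt (1 + b))^-1 - 1 + b / 2| <= b ^+ 2.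
  move=> b0; set s := Num.sqrt _.
  have s2 : s ^+ 2 = 1 + b by rewrite sqr_sqrtr//; lra.
  have s0 : 0 <= s by exact: sqrtr_ge0.
  have s1 : 1 <= s by rewrite -(@ler_pXn2r _ 2)// ?nnegrE// s2 expr1n; lra.
  have be : b = (s - 1) * (s + 1) by rewrite (_ : b = s ^+ 2 - 1); [ring|lra].
  have -> : s^-1 - 1 + b / 2 = (s - 1) ^+ 2 * ((s + 2) / (2 * s)).
    by rewrite be; field; lra.
  have h1 : 0 <= (s + 2) / (2 * s) <= 2.
    by rewrite divr_ge0 ?ler_pdivrMr//=; lra.
  have [h2 h3] := andP h1.
  have h4 : 0 <= (s - 1) ^+ 2 * ((s + 2) / (2 * s)) by rewrite mulr_ge0// sqr_ge0.
  have -> : b ^+ 2 = (s - 1) ^+ 2 * (s + 1) ^+ 2 by rewrite be exprMn.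
  rewrite (ger0_norm h4) ler_wpM2l ?sqr_ge0//.
  by nra.
have M0 := gM4_ge0.
apply/eqP; rewrite -subr_eq0 -normr_eq0; apply/eqP/le_anti; rewrite normr_ge0 andbT.
set w := `|v - 1|.
have w0 : 0 <= w by exact: normr_ge0.
rewrite leNgt; apply/negP => w1.
(* At this value of b the two expansions would give [w <= w / 2]. *)
have b0 : 0 < w / (4 * (gM4 + 1)) by rewrite divr_gt0// mulr_gt0//; lra.
have /ler_normlP[k1 k2] := key _ b0.
have /ler_normlP[k3 k4] := sq _ b0.
set b := w / _ in b0 k1 k2 k3 k4.
have k5 : b * w <= b ^+ 2 * (2 * (gM4 + 1)).
  rewrite /w; case: (lerP 0 (v - 1)) => hv; first by rewrite ger0_norm//; nra.
  by rewrite ltr0_norm//; nra.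
have k6 : w <= b * (2 * (gM4 + 1)) by rewrite -(ler_pM2l b0); nra.
have k7 : b * (2 * (gM4 + 1)) = w / 2 by rewrite /b; field; lra.
by move: k6; rewrite k7; lra.
Qed.

End GaussianMoments.

Lemma integral_prob_cst d (T : measurableType d) (R : realType) (P : probability T R)
  (r : \bar R) : (\int[P]_x r = r)%E.
Proof.
rewrite integral_cst//; have := @probability_setT _ _ _ P => /= ->.
by rewrite mule1.
Qed.

Section GaussianCos.
Context {R : realType}.
Notation TR := (measurableTypeR R).
Notation gam := (@gam R).

Lemma gam_sin t : \int[gam]_z sin (t * z) = 0.
Proof.
have ms : measurable_fun [set: TR] (fun z : R => sin (t * z)).
  apply: measurableT_comp; last by mfun.
  by apply: continuous_measurable_fun; exact: continuous_sin.
have i1 : gam.-integrable setT (EFin \o (fun z : R => sin (t * z))).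
  by apply: (@integrable_bounded _ _ _ _ _ 1) => // z; rewrite ler_norml sin_geN1 sin_le1.
have i0 : gam.-integrable setT (EFin \o (fun z : R => 1)).
  by apply: (@integrable_bounded _ _ _ _ _ 1) => // z; rewrite normr1.
have i2 : gam.-integrable setT (EFin \o (fun z : R => 1 + sin (t * z))).
  exact: integrable_EFinD.
have i3 : gam.-integrable setT (EFin \o (fun z : R => 1 - sin (t * z))).
  exact: integrable_EFinB.
(* Adding 1 makes the integrand nonnegative, as [gam_sym] requires; the same device serves for cos
   and [gam_rotation] below. *)
have : \int[gam]_z (1 + sin (t * z)) = \int[gam]_z (1 - sin (t * z)).
  congr fine; rewrite gam_sym.
  - by apply: eq_integral => z _; rewrite mulrN sinN.
  - by apply/measurable_EFinP; apply: measurable_funD.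
  - by move=> z; rewrite lee_fin -lerBlDl sub0r sin_geN1.
by rewrite RintegralD// RintegralB//; lra.
Qed.

Lemma gam_integrable_cos t a : gam.-integrable setT (EFin \o (fun z : R => cos (a + t * z))).
Proof.
apply: (@integrable_bounded _ _ _ _ _ 1).
  apply: (measurableT_comp (continuous_measurable_fun (@continuous_cos R))).
  by mfun.
by move=> z; rewrite ler_norml cos_geN1 cos_le1.
Qed.

Lemma gam_integrable_sin t : gam.-integrable setT (EFin \o (fun z : R => sin (t * z))).
Proof.
apply: (@integrable_bounded _ _ _ _ _ 1).
  apply: (measurableT_comp (continuous_measurable_fun (@continuous_sin R))).
  by mfun.
by move=> z; rewrite ler_norml sin_geN1 sin_le1.
Qed.

Let c t := \int[gam]_z cos (t * z).

Let cosI t : gam.-integrable setT (EFin \o (fun z : R => cos (t * z))).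
Proof.
have := gam_integrable_cos t 0; apply: eq_integrable => // z _ /=.
by rewrite add0r.
Qed.

Let cos_shift t a : \int[gam]_z cos (a + t * z) = cos a * c t.
Proof.
transitivity (\int[gam]_z (cos a * cos (t * z) - sin a * sin (t * z))).
  by apply: eq_Rintegral => z _; rewrite cosD.
rewrite RintegralB//.
- by rewrite !RintegralZl ?gam_sin ?mulr0 ?subr0//; exact: gam_integrable_sin.
- exact: integrable_EFinZ.
- by apply: integrable_EFinZ; exact: gam_integrable_sin.
Qed.

(** The rotation turns cos (t x) into cos (t' u + t' v) with t' = t / sqrt 2, and each of the two
    integrations contributes a factor [c t'] through [cos_shift]. *)
Let c_half t : c t = c (t / Num.sqrt 2) ^+ 2.
Proof.
set t' := t / _.
have mc : measurable_fun [set: TR] (@cos R) by exact: continuous_measurable_fun (@continuous_cos R).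
have i0 : gam.-integrable setT (EFin \o (fun z : R => 1)).
  by apply: (@integrable_bounded _ _ _ _ _ 1) => // z; rewrite normr1.
pose f (p : TR * TR) : \bar R := (1 + cos (t * p.1))%:E.
have mf : measurable_fun setT f.
  by apply/measurable_EFinP; apply: measurable_funD => //; apply: (measurableT_comp mc); mfun.
have f0 p : (0 <= f p)%E by rewrite lee_fin -lerBlDl sub0r cos_geN1.
have i1 : gam.-integrable setT (EFin \o (fun z : R => 1 + cos (t * z))).
  exact: integrable_EFinD.
transitivity (fine (\int[gam]_x \int[gam]_y f (x, y))%E - 1).
  rewrite (eq_integral (fun x : TR => (1 + cos (t * x))%:E)).
    rewrite -/(Rintegral _ _ _) RintegralD// Rintegral_prob_cst; first by rewrite addrC addKr.
  by move=> x _; exact: (integral_prob_cst gam (1 + cos (t * x))%:E).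
rewrite (gam_rotation mf f0).
rewrite (eq_integral (fun u : TR => (1 + cos (t' * u) * c t')%:E)).
  rewrite -/(Rintegral _ _ _) RintegralD//; last first.
    have := integrable_EFinZ (c t') (cosI t'); apply: eq_integrable => // z _ /=.
    by rewrite mulrC.
  by rewrite Rintegral_prob_cst RintegralZr// addrC addKr expr2.
move=> u _; rewrite (eq_integral (fun v : TR => (1 + cos (t' * u + t' * v))%:E)).
  rewrite EFin_Rintegral; last first.
    by apply: integrable_EFinD => //; exact: gam_integrable_cos.
  rewrite RintegralD// ?Rintegral_prob_cst ?cos_shift//.
  exact: gam_integrable_cos.
by move=> v _; rewrite /f/= /t'; congr (EFin (1 + cos _)); ring.
Qed.

(** The characteristic function and exp (- t^2 / 2) both satisfy f t = f (t / sqrt 2)^2 and differ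
    by O(t^4). One use of this equation at most doubles the error and divides t^4 by 4, so the
    constant is halved at each iteration and the difference vanishes. *)
Lemma gam_cos a t : \int[gam]_z cos (a + t * z) = cos a * expR (- t ^+ 2 / 2).
Proof.
rewrite cos_shift; congr (_ * _).
pose K := @gM4 R + 1.
have K0 : 0 < K by have := @gM4_ge0 R; rewrite /K; lra.
have c1 s : `|c s| <= 1.
  rewrite -[leRHS](Rintegral_prob_cst gam); apply: Rintegral_norm_le => //.
  - by apply: (@integrable_bounded _ _ _ _ _ 1) => // z; rewrite normr1.
  - by move=> z; rewrite ler_norml cos_geN1 cos_le1.
have e1 (s : R) : 0 <= expR (- s ^+ 2 / 2) <= 1.
  by rewrite expR_ge0 expR_le1 mulNr oppr_le0 divr_ge0// sqr_ge0.
have r22 : Num.sqrt 2 ^+ 2 = 2 :> R by rewrite sqr_sqrtr.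
have d0 s : `|c s - expR (- s ^+ 2 / 2)| <= K * s ^+ 4.
  have i0 : gam.-integrable setT (EFin \o (fun z : R => 1)).
    by apply: (@integrable_bounded _ _ _ _ _ 1) => // z; rewrite normr1.
  have i2 : gam.-integrable setT (EFin \o (fun z : R => s ^+ 2 / 2 * z ^+ 2)).
    exact: (integrable_EFinZ _ gam_integrable_pow2).
  have h1 : `|c s - 1 + s ^+ 2 / 2| <= s ^+ 4 * gM4.
    have -> : c s - 1 + s ^+ 2 / 2 =
        \int[gam]_z (cos (s * z) - 1 + s ^+ 2 / 2 * z ^+ 2).
      rewrite RintegralD//; last exact: integrable_EFinB.
      rewrite RintegralB// RintegralZl//; last exact: gam_integrable_pow2.
      by rewrite Rintegral_prob_cst gam_var mulr1.
    have -> : s ^+ 4 * gM4 = \int[gam]_z (s ^+ 4 * z ^+ 4).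
      by rewrite RintegralZl//; exact: gam_integrable_pow4.
    apply: Rintegral_norm_le.
    - by apply: integrable_EFinD => //; exact: integrable_EFinB.
    - exact: (integrable_EFinZ _ gam_integrable_pow4).
    - move=> z; have := cos_taylor (s * z); rewrite !exprMn => /(le_trans _); apply.
      by rewrite mulrAC.
  have s20 : 0 <= s ^+ 2 / 2 by rewrite divr_ge0// sqr_ge0.
  have := expRN_taylor s20; rewrite -mulNr => h2.
  have h3 : (s ^+ 2 / 2) ^+ 2 <= s ^+ 4.
    rewrite expr_div_n -exprM ler_pdivrMr//.
    by have : 0 <= s ^+ 4 by [rewrite exprn_even_ge0]; lra.
  have -> : c s - expR (- s ^+ 2 / 2) =
    (c s - 1 + s ^+ 2 / 2) - (expR (- s ^+ 2 / 2) - 1 + s ^+ 2 / 2) by lra.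
  by apply: (le_trans (ler_normB _ _)); rewrite /K; lra.
have dn n : forall s, `|c s - expR (- s ^+ 2 / 2)| <= K / 2 ^+ n * s ^+ 4.
  elim: n => [|n IH] s; first by rewrite expr0 divr1.
  pose s' := s / Num.sqrt 2.
  have -> : expR (- s ^+ 2 / 2) = expR (- s' ^+ 2 / 2) ^+ 2.
    rewrite -expRM_natl; congr expR; rewrite /s' expr_div_n r22; by field.
  rewrite c_half -/s' subr_sqr normrM.
  have h1 : `|c s' + expR (- s' ^+ 2 / 2)| <= 2.
    apply: (le_trans (ler_normD _ _)); have /andP[? ?] := e1 s'.
    by have := c1 s'; rewrite (ger0_norm (expR_ge0 _)); lra.
  have h2 := IH s'.
  have -> : K / 2 ^+ n.+1 * s ^+ 4 = (K / 2 ^+ n * s' ^+ 4) * 2.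
    rewrite /s' expr_div_n (_ : Num.sqrt 2 ^+ 4 = 4); last by rewrite (exprM _ 2 2) r22; ring.
    by rewrite exprS; field; rewrite expf_neq0.
  by apply: ler_pM.
apply/eqP; rewrite -subr_eq0 -normr_eq0; apply/eqP/le_anti; rewrite normr_ge0 andbT.
apply/ler_addgt0Pl => e e0; rewrite addr0.
have X0 : 0 <= K * t ^+ 4 / e.
  by apply: divr_ge0; [apply: mulr_ge0; [exact: ltW|exact: exprn_even_ge0]|exact: ltW].
have := archi_boundP X0; set n := Num.bound _ => hn.
apply: (le_trans (dn n t)).
have n2 : n%:R <= 2 ^+ n :> R by rewrite -natrX ler_nat ltnW// ltn_expl.
rewrite mulrAC ler_pdivrMr ?exprn_gt0// [leRHS]mulrC -ler_pdivrMr//.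
by apply: le_trans n2; exact: ltW.
Qed.
End GaussianCos.

(** * Sums of squares of shifted Gaussians and their concentration *)

Section Laws.
Context {R : realType}.
Notation TR := (measurableTypeR R).
Notation gam := (@gam R).
Implicit Types mu nu : probability TR R.

Definition addTR : TR * TR -> TR := fun p => (p.1 : R) + p.2.

Lemma measurable_addTR : measurable_fun setT addTR.
Proof. by rewrite /addTR; mfun. Qed.

HB.instance Definition _ := isMeasurableFun.Build _ _ _ _ addTR measurable_addTR.

Definition conv mu nu : probability TR R := distribution (mu \x nu)%E addTR.

Definition sqf (s a : R) : TR -> TR := fun z : R => (s * z - a) ^+ 2.

Lemma measurable_sqf (s a : R) : measurable_fun setT (sqf s a).
Proof. by rewrite /sqf; mfun. Qed.

HB.instance Definition _ (s a : R) :=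
  isMeasurableFun.Build _ _ _ _ (sqf s a) (measurable_sqf s a).

Definition law1 (p : R * R) : probability TR R := distribution gam (sqf p.1 p.2).

(* For independent standard normal Z_i, [law [:: (s_1, a_1); (s_2, a_2); ...]] is the
   distribution of the sum of the (s_i Z_i - a_i)^2. *)
Fixpoint law (l : seq (R * R)) : probability TR R :=
  if l is p :: l' then conv (law1 p) (law l') else \d_(0 : TR).

Lemma ge0_integral_conv mu nu (f : TR -> \bar R) : measurable_fun setT f ->
  (forall x, 0 <= f x)%E ->
  (\int[conv mu nu]_x f x = \int[mu]_x \int[nu]_y f (x + y)%R)%E.
Proof.
move=> mf f0; rewrite /conv ge0_integral_distribution//.
have mfa : measurable_fun setT (f \o addTR) by apply: measurableT_comp.
by rewrite fubini_tonelli1// => p; exact: f0.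
Qed.

Lemma ge0_integral_law1 p (f : TR -> \bar R) : measurable_fun setT f ->
  (forall x, 0 <= f x)%E ->
  (\int[law1 p]_x f x = \int[gam]_z f ((p.1 * z - p.2) ^+ 2)%R)%E.
Proof. by move=> mf f0; rewrite /law1 ge0_integral_distribution. Qed.

Lemma measurable_shiftR (f : TR -> \bar R) (x : R) : measurable_fun setT f ->
  measurable_fun setT (fun y : TR => f (x + y)%R).
Proof. by move=> mf; apply: (measurableT_comp mf); exact: measurable_funD. Qed.

Lemma measurable_shift2 (f : TR -> \bar R) : measurable_fun setT f ->
  measurable_fun setT (fun p : TR * TR => f (p.1 + p.2)%R).
Proof. by move=> mf; apply: (measurableT_comp mf); mfun. Qed.

Lemma measurable_int_shift nu (f : TR -> \bar R) : measurable_fun setT f ->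
  (forall x, 0 <= f x)%E ->
  measurable_fun setT (fun x : TR => \int[nu]_y f (x + y)%R)%E.
Proof.
move=> mf f0.
exact: (measurable_fun_fubini_tonelli_F _ (measurable_shift2 mf) (fun p => f0 _)).
Qed.

Lemma ge0_integral_convC mu nu (f : TR -> \bar R) : measurable_fun setT f ->
  (forall x, 0 <= f x)%E ->
  (\int[conv mu nu]_x f x = \int[conv nu mu]_x f x)%E.
Proof.
move=> mf f0; rewrite !ge0_integral_conv//.
rewrite (tonelli mu nu (measurable_shift2 mf) (fun p => f0 _)).
by apply: eq_integral => y _; apply: eq_integral => x _ /=; rewrite addrC.
Qed.

Lemma ge0_integral_law_cons p l (f : TR -> \bar R) : measurable_fun setT f ->
  (forall x, 0 <= f x)%E ->
  (\int[law (p :: l)]_x f x = \int[law1 p]_x \int[law l]_y f (x + y)%R)%E.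
Proof. exact: ge0_integral_conv. Qed.

Lemma ge0_integral_law_nil (f : TR -> \bar R) : measurable_fun setT f ->
  (forall x, 0 <= f x)%E -> (\int[law [::]]_x f x = f 0%R)%E.
Proof. by move=> mf f0; rewrite integral_dirac// diracT mul1e. Qed.

Lemma ge0_integral_law_cat l1 l2 (f : TR -> \bar R) : measurable_fun setT f ->
  (forall x, 0 <= f x)%E ->
  (\int[law (l1 ++ l2)]_x f x = \int[law l1]_x \int[law l2]_y f (x + y)%R)%E.
Proof.
elim: l1 f => [|p l1 IH] f mf f0 /=.
  rewrite [RHS]ge0_integral_law_nil.
  - by apply: eq_integral => y _; rewrite add0r.
  - exact: measurable_int_shift.
  - by move=> x; exact: integral_ge0.
have I0 x : (0 <= \int[law l2]_y f (x + y)%R)%E by exact: integral_ge0.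
rewrite (ge0_integral_conv _ _ mf f0).
rewrite (ge0_integral_conv _ _ (measurable_int_shift _ mf f0) I0).
apply: eq_integral => x _; rewrite (IH _ (measurable_shiftR x mf) (fun=> f0 _)).
by apply: eq_integral => y _; apply: eq_integral => z _; rewrite addrA.
Qed.

Lemma ge0_integral_law_catC l1 l2 (f : TR -> \bar R) : measurable_fun setT f ->
  (forall x, 0 <= f x)%E ->
  (\int[law (l1 ++ l2)]_x f x = \int[law (l2 ++ l1)]_x f x)%E.
Proof.
move=> mf f0; rewrite !ge0_integral_law_cat//.
rewrite (tonelli (law l1) (law l2) (measurable_shift2 mf) (fun p => f0 _)).
by apply: eq_integral => y _; apply: eq_integral => x _ /=; rewrite addrC.
Qed.

Lemma ge0_integral_law_perm l1 l2 (f : TR -> \bar R) : perm_eq l1 l2 ->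
  measurable_fun setT f -> (forall x, 0 <= f x)%E ->
  (\int[law l1]_x f x = \int[law l2]_x f x)%E.
Proof.
move=> pl mf f0; move: l1 l2 pl.
have H s1 s2 s3 : (\int[law (s1 ++ s2 ++ s3)]_x f x = \int[law (s2 ++ s1 ++ s3)]_x f x)%E.
  rewrite !catA ge0_integral_law_cat// [RHS]ge0_integral_law_cat//.
  rewrite ge0_integral_law_catC//; first exact: measurable_int_shift.
  by move=> x; exact: integral_ge0.
move=> l1 l2 pl.
apply: (@catCA_perm_ind _ (fun l => (\int[law l1]_x f x = \int[law l]_x f x)%E) _ _ _ pl erefl).
by move=> s1 s2 s3 ->; exact: H.
Qed.
End Laws.

(** * Concentration produced by one or two large coordinates *)

Section Concentration.
Context {R : realType}.
Notation leb := (@lebesgue_measure R).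
Notation TR := (measurableTypeR R).
Notation gam := (@gam R).
Implicit Types mu nu : probability TR R.

Lemma prob_indic d (T : measurableType d) (mu : probability T R) (A : set T) :
  measurable A -> mu A = (\int[mu]_x (\1_A x)%:E)%E.
Proof. by move=> mA; rewrite integral_indic// setIT. Qed.

Lemma measurable_EFin_indic d (T : measurableType d) (A : set T) :
  measurable A -> measurable_fun setT (fun x => (\1_A x : R)%:E).
Proof. by move=> mA; apply/measurable_EFinP; exact: measurable_indic. Qed.

Lemma indic_ge0 (T : Type) (A : set T) x : (0 <= (\1_A x : R)%:E)%E.
Proof. by rewrite lee_fin. Qed.

(** A linear bound on the Levy concentration function, equivalent to a density bounded by [M]; the
    formulation by intervals spares the construction of densities of convolutions. *)
Definition conc mu (M : R) : Prop :=
  forall x h : R, 0 < h -> (mu `[x, (x + h)%R]%classic <= (M * h)%:E)%E.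

Lemma convE mu nu (A : set TR) : measurable A ->
  conv mu nu A = (\int[mu]_x \int[nu]_y (\1_A (x + y)%R)%:E)%E.
Proof.
move=> mA; rewrite prob_indic// ge0_integral_conv//.
exact: measurable_EFin_indic.
Qed.

Lemma convEC mu nu (A : set TR) : measurable A ->
  conv mu nu A = (\int[nu]_x \int[mu]_y (\1_A (x + y)%R)%:E)%E.
Proof.
move=> mA; rewrite prob_indic// ge0_integral_convC//; last exact: measurable_EFin_indic.
by rewrite ge0_integral_conv//; exact: measurable_EFin_indic.
Qed.

Lemma indic_shift_itv (x y w z : R) :
  \1_(`[x, y]%classic) (w + z) = \1_(`[(x - w)%R, (y - w)%R]%classic) z :> R.
Proof.
rewrite !indicE !mem_setE !in_itv/=; congr (_%:R); congr (nat_of_bool _).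
by rewrite lerBlDl lerBrDl.
Qed.

Lemma integral_indic_shift mu (x y w : R) :
  (\int[mu]_z (\1_(`[x, y]%classic) (w + z)%R)%:E = mu `[(x - w)%R, (y - w)%R]%classic)%E.
Proof.
rewrite prob_indic//; apply: eq_integral => z _.
by rewrite indic_shift_itv.
Qed.

Lemma measurable_int_indic nu (A : set TR) : measurable A ->
  measurable_fun setT (fun x : TR => \int[nu]_y (\1_A (x + y)%R)%:E)%E.
Proof.
move=> mA.
exact: (@measurable_int_shift _ nu (fun y => (\1_A y)%:E) (measurable_EFin_indic mA) (@indic_ge0 _ A)).
Qed.

Lemma le_integral_prob_cst d (T : measurableType d) (mu : probability T R) (f : T -> \bar R) (c : \bar R) :
  measurable_fun setT f -> (forall x, 0 <= f x)%E -> (forall x, f x <= c)%E ->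
  (\int[mu]_x f x <= c)%E.
Proof.
move=> mf f0 fc; rewrite -[leRHS](integral_prob_cst mu).
by apply: ge0_le_integral => //; move=> x _; exact: le_trans (f0 x) (fc x).
Qed.

Lemma conc_convr mu nu M : conc nu M -> conc (conv mu nu) M.
Proof.
move=> cM x h h0; rewrite convE//.
apply: le_integral_prob_cst.
- exact: measurable_int_indic.
- by move=> y; apply: integral_ge0 => z _; rewrite lee_fin.
- move=> y; rewrite integral_indic_shift addrAC; exact: cM.
Qed.

Lemma conc_convl mu nu M : conc mu M -> conc (conv mu nu) M.
Proof.
move=> cM x h h0; rewrite convEC//.
apply: le_integral_prob_cst.
- exact: measurable_int_indic.
- by move=> y; apply: integral_ge0 => z _; rewrite lee_fin.
- move=> y; rewrite integral_indic_shift addrAC; exact: cM.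
Qed.

Lemma conc_perm l1 l2 M : perm_eq l1 l2 -> conc (law l1) M -> conc (law l2) M.
Proof.
move=> pl cM x h h0; rewrite prob_indic// -(ge0_integral_law_perm pl)//.
  by rewrite -prob_indic//; exact: cM.
exact: measurable_EFin_indic.
Qed.

Lemma conc_le mu M M' : M <= M' -> conc mu M -> conc mu M'.
Proof.
move=> MM cM x h h0; apply: (le_trans (cM x h h0)).
by rewrite lee_fin ler_wpM2r// ltW.
Qed.

Lemma law_catE l1 l2 (A : set TR) : measurable A -> law (l1 ++ l2) A = conv (law l1) (law l2) A.
Proof.
move=> mA; have mI := measurable_EFin_indic mA.
rewrite !prob_indic// (ge0_integral_law_cat _ _ mI (@indic_ge0 _ A)).
by rewrite (ge0_integral_conv _ _ mI (@indic_ge0 _ A)).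
Qed.

Lemma conc_catr l1 l2 M : conc (law l2) M -> conc (law (l1 ++ l2)) M.
Proof. by move=> c x h h0; rewrite law_catE//; exact: conc_convr. Qed.

Lemma conc_catl l1 l2 M : conc (law l1) M -> conc (law (l1 ++ l2)) M.
Proof. by move=> c x h h0; rewrite law_catE//; exact: conc_convl. Qed.

Lemma gam_itv_le (u v : R) : u <= v -> (gam `[u, v]%classic <= (v - u)%:E)%E.
Proof.
move=> uv; rewrite /gam/= /normal_prob.
apply: (@le_trans _ _ (\int[leb]_(x in `[u, v]%classic) 1%:E)%E).
  apply: ge0_le_integral => //.
  - by move=> x _; rewrite lee_fin normal_pdf_ge0.
  - by apply/measurable_EFinP; apply: measurable_funTS; exact: measurable_normal_pdf.
  - move=> x _; rewrite lee_fin normal_pdf01.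
    apply: mulr_ile1; [exact/ltW/cpi_gt0|exact: expR_ge0|exact/ltW/cpi_lt1|].
    by rewrite expR_le1 mulNr oppr_le0 divr_ge0// sqr_ge0.
rewrite integral_cst//= mul1e lebesgue_measure_itv/= lte_fin.
case: ifPn => // _; last by rewrite lee_fin subr_ge0.
Qed.

(** The preimage lies in two intervals of length (sqrt w - sqrt y) / s, and the normal density is
    below 1. The square roots are kept because near 0 the mass of [0, t] is only O(sqrt t). *)
Lemma law1_itv_le (s a y w : R) : 0 < s -> 0 <= y -> y <= w ->
  (law1 (s, a) `[y, w]%classic <= (2 * (Num.sqrt w - Num.sqrt y) / s)%:E)%E.
Proof.
move=> s0 y0 yw.
have syw : Num.sqrt y <= Num.sqrt w by rewrite ler_wsqrtr.
rewrite /law1/= /distribution /pushforward/=.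
apply: (@le_trans _ _ (gam (`[((a + Num.sqrt y) / s)%R, ((a + Num.sqrt w) / s)%R]%classic `|`
  `[((a - Num.sqrt w) / s)%R, ((a - Num.sqrt y) / s)%R]%classic))).
  apply: le_measure; rewrite ?inE//.
  - rewrite -[X in measurable X]setTI; apply: (measurable_sqf s a) => //.
  - exact: measurableU.
  move=> z /=; rewrite in_itv/= /sqf => /andP[yz zw].
  have := ler_wsqrtr yz; have := ler_wsqrtr zw; rewrite sqrtr_sqr !in_itv/=.
  rewrite !ler_pdivrMr// !ler_pdivlMr//.
  case: (lerP 0 (s * z - a)) => h; [rewrite ger0_norm//|rewrite ltr0_norm//] => h1 h2; [left|right];
   apply/andP; split; lra.
apply: (le_trans (measureU2 _ _ _)) => //.
have h1 : (a + Num.sqrt y) / s <= (a + Num.sqrt w) / s.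
  by rewrite ler_pM2r ?invr_gt0// lerD2l.
have h2 : (a - Num.sqrt w) / s <= (a - Num.sqrt y) / s.
  by rewrite ler_pM2r ?invr_gt0// lerD2l lerN2.
apply: (le_trans (leeD (gam_itv_le h1) (gam_itv_le h2))).
rewrite -EFinD lee_fin le_eqVlt; apply/orP; left; apply/eqP; ring.
Qed.

End Concentration.

Section DoubleIntegrals.
Context d1 d2 (T1 : measurableType d1) (T2 : measurableType d2) (R : realType).
Variables (m1 : {sigma_finite_measure set T1 -> \bar R})
  (m2 : {sigma_finite_measure set T2 -> \bar R}).
Variables F G : T1 * T2 -> \bar R.
Hypotheses (mF : measurable_fun setT F) (mG : measurable_fun setT G).
Hypotheses (F0 : forall p, (0 <= F p)%E) (G0 : forall p, (0 <= G p)%E).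
Local Open Scope ereal_scope.

Lemma ge0_integral2D :
  \int[m1]_x \int[m2]_y (F (x, y) + G (x, y)) =
  \int[m1]_x \int[m2]_y F (x, y) + \int[m1]_x \int[m2]_y G (x, y).
Proof.
rewrite -ge0_integralD//.
- apply: eq_integral => x _; rewrite ge0_integralD//.
    exact: (measurableT_comp mF (pair1_measurable x)).
  exact: (measurableT_comp mG (pair1_measurable x)).
- by move=> x _; exact: integral_ge0.
- exact: (measurable_fun_fubini_tonelli_F _ mF F0).
- by move=> x _; exact: integral_ge0.
- exact: (measurable_fun_fubini_tonelli_F _ mG G0).
Qed.

Lemma ge0_le_integral2 : (forall p, F p <= G p) ->
  \int[m1]_x \int[m2]_y F (x, y) <= \int[m1]_x \int[m2]_y G (x, y).
Proof.
move=> FG; apply: ge0_le_integral => //.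
- by move=> x _; exact: integral_ge0.
- exact: (measurable_fun_fubini_tonelli_F _ mF F0).
- exact: (measurable_fun_fubini_tonelli_F _ mG G0).
move=> x _; apply: ge0_le_integral => //.
- exact: (measurableT_comp mF (pair1_measurable x)).
- exact: (measurableT_comp mG (pair1_measurable x)).
Qed.
End DoubleIntegrals.

Section TwoCoordinates.
Context {R : realType}.
Notation TR := (measurableTypeR R).
Notation gam := (@gam R).
Implicit Types mu nu : probability TR R.

Lemma measurable_indic_shift (A : set TR) (x : R) : measurable A ->
  measurable_fun setT (fun y : TR => (\1_A (x + y)%R : R)%:E).
Proof. by move=> mA; exact: (measurable_shiftR x (measurable_EFin_indic mA)). Qed.

Lemma law1_near (s a t : R) : 0 < s -> 0 <= t ->
  (law1 (s, a) `]-oo, t]%classic <= (2 * Num.sqrt t / s)%:E)%E.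
Proof.
move=> s0 t0; have := law1_itv_le a s0 (lexx 0) t0; rewrite sqrtr0 subr0.
apply: le_trans; rewrite /law1/= /distribution /pushforward/=.
rewrite le_eqVlt; apply/orP; left; apply/eqP; congr (gam _).
by apply/seteqP; split => z /=; rewrite !in_itv/= /sqf sqr_ge0.
Qed.

(** Above [t] the square root is Lipschitz with constant 1 / (2 sqrt t). *)
Lemma law1_far (s a t x h : R) : 0 < s -> 0 < t -> 0 < h ->
  (law1 (s, a) (`[x, (x + h)%R]%classic `&` `[t, +oo[%classic) <= (h / (s * Num.sqrt t))%:E)%E.
Proof.
move=> s0 t0 h0.
have st : 0 < Num.sqrt t by rewrite sqrtr_gt0.
pose y := Num.max x t.
have [yw|wy] := leP y (x + h); last first.
  rewrite (_ : _ `&` _ = set0) ?measure0 ?lee_fin ?divr_ge0 ?mulr_ge0 ?ltW//.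
  rewrite -subset0 => z /= [/[!in_itv]/= /andP[xz zw] /[!andbT] tz].
  have : y <= z by rewrite /y ge_max xz tz.
  by move=> /le_trans /(_ zw); rewrite leNgt wy.
have ty : t <= y by rewrite le_max lexx orbT.
have xy : x <= y by rewrite le_max lexx.
have y0 : 0 <= y by rewrite (le_trans _ ty)// ltW.
apply: (@le_trans _ _ (law1 (s, a) `[y, (x + h)%R]%classic)).
  apply: le_measure; rewrite ?inE//; first exact: measurableI.
  move=> z /= [/[!in_itv]/= /andP[xz zw] /[!andbT] tz].
  by rewrite zw andbT /y ge_max xz tz.
apply: (le_trans (law1_itv_le a s0 y0 yw)); rewrite lee_fin.
have w0 : 0 <= x + h by exact: le_trans yw.
have sty : Num.sqrt t <= Num.sqrt y by rewrite ler_wsqrtr.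
have syw : Num.sqrt y <= Num.sqrt (x + h) by rewrite ler_wsqrtr.
have e1 := sqr_sqrtr y0; have e2 := sqr_sqrtr w0.
have -> : h / (s * Num.sqrt t) = (h / Num.sqrt t) / s by field; rewrite !gt_eqF.
rewrite ler_pM2r ?invr_gt0// ler_pdivlMr//.
set A := Num.sqrt (x + h) in syw e2 *; set B := Num.sqrt y in sty syw e1 *.
have : 0 <= (A - B) * ((A + B) - 2 * Num.sqrt t) by rewrite mulr_ge0; lra.
have : (A - B) * (A + B) = A ^+ 2 - B ^+ 2 by ring.
by rewrite e1 e2; lra.
Qed.

Lemma le_integral_law1 p (f g : TR -> \bar R) :
  measurable_fun setT f -> measurable_fun setT g ->
  (forall x, 0 <= f x)%E -> (forall x, 0 <= g x)%E -> (forall x, (0 <= x)%R -> (f x <= g x)%E) ->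
  (\int[law1 p]_x f x <= \int[law1 p]_x g x)%E.
Proof.
move=> mf mg f0 g0 fg; rewrite !ge0_integral_law1//.
apply: ge0_le_integral => //.
- exact: (measurableT_comp mf (measurable_sqf p.1 p.2)).
- exact: (measurableT_comp mg (measurable_sqf p.1 p.2)).
- by move=> z _; apply: fg; exact: sqr_ge0.
Qed.

Definition farF (x h t : R) (B : set TR) (p : TR * TR) : \bar R :=
  (\1_(`[x, (x + h)%R]%classic) (p.1 + p.2)%R * \1_(`[t, +oo[%classic) p.1 * \1_B p.2)%:E.

Lemma measurable_farF x h t (B : set TR) : measurable B -> measurable_fun setT (farF x h t B).
Proof.
move=> mB; apply/measurable_EFinP; apply: measurable_funM; first apply: measurable_funM.
- by apply: (measurableT_comp (measurable_indic _)) => //; mfun.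
- by apply: (measurableT_comp (measurable_indic _)).
- by apply: (measurableT_comp (measurable_indic _)).
Qed.

Lemma farF_ge0 x h t (B : set TR) p : (0 <= farF x h t B p)%E.
Proof. by rewrite lee_fin !mulr_ge0. Qed.

(** Given the second summand, the first one lies in an interval of length h above [t], where
    [law1_far] applies. *)
Lemma far_term (s a x h t : R) nu (B : set TR) : measurable B -> 0 < s -> 0 < t -> 0 < h ->
  (\int[law1 (s, a)]_x1 \int[nu]_y farF x h t B (x1, y) <= (h / (s * Num.sqrt t))%:E * nu B)%E.
Proof.
move=> mB s0 t0 h0; have mF := measurable_farF x h t mB.
rewrite (tonelli _ _ mF (@farF_ge0 x h t B)).
rewrite [in leRHS]prob_indic// -ge0_integralZl//; last 2 first.
- exact: measurable_EFin_indic.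
- by rewrite lee_fin divr_ge0 ?mulr_ge0// ltW.
apply: ge0_le_integral => //.
- by move=> y _; apply: integral_ge0 => z _; exact: farF_ge0.
- exact: (measurable_fun_fubini_tonelli_G _ mF (@farF_ge0 x h t B)).
- by apply: emeasurable_funM => //; exact: measurable_EFin_indic.
move=> y _; rewrite /farF/=.
have [By|nBy] := boolP (y \in B); last first.
  rewrite integral0_eq; last by move=> z _; rewrite [\1_B y]indicE (negbTE nBy) mulr0.
  by rewrite mule_ge0// lee_fin// divr_ge0 ?mulr_ge0// ltW.
rewrite [\1_B y]indicE By mule1.
apply: le_trans (law1_far a (x - y) s0 t0 h0).
rewrite prob_indic; last exact: measurableI.
rewrite le_eqVlt; apply/orP; left; apply/eqP; apply: eq_integral => z _.
rewrite indicI/= [(z + y)%R]addrC indic_shift_itv [x + h - y]addrAC.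
by rewrite mulr1.
Qed.

Lemma conc_sqrt (s a M : R) nu : 0 < s -> 0 < M -> conc nu M ->
  conc (conv (law1 (s, a)) nu) (3 * Num.sqrt M / s).
Proof.
move=> s0 M0 cM x h h0; rewrite convE//.
have sM : 0 < Num.sqrt M by rewrite sqrtr_gt0.
(* This cut balances two cases. Above [t] the first summand has density at most 1 / (s sqrt t) =
   sqrt M / s. Below [t], an event of probability at most 2 sqrt t / s, the density bound [M] of the
   second summand is used. *)
pose t := M^-1.
have t0 : 0 < t by rewrite invr_gt0.
pose I := `[x, (x + h)%R]%classic : set TR.
pose G (p : TR * TR) : \bar R := (\1_I (p.1 + p.2)%R * \1_(`]-oo, t]%classic) p.1)%:E.
have mG : measurable_fun setT G.
  have mI : measurable I by exact: measurable_itv.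
  apply/measurable_EFinP; apply: measurable_funM.
  - by apply: (measurableT_comp (measurable_indic mI)); mfun.
  - by apply: (measurableT_comp (measurable_indic _)).
have G0 p : (0 <= G p)%E by rewrite lee_fin mulr_ge0.
have mF := @measurable_farF x h t setT measurableT.
pose J (p : TR * TR) : \bar R := (\1_I (p.1 + p.2)%R)%:E.
have mJ : measurable_fun setT J.
  have mI : measurable I by exact: measurable_itv.
  by apply/measurable_EFinP; apply: (measurableT_comp (measurable_indic mI)); mfun.
have J0 p : (0 <= J p)%E by exact: indic_ge0.
have F0 := @farF_ge0 x h t setT.
apply: (@le_trans _ _ (\int[law1 (s, a)]_x1 \int[nu]_y
    (fun p => farF x h t setT p + G p) (x1, y))%E).
  have mFG : measurable_fun setT (fun p => farF x h t setT p + G p)%E by exact: emeasurable_funD.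
  have FG0 p : (0 <= farF x h t setT p + G p)%E by rewrite adde_ge0.
  apply: (ge0_le_integral2 (law1 (s, a)) nu mJ mFG J0 FG0).
  move=> [y z]; rewrite -EFinD lee_fin /= -[leLHS]mulr1 -mulrA -mulrDr ler_wpM2l//.
  rewrite [\1_setT z]indicE in_setT mulr1 !indicE !mem_setE !in_itv/= andbT.
  by case: (leP t y) => [_|/ltW ->]; rewrite /= ?lerDl ?add0r.
rewrite (ge0_integral2D _ _ mF mG F0 G0).
have -> : 3 * Num.sqrt M / s * h = h / (s * Num.sqrt t) + M * h * (2 * Num.sqrt t / s).
  rewrite /t sqrtrV ?ltW// -{3}(sqr_sqrtr (ltW M0)).
  by field; rewrite !gt_eqF.
rewrite EFinD; apply: leeD.
  apply: (le_trans (far_term a x nu measurableT s0 t0 h0)).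
  by have := @probability_setT _ _ _ nu => /= ->; rewrite mule1.
rewrite EFinM; apply: (@le_trans _ _ ((M * h)%:E * law1 (s, a) `]-oo, t]%classic)%E); last first.
  apply: lee_wpmul2l; first by rewrite lee_fin mulr_ge0// ltW.
  exact: law1_near (ltW t0).
rewrite [in leRHS]prob_indic// -ge0_integralZl//; last 2 first.
- exact: measurable_EFin_indic.
- by rewrite lee_fin mulr_ge0// ltW.
apply: ge0_le_integral => //.
- by move=> y _; apply: integral_ge0 => z _; exact: G0.
- exact: (measurable_fun_fubini_tonelli_F _ mG G0).
- by apply: emeasurable_funM => //; exact: measurable_EFin_indic.
move=> y _; rewrite /G/=.
have [By|nBy] := boolP (y \in (`]-oo, t]%classic : set TR)); last first.
  rewrite integral0_eq; last by move=> z _; rewrite [X in _ * X]indicE (negbTE nBy) mulr0.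
  by rewrite mule_ge0// lee_fin// mulr_ge0// ltW.
rewrite [X in (_ * X%:E)%E]indicE By mule1.
apply: le_trans (cM (x - y) h h0).
rewrite prob_indic// le_eqVlt; apply/orP; left; apply/eqP; apply: eq_integral => z _.
by rewrite [X in _ * X]indicE By mulr1 indic_shift_itv addrAC.
Qed.

Lemma le_integral2_law1 p q (F G : TR * TR -> \bar R) :
  measurable_fun setT F -> measurable_fun setT G ->
  (forall x, 0 <= F x)%E -> (forall x, 0 <= G x)%E ->
  (forall x y, (0 <= x)%R -> (0 <= y)%R -> (F (x, y) <= G (x, y))%E) ->
  (\int[law1 p]_x \int[law1 q]_y F (x, y) <= \int[law1 p]_x \int[law1 q]_y G (x, y))%E.
Proof.
move=> mF mG F0 G0 FG; apply: le_integral_law1.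
- exact: (measurable_fun_fubini_tonelli_F _ mF F0).
- exact: (measurable_fun_fubini_tonelli_F _ mG G0).
- by move=> x; exact: integral_ge0.
- by move=> x; exact: integral_ge0.
move=> x x0; apply: le_integral_law1 => //.
- exact: (measurableT_comp mF (pair1_measurable x)).
- exact: (measurableT_comp mG (pair1_measurable x)).
- by move=> y y0; exact: FG.
Qed.

Lemma conc_pair (s1 a1 s2 a2 : R) : 0 < s1 -> 0 < s2 ->
  conc (conv (law1 (s1, a1)) (law1 (s2, a2))) (8 / (s1 * s2)).
Proof.
move=> s10 s20 x h h0; rewrite convE//.
pose I := `[x, (x + h)%R]%classic : set TR.
have mI : measurable I by exact: measurable_itv.
have sr (r : R) : 0 <= r -> Num.sqrt r ^+ 2 = r by exact: sqr_sqrtr.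
(* An interval ending below 2 h forces both summands below 2 h, and each of these independent events
   has probability O(sqrt h / s). *)
have [rh|hr] := leP (x + h) (2 * h).
  have h20 : 0 <= 2 * h by rewrite mulr_ge0// ltW.
  pose B := `]-oo, (2 * h)%R]%classic : set TR.
  have mB : measurable B by exact: measurable_itv.
  apply: (@le_trans _ _ (\int[law1 (s1, a1)]_x1 ((2 * Num.sqrt (2 * h) / s2)%:E * (\1_B x1)%:E))%E).
    apply: le_integral_law1.
    - exact: measurable_int_indic.
    - by apply: emeasurable_funM => //; exact: measurable_EFin_indic.
    - by move=> y; apply: integral_ge0 => z _; exact: indic_ge0.
    - by move=> y; rewrite mule_ge0// lee_fin divr_ge0 ?mulr_ge0 ?sqrtr_ge0// ltW.
    move=> y y0.
    apply: (@le_trans _ _ (\int[law1 (s2, a2)]_x2 ((\1_B y)%:E * (\1_B x2)%:E))%E).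
      apply: le_integral_law1.
      + exact: measurable_indic_shift.
      + by apply: emeasurable_funM => //; exact: measurable_EFin_indic.
      + by move=> z; exact: indic_ge0.
      + by move=> z; rewrite mule_ge0.
      move=> z z0; rewrite -EFinM lee_fin !indicE !mem_setE !in_itv/=.
      case: andP => [[h1 h2]|_] /=; last by rewrite mulr_ge0.
      have -> : y <= 2 * h by lra.
      have -> : z <= 2 * h by lra.
      by rewrite mulr1.
    rewrite ge0_integralZl//; last exact: measurable_EFin_indic.
    rewrite muleC -prob_indic// lee_wpmul2r ?lee_fin//.
    exact: law1_near.
  rewrite ge0_integralZl//; last 2 first.
  - exact: measurable_EFin_indic.
  - by rewrite lee_fin divr_ge0 ?mulr_ge0 ?sqrtr_ge0// ltW.
  rewrite -prob_indic//.
  apply: (@le_trans _ _ ((2 * Num.sqrt (2 * h) / s2)%:E * (2 * Num.sqrt (2 * h) / s1)%:E)%E).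
    rewrite lee_wpmul2l ?law1_near// lee_fin divr_ge0 ?mulr_ge0 ?sqrtr_ge0// ltW//.
  rewrite -EFinM lee_fin.
  have -> : 2 * Num.sqrt (2 * h) / s2 * (2 * Num.sqrt (2 * h) / s1) =
      4 * Num.sqrt (2 * h) ^+ 2 / (s1 * s2) by field; rewrite !gt_eqF.
  rewrite sr// le_eqVlt; apply/orP; left; apply/eqP; field.
  by rewrite !gt_eqF.
pose r := x + h.
have r0 : 0 < r by rewrite /r; lra.
(* Here x > r / 2, so one summand is at least r / 4 while the other is at most r; the two cases
   contribute 4 h / (s1 s2) each. *)
pose t := r / 4.
have t0 : 0 < t by rewrite divr_gt0.
have st : Num.sqrt t = Num.sqrt r / 2.
  rewrite /t sqrtrM ?ltW// sqrtrV//; congr (_ / _).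
  by rewrite (_ : 4 = 2 ^+ 2) ?sqrtr_sqr ?ger0_norm//; ring.
pose B := `]-oo, r]%classic : set TR.
have mB : measurable B by exact: measurable_itv.
pose J (p : TR * TR) : \bar R := (\1_I (p.1 + p.2)%R)%:E.
have mJ : measurable_fun setT J.
  by apply/measurable_EFinP; apply: (measurableT_comp (measurable_indic mI)); mfun.
have J0 p : (0 <= J p)%E by exact: indic_ge0.
pose F1 := farF x h t B.
pose F2 (p : TR * TR) := farF x h t B (p.2, p.1).
have mF1 : measurable_fun setT F1 by exact: measurable_farF.
have mF2 : measurable_fun setT F2 by apply: (measurableT_comp mF1); mfun.
have F10 p : (0 <= F1 p)%E by exact: farF_ge0.
have F20 p : (0 <= F2 p)%E by exact: farF_ge0.
have mF12 : measurable_fun setT (fun p => F1 p + F2 p)%E by exact: emeasurable_funD.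
have F120 p : (0 <= F1 p + F2 p)%E by rewrite adde_ge0.
have JF (y z : R) : 0 <= y -> 0 <= z -> (J (y, z) <= F1 (y, z) + F2 (y, z))%E.
  move=> y0 z0; rewrite /J /F1 /F2 /farF -EFinD lee_fin /= [(z + y)%R]addrC -!mulrA -mulrDr.
  rewrite !indicE !mem_setE !in_itv/= !andbT.
  case: andP => [[h1 h2]|_] /=; last by rewrite !mul0r.
  have -> : y <= r by rewrite /r; lra.
  have -> : z <= r by rewrite /r; lra.
  rewrite !mulr1 !mul1r; case: (leP t y) => ty /=; first by rewrite lerDl.
  by rewrite add0r (_ : t <= z)//; move: ty h1 hr; rewrite /t /r; lra.
apply: (le_trans (le_integral2_law1 (s1, a1) (s2, a2) mJ mF12 J0 F120 JF)).
rewrite (ge0_integral2D _ _ mF1 mF2 F10 F20).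
have K (s s' a a' : R) : 0 < s -> 0 < s' ->
    (\int[law1 (s, a)]_x1 \int[law1 (s', a')]_y F1 (x1, y) <= (4 * h / (s * s'))%:E)%E.
  move=> s0 s'0; apply: (le_trans (far_term a x (law1 (s', a')) mB s0 t0 h0)).
  apply: (@le_trans _ _ ((h / (s * Num.sqrt t))%:E * (2 * Num.sqrt r / s')%:E)%E).
    apply: lee_wpmul2l; first by rewrite lee_fin divr_ge0 ?mulr_ge0// ltW.
    exact: law1_near (ltW r0).
  rewrite -EFinM lee_fin st le_eqVlt; apply/orP; left; apply/eqP.
  by field; rewrite !gt_eqF// sqrtr_gt0.
rewrite [X in (_ + X <= _)%E](tonelli _ _ mF2 F20).
apply: (le_trans (leeD (K _ _ _ _ s10 s20) (K _ _ _ _ s20 s10))).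
rewrite -EFinD lee_fin le_eqVlt; apply/orP; left; apply/eqP.
by field; rewrite !gt_eqF.
Qed.
End TwoCoordinates.

(** * Symmetrized sums and the difference of two independent copies *)

Section Decoupling.
Context {R : realType}.
Notation TR := (measurableTypeR R).
Notation gam := (@gam R).
Implicit Types mu nu : probability TR R.

(* The expectation of g (w + X - X') for independent X and X' with law mu. *)
Definition diffI mu (g : TR -> \bar R) (w : R) : \bar R :=
  (\int[mu]_x \int[mu]_y g (w + (x - y))%R)%E.

Lemma measurable_diff3 (g : TR -> \bar R) : measurable_fun setT g ->
  measurable_fun setT (fun p : TR * (TR * TR) => g (p.1 + (p.2.1 - p.2.2))%R).
Proof.
move=> mg; apply: (measurableT_comp mg).
apply: measurable_funD => //; apply: measurable_funB.
  exact: (measurableT_comp measurable_fst measurable_snd).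
exact: (measurableT_comp measurable_snd measurable_snd).
Qed.

Lemma measurable_diff2 (g : TR -> \bar R) (w : R) : measurable_fun setT g ->
  measurable_fun setT (fun p : TR * TR => g (w + (p.1 - p.2))%R).
Proof.
move=> mg; exact: (measurableT_comp (measurable_diff3 mg) (pair1_measurable (w : TR))).
Qed.

Definition sqr_prob mu : probability (TR * TR)%type R := (mu \x mu)%E.

Lemma diffIE mu g w : measurable_fun setT g -> (forall x, 0 <= g x)%E ->
  diffI mu g w = (\int[sqr_prob mu]_q g (w + (q.1 - q.2))%R)%E.
Proof.
move=> mg g0; rewrite /diffI /sqr_prob.
by rewrite (fubini_tonelli1 _ (measurable_diff2 w mg) (fun p => g0 _)).
Qed.

Lemma diffI_ge0 mu g w : (forall x, 0 <= g x)%E -> (0 <= diffI mu g w)%E.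
Proof. by move=> g0; apply: integral_ge0 => x _; exact: integral_ge0. Qed.

Lemma measurable_diffI mu g : measurable_fun setT g -> (forall x, 0 <= g x)%E ->
  measurable_fun [set: TR] (diffI mu g).
Proof.
move=> mg g0.
rewrite (_ : diffI mu g = (fun w => \int[sqr_prob mu]_q g (w + (q.1 - q.2))%R)%E).
  have := measurable_fun_fubini_tonelli_F (m2 := sqr_prob mu)
    (fun p : TR * (TR * TR) => g (p.1 + (p.2.1 - p.2.2))%R) (measurable_diff3 mg).
  by apply => p; exact: g0.
by apply/funext => w; rewrite diffIE.
Qed.

Lemma diffI_conv mu nu g w : measurable_fun setT g -> (forall x, 0 <= g x)%E ->
  diffI (conv mu nu) g w = diffI mu (diffI nu g) w.
Proof.
move=> mg g0; rewrite /diffI.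
have mg1 : measurable_fun setT (fun p : TR * TR => g (w + (p.1 - p.2))%R).
  exact: measurable_diff2.
rewrite ge0_integral_conv; last 2 first.
- exact: (measurable_fun_fubini_tonelli_F _ mg1 (fun p => g0 _)).
- by move=> x; exact: integral_ge0.
apply: eq_integral => x _.
pose K (p : (TR * TR) * TR) := g (w + ((x + p.1.1) - (p.1.2 + p.2)))%R.
have mK : measurable_fun setT K.
  apply: (measurableT_comp mg); apply: measurable_funD => //; apply: measurable_funB.
    apply: measurable_funD => //.
    exact: (measurableT_comp measurable_fst measurable_fst).
  apply: measurable_funD => //.
  exact: (measurableT_comp measurable_snd measurable_fst).
have mK2 := measurable_fun_fubini_tonelli_F (m2 := nu) _ mK (fun p => g0 _).
transitivity (\int[nu]_y \int[mu]_x' \int[nu]_y' K ((y, x'), y'))%E.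
  apply: eq_integral => y _; rewrite ge0_integral_conv//.
  exact: (measurableT_comp mg1 (pair1_measurable (x + y : TR))).
rewrite (tonelli nu mu mK2); last by move=> q; apply: integral_ge0 => y _; exact: g0.
apply: eq_integral => x' _; apply: eq_integral => y _; apply: eq_integral => y' _.
by rewrite /K/=; congr g; ring.
Qed.

(** With s and a the components of [p], (s x - a)^2 - (s y - a)^2 is a product of one factor in x -
    y and one in x + y, which the rotation makes independent. Given u, the difference is normal in v
    with standard deviation 2 s^2 |u|; the shift a only moves its mean. *)
Lemma diffI_law1 p g w : measurable_fun setT g -> (forall x, 0 <= g x)%E ->
  diffI (law1 p) g w = (\int[gam]_u \int[gam]_v
    g ((w - 2 * Num.sqrt 2 * p.1 * p.2 * u) + (2 * p.1 ^+ 2 * u) * v)%R)%E.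
Proof.
move=> mg g0; rewrite /diffI.
have mg1 : measurable_fun setT (fun q : TR * TR => g (w + (q.1 - q.2))%R).
  exact: measurable_diff2.
rewrite ge0_integral_law1; last 2 first.
- exact: (measurable_fun_fubini_tonelli_F _ mg1 (fun p => g0 _)).
- by move=> x; exact: integral_ge0.
pose f (q : TR * TR) := g (w + ((p.1 * q.1 - p.2) ^+ 2 - (p.1 * q.2 - p.2) ^+ 2))%R.
have mf : measurable_fun setT f by apply: (measurableT_comp mg); mfun.
transitivity (\int[gam]_x \int[gam]_y f (x, y))%E.
  apply: eq_integral => z _; rewrite ge0_integral_law1//.
  exact: (measurableT_comp mg1 (pair1_measurable ((p.1 * z - p.2) ^+ 2 : TR))).
rewrite (gam_rotation mf (fun q => g0 _)).
apply: eq_integral => u _; apply: eq_integral => v _; rewrite /f/=; congr g.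
have r20 : Num.sqrt 2 != 0 :> R by rewrite gt_eqF// sqrtr_gt0.
have r22 : Num.sqrt 2 ^+ 2 = 2 :> R by rewrite sqr_sqrtr.
rewrite -addrA; congr (_ + _).
set r := Num.sqrt 2 in r20 r22 *.
have e : r^-1 = r / 2 by rewrite -r22; field.
rewrite e; transitivity (r ^+ 2 * p.1 ^+ 2 * u * v - 2 * r * p.1 * p.2 * u).
  set i := (2 : R)^-1; have i2 : i * 2 = 1 by rewrite mulVf.
  have -> : (p.1 * ((v + u) * (r * i)) - p.2) ^+ 2 - (p.1 * ((v - u) * (r * i)) - p.2) ^+ 2
    = r ^+ 2 * p.1 ^+ 2 * u * v * (i * 2) ^+ 2 - 2 * r * p.1 * p.2 * u * (i * 2) by ring.
  by rewrite i2 expr1n !mulr1.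
by rewrite r22; ring.
Qed.

End Decoupling.

Section DifferenceBound.
Context {R : realType}.
Notation leb := (@lebesgue_measure R).
Notation TR := (measurableTypeR R).
Notation gam := (@gam R).
Notation cpi := (@cpi R).
Implicit Types (mu nu : probability TR R) (l : seq (R * R)).

(* With s_i the scales in l, [Psi l t] is (up to normalisation) the integral of a Gaussian
   against a bound on the characteristic function of X - X'; the shifts a_i only
   contribute phases. *)
Definition wprod l (s : R) : R :=
  \prod_(p <- l) (Num.sqrt (1 + 4 * s ^+ 2 * p.1 ^+ 4))^-1.

Lemma wprod_ge0 l s : 0 <= wprod l s.
Proof. by apply: prodr_ge0 => p _; rewrite invr_ge0. Qed.

Lemma measurable_wfactor (c : R) : 0 <= c ->
  measurable_fun [set: TR] (fun s : TR => (Num.sqrt (1 + 4 * s ^+ 2 * c))^-1).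
Proof.
move=> c0.
rewrite (_ : (fun s : TR => _) = (fun s : R => (1 + 4 * s ^+ 2 * c) `^ (- 2^-1))).
  by apply: (measurableT_comp (measurable_powR (- 2^-1))); mfun.
apply/funext => s; rewrite powRN powR12_sqrt// ltW// ltr_wpDr//.
by apply: mulr_ge0 => //; apply: mulr_ge0 => //; exact: sqr_ge0.
Qed.

Lemma measurable_wprod l : measurable_fun [set: TR] (wprod l).
Proof.
elim: l => [|p l IH].
  rewrite (_ : wprod [::] = cst 1)//.
  by apply/funext => s; rewrite /wprod big_nil.
rewrite (_ : wprod (p :: l) =
    (fun s : R => (Num.sqrt (1 + 4 * s ^+ 2 * p.1 ^+ 4))^-1 * wprod l s)).
  by apply: measurable_funM => //; apply: measurable_wfactor; exact: exprn_even_ge0.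
by apply/funext => s; rewrite /wprod big_cons.
Qed.

Definition Psi l (t : R) : \bar R :=
  (\int[leb]_s (cpi * expR (- (t * s ^+ 2) / 2) * wprod l s)%:E)%E.

Lemma measurable_Psi_arg l : measurable_fun setT (fun p : TR * TR =>
  (cpi * expR (- (p.1 * p.2 ^+ 2) / 2) * wprod l p.2)%:E).
Proof.
apply/measurable_EFinP; apply: measurable_funM.
  by mfun.
exact: (measurableT_comp (measurable_wprod l)).
Qed.

Lemma Psi_arg_ge0 l (t s : R) : (0 <= (cpi * expR (- (t * s ^+ 2) / 2) * wprod l s)%:E)%E.
Proof.
by rewrite lee_fin mulr_ge0 ?wprod_ge0// mulr_ge0 ?expR_ge0// ltW// cpi_gt0.
Qed.

Lemma measurable_Psi l : measurable_fun [set: TR] (Psi l).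
Proof.
have := @measurable_fun_fubini_tonelli_F _ _ TR TR R leb _ (measurable_Psi_arg l).
by apply => p; exact: Psi_arg_ge0.
Qed.

Lemma Psi_nil t : 0 < t -> Psi [::] t = (Num.sqrt t)^-1%:E.
Proof.
move=> t0; rewrite /Psi.
under eq_integral do rewrite /wprod big_nil mulr1 EFinM.
rewrite ge0_integralZl//; last 2 first.
- by mfun.
- by rewrite lee_fin ltW ?cpi_gt0.
rewrite integral_leb_gauss// -EFinM; congr EFin.
by rewrite invfM mulrA divff ?mul1r// gt_eqF ?cpi_gt0.
Qed.

(** By Tonelli, integrating over u first multiplies the integrand at s by a Gaussian integral, which
    is the factor of [wprod] belonging to [p]. *)
Lemma Psi_cons p l t :
  (\int[gam]_u Psi l (t + (2 * p.1 ^+ 2 * u) ^+ 2)%R)%E = Psi (p :: l) t.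
Proof.
rewrite /Psi.
pose F (q : TR * TR) := (cpi * expR (- ((t + (2 * p.1 ^+ 2 * q.1) ^+ 2) * q.2 ^+ 2) / 2)
  * wprod l q.2)%:E.
have mF : measurable_fun setT F.
  apply/measurable_EFinP; apply: measurable_funM; first by mfun.
  exact: (measurableT_comp (measurable_wprod l)).
rewrite (tonelli gam leb mF); last by move=> q; exact: Psi_arg_ge0.
apply: eq_integral => s _; rewrite /F/=.
transitivity (\int[gam]_u ((cpi * expR (- (t * s ^+ 2) / 2) * wprod l s)%:E *
   (expR (- ((4 * s ^+ 2 * p.1 ^+ 4) * u ^+ 2) / 2))%:E))%E.
  apply: eq_integral => u _; rewrite -EFinM; congr EFin.
  have -> : - ((t + (2 * p.1 ^+ 2 * u) ^+ 2) * s ^+ 2) / 2 =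
    - (t * s ^+ 2) / 2 + - ((4 * s ^+ 2 * p.1 ^+ 4) * u ^+ 2) / 2 by field.
  by rewrite expRD mulrA mulrAC.
have c0 : 0 <= 4 * s ^+ 2 * p.1 ^+ 4.
  by apply: mulr_ge0; [apply: mulr_ge0 => //; exact: sqr_ge0|exact: exprn_even_ge0].
rewrite ge0_integralZl//; last 2 first.
- by mfun.
- exact: Psi_arg_ge0.
rewrite integral_gam_gauss; last by rewrite (lt_le_trans _ c0)// ltrN10.
by rewrite -EFinM /wprod big_cons; congr EFin; ring.
Qed.

(** Induction on the coordinates. Given u, averaging [kt] over the normal difference replaces t by t
    + (2 s^2 u)^2 for a coordinate of scale s. The random mean is carried along and discarded only
    at the end, where [kt t] is at most its value at 0. This takes the place of Fourier
    inversion. *)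
Lemma diffI_law_le l t m : 0 < t ->
  (diffI (law l) (fun d => (kt t d)%:E) m <= Psi l t)%E.
Proof.
have mk t' : measurable_fun [set: TR] (fun d : TR => (kt t' d)%:E).
  by apply/measurable_EFinP; exact: measurable_kt.
have k0 t' (d : TR) : (0 <= (kt t' d)%:E)%E by rewrite lee_fin kt_ge0.
elim: l t m => [|p l IH] t m t0.
  rewrite /diffI ge0_integral_law_nil; last 2 first.
  - exact: (measurable_fun_fubini_tonelli_F _ (measurable_diff2 m (mk t)) (fun p => k0 t _)).
  - by move=> x; apply: integral_ge0 => y _; exact: k0.
  rewrite ge0_integral_law_nil//; last first.
    exact: (measurableT_comp (measurable_diff2 m (mk t)) (pair1_measurable (0 : TR))).
  rewrite Psi_nil// lee_fin /kt ler_piMr ?invr_ge0// expR_le1 mulNr oppr_le0.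
  by rewrite divr_ge0 ?sqr_ge0// mulr_ge0// ltW.
rewrite [law _]/= diffI_conv// diffI_law1; last 2 first.
- exact: measurable_diffI.
- by move=> x; exact: diffI_ge0.
rewrite -Psi_cons; apply: ge0_le_integral => //.
- by move=> u _; apply: integral_ge0 => v _; exact: diffI_ge0.
- pose H (q : TR * TR) := diffI (law l) (fun d : TR => (kt t d)%:E)
    (m - 2 * Num.sqrt 2 * p.1 * p.2 * q.1 + 2 * p.1 ^+ 2 * q.1 * q.2).
  have mH : measurable_fun setT H.
    by apply: (measurableT_comp (measurable_diffI (law l) (mk t) (k0 t))); mfun.
  by apply: (measurable_fun_fubini_tonelli_F H mH) => q; exact: diffI_ge0.
- apply: (measurableT_comp (measurable_Psi l)); mfun.
move=> u _.
have t1 : 0 < t + (2 * p.1 ^+ 2 * u) ^+ 2 by rewrite ltr_pwDl// sqr_ge0.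
set b := 2 * p.1 ^+ 2 * u in t1 *; set c := m - _.
apply: le_trans (IH _ c t1).
under eq_integral do rewrite diffIE//.
rewrite diffIE//.
pose G (q : TR * (TR * TR)) := (kt t ((c + b * q.1) + (q.2.1 - q.2.2)))%:E.
have mG : measurable_fun setT G.
  apply: (measurableT_comp (mk t)); apply: measurable_funD; first by mfun.
  apply: measurable_funB.
    exact: (measurableT_comp measurable_fst measurable_snd).
  exact: (measurableT_comp measurable_snd measurable_snd).
rewrite (tonelli gam (sqr_prob (law l)) mG (fun q => k0 t _)).
rewrite le_eqVlt; apply/orP; left; apply/eqP; apply: eq_integral => q _.
rewrite /G -(integral_gam_kt _ _ t0); apply: eq_integral => v _.
by congr (EFin (kt _ _)); rewrite /=; ring.
Qed.

End DifferenceBound.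

Section ConvDifference.
Context {R : realType}.
Notation leb := (@lebesgue_measure R).
Notation TR := (measurableTypeR R).
Implicit Types (mu nu : probability TR R).

Definition pair_prob mu nu : probability (TR * TR)%type R := (mu \x nu)%E.

Section Kernels.
Variables (K1 K2 : TR * TR -> R) (mu nu : probability TR R).
Hypotheses (mK1 : measurable_fun setT K1) (mK2 : measurable_fun setT K2).
Hypotheses (K10 : forall p, 0 <= K1 p <= 1) (K20 : forall p, 0 <= K2 p <= 1).

Let K1ge0 p : 0 <= K1 p. Proof. by have /andP[] := K10 p. Qed.
Let K2ge0 p : 0 <= K2 p. Proof. by have /andP[] := K20 p. Qed.

Lemma measurable_kernel_prod : measurable_fun setT
  (fun p : TR * (TR * TR) => (K1 (p.1, p.2.1) * K2 (p.1, p.2.2))%:E).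
Proof.
apply/measurable_EFinP; apply: measurable_funM.
  apply: (measurableT_comp mK1); apply: measurable_fun_pair => //.
  exact: (measurableT_comp measurable_fst measurable_snd).
apply: (measurableT_comp mK2); apply: measurable_fun_pair => //.
exact: (measurableT_comp measurable_snd measurable_snd).
Qed.

Lemma kernel_prodE (t : TR) : (\int[pair_prob mu nu]_q (K1 (t, q.1) * K2 (t, q.2))%:E =
  (\int[mu]_x (K1 (t, x))%:E) * (\int[nu]_y (K2 (t, y))%:E))%E.
Proof.
have mF : measurable_fun setT (fun q : TR * TR => (K1 (t, q.1) * K2 (t, q.2))%:E).
  exact: (measurableT_comp measurable_kernel_prod (pair1_measurable t)).
have m1 : measurable_fun setT (fun x : TR => (K1 (t, x))%:E).
  by apply/measurable_EFinP; exact: (measurableT_comp mK1 (pair1_measurable t)).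
have m2 : measurable_fun setT (fun x : TR => (K2 (t, x))%:E).
  by apply/measurable_EFinP; exact: (measurableT_comp mK2 (pair1_measurable t)).
rewrite /pair_prob (fubini_tonelli1 _ mF) /=; last first.
  by move=> q; rewrite lee_fin mulr_ge0.
rewrite -ge0_integralZr//; last 2 first.
- by move=> x _; rewrite lee_fin.
- by apply: integral_ge0 => y _; rewrite lee_fin.
apply: eq_integral => x _; rewrite /fubini_F -ge0_integralZl//.
- by move=> y _; rewrite lee_fin.
- by rewrite lee_fin.
Qed.

Lemma kernel_int_fin (t : TR) : exists2 r : R, 0 <= r & (\int[mu]_x (K1 (t, x))%:E)%E = r%:E.
Proof.
have m1 : measurable_fun setT (fun x : TR => (K1 (t, x))%:E).
  by apply/measurable_EFinP; exact: (measurableT_comp mK1 (pair1_measurable t)).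
have h0 : (0 <= \int[mu]_x (K1 (t, x))%:E)%E by apply: integral_ge0 => y _; rewrite lee_fin.
have h1 : (\int[mu]_x (K1 (t, x))%:E <= 1%:E)%E.
  apply: le_integral_prob_cst => //.
  - by move=> x; rewrite lee_fin.
  - by move=> x; rewrite lee_fin; have /andP[] := K10 (t, x).
exists (fine (\int[mu]_x (K1 (t, x))%:E)%E); first exact: fine_ge0.
by rewrite fineK// ge0_fin_numE// (le_lt_trans h1)// ltry.
Qed.

End Kernels.

(** The square of the mixture is an integral over an independent pair. A pair contributes only when
    its members are within L of each other, and then at most [L] after integration in t. *)
Lemma kernel_sqr_le (K : TR * TR -> R) mu (L : R) : 0 <= L -> measurable_fun setT K -> (forall p, 0 <= K p <= 1) ->
  (forall s : R, (\int[leb]_t (K (t, s))%:E <= L%:E)%E) ->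
  (forall t s s', K (t, s) * K (t, s') <= K (t, s) * \1_(`[(- L)%R, L]%classic) (s - s')) ->
  (\int[leb]_t ((\int[mu]_x (K (t, x))%:E) * (\int[mu]_x (K (t, x))%:E)) <=
   L%:E * diffI mu (fun d => (\1_(`[(- L)%R, L]%classic) d)%:E) 0)%E.
Proof.
move=> L0 mK K01 KL KK.
pose I := `[(- L)%R, L]%classic : set TR.
have mI : measurable I by exact: measurable_itv.
have K0 p : 0 <= K p by have /andP[] := K01 p.
under eq_integral do rewrite -kernel_prodE//.
have mG := measurable_kernel_prod mK mK.
rewrite (tonelli leb (pair_prob mu mu) mG); last first.
  by move=> q; rewrite lee_fin mulr_ge0.
rewrite diffIE; last 2 first.
- exact: measurable_EFin_indic.
- by move=> q; exact: indic_ge0.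
have mD := measurable_diff2 0 (measurable_EFin_indic mI).
rewrite -ge0_integralZl//.
apply: ge0_le_integral => //.
- by move=> q _; apply: integral_ge0 => t _; rewrite lee_fin mulr_ge0.
- by apply: (measurable_fun_fubini_tonelli_G _ mG) => q; rewrite lee_fin mulr_ge0.
- by apply: emeasurable_funM.
move=> [s s'] _ /=; rewrite add0r.
have mKs : measurable_fun setT (fun t : TR => (K (t, s))%:E).
  by apply/measurable_EFinP; exact: (measurableT_comp mK (pair2_measurable s)).
apply: (@le_trans _ _ (\int[leb]_t ((\1_I (s - s'))%:E * (K (t, s))%:E))%E).
  apply: ge0_le_integral => //.
  - by move=> t _; rewrite lee_fin mulr_ge0.
  - exact: (measurableT_comp mG (pair2_measurable (s, s'))).
  - by apply: emeasurable_funM.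
  - by move=> t _; rewrite -EFinM lee_fin mulrC [leRHS]mulrC mulrC KK.
rewrite ge0_integralZl//; last by move=> t _; rewrite lee_fin.
by rewrite muleC; apply: lee_wpmul2r => //; exact: indic_ge0.
Qed.

Lemma lee_cancel_scale (h : R) (C D1 D2 : \bar R) : 0 < h -> (0 <= D1)%E -> (0 <= D2)%E ->
  (2%:E * (h%:E * C) <= h%:E * D1 + (2 * h)%:E * D2 -> 2%:E * C <= D1 + 2%:E * D2)%E.
Proof.
move=> h0 D10 D20; rewrite muleCA [(2 * h)%R]mulrC EFinM -[((_ * _) * D2)%E]muleA.
rewrite -ge0_muleDr ?mule_ge0 ?lee_fin//.
by rewrite lee_pmul2l// lte_fin.
Qed.

(* Cauchy-Schwarz decouples mu from nu: an interval of a convolution is an integral over t of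
   a product of two factors, each of which is a probability of a small difference. *)
Lemma conv_itv_le mu nu (x h : R) : 0 < h ->
  (2%:E * conv mu nu `[x, (x + h)%R]%classic <=
   diffI mu (fun d => (\1_(`[(- h)%R, h]%classic) d)%:E) 0 +
   2%:E * diffI nu (fun d => (\1_(`[(- (2 * h))%R, (2 * h)%R]%classic) d)%:E) 0)%E.
Proof.
move=> h0.
pose I1 := `[0, h]%classic : set TR.
pose I2 := `[(- h)%R, h]%classic : set TR.
have mI1 : measurable I1 by exact: measurable_itv.
have mI2 : measurable I2 by exact: measurable_itv.
(* If [s + s'] lies in the target interval, every t with 0 <= s - t <= h satisfies |s' + t - x| <=
   h. Hence h times the indicator is at most the integral over t of K1 (t, s) K2 (t, s'), in which
   the two variables are separated. *)
pose K1 (p : TR * TR) : R := \1_I1 (p.2 - p.1).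
pose K2 (p : TR * TR) : R := \1_I2 (p.2 + p.1 - x).
have mK1 : measurable_fun setT K1.
  by apply: (measurableT_comp (measurable_indic mI1)); mfun.
have mK2 : measurable_fun setT K2.
  by apply: (measurableT_comp (measurable_indic mI2)); mfun.
have ind01 (A : set R) y : 0 <= (\1_A y : R) <= 1.
  by rewrite indicE; case: (_ \in _); rewrite /= ?lexx ?ler01.
have K101 p : 0 <= K1 p <= 1 by exact: ind01.
have K201 p : 0 <= K2 p <= 1 by exact: ind01.
have leb_itv (u v : R) : u <= v -> (\int[leb]_t (\1_(`[u, v]%classic) t)%:E = (v - u)%:E)%E.
  move=> uv; rewrite integral_indic//= setIT lebesgue_measure_itv/= lte_fin.
  case: ifPn => [//|]; rewrite -leNgt => vu.
  by rewrite (le_anti (introT andP (conj uv vu))) subrr.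
have L1 s : (\int[leb]_t (K1 (t, s))%:E = h%:E)%E.
  have <- : s - (s - h) = h by ring.
  rewrite -leb_itv; last by rewrite lerBlDr lerDl ltW.
  apply: eq_integral => t _; congr EFin; rewrite /K1 !indicE !mem_setE !in_itv/=.
  by rewrite subr_ge0 andbC lerBlDr lerBlDr addrC.
have L2 s : (\int[leb]_t (K2 (t, s))%:E = (2 * h)%:E)%E.
  have <- : (x + h - s) - (x - h - s) = 2 * h by ring.
  rewrite -leb_itv; last by lra.
  apply: eq_integral => t _; congr EFin; rewrite /K2 !indicE !mem_setE !in_itv/=.
  by congr ((_ && _)%:R); apply/idP/idP; lra.
have KK1 t s s' : K1 (t, s) * K1 (t, s') <= K1 (t, s) * \1_(`[(- h)%R, h]%classic) (s - s').
  rewrite /K1 /= !indicE !mem_setE !in_itv/=.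
  case: andP => [[a1 a2]|_] /=; last by rewrite !mul0r.
  case: andP => [[b1 b2]|_] /=; last by rewrite mulr0 mulr_ge0.
  have -> : - h <= s - s' by lra.
  by have -> : s - s' <= h by lra.
have KK2 t s s' : K2 (t, s) * K2 (t, s') <=
    K2 (t, s) * \1_(`[(- (2 * h))%R, (2 * h)%R]%classic) (s - s').
  rewrite /K2 /= !indicE !mem_setE !in_itv/=.
  case: andP => [[a1 a2]|_] /=; last by rewrite !mul0r.
  case: andP => [[b1 b2]|_] /=; last by rewrite mulr0 mulr_ge0.
  have -> : - (2 * h) <= s - s' by lra.
  by have -> : s - s' <= 2 * h by lra.
have h20 : 0 <= 2 * h by rewrite mulr_ge0// ltW.
have Q1 : (\int[leb]_t ((\int[mu]_y (K1 (t, y))%:E) * (\int[mu]_y (K1 (t, y))%:E)) <=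
   h%:E * diffI mu (fun d => (\1_(`[(- h)%R, h]%classic) d)%:E) 0)%E.
  by apply: kernel_sqr_le => //; [exact: ltW|move=> s; rewrite L1].
have Q2 : (\int[leb]_t ((\int[nu]_y (K2 (t, y))%:E) * (\int[nu]_y (K2 (t, y))%:E)) <=
   (2 * h)%:E * diffI nu (fun d => (\1_(`[(- (2 * h))%R, (2 * h)%R]%classic) d)%:E) 0)%E.
  by apply: kernel_sqr_le => // s; rewrite L2.
have mK12 := measurable_kernel_prod mK1 mK2.
have K120 p : (0 <= (K1 (p.1, p.2.1) * K2 (p.1, p.2.2))%:E)%E by rewrite lee_fin mulr_ge0.
pose I := `[x, (x + h)%R]%classic : set TR.
have mI : measurable I by exact: measurable_itv.
have mII := measurable_shift2 (measurable_EFin_indic mI).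
have key : (h%:E * conv mu nu I <= \int[leb]_t ((\int[mu]_y (K1 (t, y))%:E) * (\int[nu]_y (K2 (t, y))%:E)))%E.
  under [leRHS]eq_integral do rewrite -kernel_prodE//.
  rewrite (tonelli leb (pair_prob mu nu) mK12 K120).
  rewrite convE// -(fubini_tonelli1 _ mII); last by move=> q; exact: indic_ge0.
  rewrite -ge0_integralZl//; last by rewrite lee_fin ltW.
  apply: ge0_le_integral => //.
  - by move=> q _; rewrite mule_ge0 ?indic_ge0// lee_fin ltW.
  - by apply: emeasurable_funM.
  - exact: (measurable_fun_fubini_tonelli_G _ mK12 K120).
  move=> [s s'] _ /=.
  have [/set_mem|] := boolP (s + s' \in I); last first.
    rewrite indicE => /negbTE ->; rewrite mule0.
    by apply: integral_ge0 => t _; exact: (K120 (t, (s, s'))).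
  rewrite /I /= in_itv/= => /andP[a1 a2].
  rewrite indicE mem_setE in_itv/= a1 a2 /= mule1 -(L1 s).
  apply: ge0_le_integral => //.
  - by move=> t _; rewrite lee_fin; have /andP[] := K101 (t, s).
  - by apply/measurable_EFinP; exact: (measurableT_comp mK1 (pair2_measurable s)).
  - exact: (measurableT_comp mK12 (pair2_measurable (s, s'))).
  move=> t _; rewrite lee_fin /K1 /K2 !indicE !mem_setE !in_itv/=.
  case: andP => [[b1 b2]|_] /=; last by rewrite mul0r.
  have -> : - h <= s' + t - x by lra.
  have -> : s' + t - x <= h by lra.
  by rewrite mul1r.
have mp : measurable_fun setT (fun t : TR => \int[mu]_y (K1 (t, y))%:E)%E.
  apply: (measurable_fun_fubini_tonelli_F (fun p => (K1 p)%:E)).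
    exact/measurable_EFinP.
  by move=> p; rewrite lee_fin; have /andP[] := K101 p.
have mq : measurable_fun setT (fun t : TR => \int[nu]_y (K2 (t, y))%:E)%E.
  apply: (measurable_fun_fubini_tonelli_F (fun p => (K2 p)%:E)).
    exact/measurable_EFinP.
  by move=> p; rewrite lee_fin; have /andP[] := K201 p.
have p0 t : (0 <= \int[mu]_y (K1 (t, y))%:E)%E.
  by apply: integral_ge0 => y _; rewrite lee_fin.
have q0 t : (0 <= \int[nu]_y (K2 (t, y))%:E)%E.
  by apply: integral_ge0 => y _; rewrite lee_fin.
(* Cauchy-Schwarz in the pointwise form 2 r r' <= r^2 + r'^2; both squares are of order h, so
   nothing is lost but a constant. *)
have pq : (2%:E * \int[leb]_t ((\int[mu]_y (K1 (t, y))%:E) * (\int[nu]_y (K2 (t, y))%:E)) <=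
    h%:E * diffI mu (fun d => (\1_(`[(- h)%R, h]%classic) d)%:E) 0 +
    (2 * h)%:E * diffI nu (fun d => (\1_(`[(- (2 * h))%R, (2 * h)%R]%classic) d)%:E) 0)%E.
  apply: le_trans (leeD Q1 Q2); rewrite -ge0_integralD//; last 4 first.
  - by move=> t _; rewrite mule_ge0.
  - by apply: emeasurable_funM.
  - by move=> t _; rewrite mule_ge0.
  - by apply: emeasurable_funM.
  rewrite -ge0_integralZl//; last 2 first.
  - by apply: emeasurable_funM.
  - by move=> t _; rewrite mule_ge0.
  apply: ge0_le_integral => //.
  - by move=> t _; rewrite mule_ge0// mule_ge0.
  - by apply: emeasurable_funM => //; exact: emeasurable_funM.
  - by apply: emeasurable_funD; exact: emeasurable_funM.
  move=> t _.
  have [r r0 ->] := kernel_int_fin mu mK1 K101 t.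
  have [r' r'0 ->] := kernel_int_fin nu mK2 K201 t.
  by rewrite -!EFinM -EFinD lee_fin; have := sqr_ge0 (r - r'); rewrite sqrrB; lra.
have z2 : (0 <= 2%:E :> \bar R)%E by rewrite lee_fin.
apply: (lee_cancel_scale h0 _ _ (le_trans (lee_wpmul2l z2 key) pq)).
  by apply: diffI_ge0 => d; exact: indic_ge0.
by apply: diffI_ge0 => d; exact: indic_ge0.
Qed.
End ConvDifference.

Section SpreadCoordinates.
Context {R : realType}.
Notation leb := (@lebesgue_measure R).
Notation TR := (measurableTypeR R).
Implicit Types (mu nu : probability TR R).

Lemma integral_cauchy : (\int[leb]_x ((1 + x ^+ 2)^-1)%:E = pi%:E :> \bar R)%E.
Proof.
have := @ge0_symfun_integralT R (fun x => (oneDsqr x)^-1).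
rewrite /oneDsqr => -> //=.
- rewrite (_ : [set x | _] = `[0, +oo[%classic); last first.
    by apply/seteqP; split => x/=; rewrite in_itv/= andbT.
  by rewrite integral0y_oneDsqr -EFinM mulrCA divff// mulr1.
- by move=> x; rewrite invr_ge0 addr_ge0// sqr_ge0.
- by move=> x; exact: continuous_oneDsqrV.
- by move=> x /=; rewrite sqrrN.
Qed.

Lemma measurable_cauchy (b : R) : measurable_fun [set: TR] (fun x : R => (1 + (b * x) ^+ 2)^-1).
Proof.
have mc : measurable_fun [set: TR] (fun x : R => (oneDsqr x)^-1).
  apply: continuous_measurable_fun => x; exact: continuous_oneDsqrV.
by apply: (measurableT_comp mc); apply: measurable_funM.
Qed.

Lemma integral_cauchy_scale (b : R) : 0 < b ->
  (\int[leb]_x ((1 + (b * x) ^+ 2)^-1)%:E = (pi / b)%:E :> \bar R)%E.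
Proof.
move=> b0.
have := @ge0_integral_affine R b 0 (fun x => ((1 + x ^+ 2)^-1)%:E) b0.
rewrite integral_cauchy -EFinM mulrC => <-.
- by apply: eq_integral => x _; rewrite addr0.
- have := measurable_cauchy 1; under eq_fun do rewrite mul1r.
  by move=> h; apply/measurable_EFinP.
- by move=> x; rewrite lee_fin invr_ge0 addr_ge0// sqr_ge0.
Qed.

(** The product is kept up to the second elementary symmetric polynomial, written with power sums;
    its nonnegativity is carried along because the induction step multiplies it by [z i]. *)
Lemma prod1D_ge (I : Type) (s : seq I) (z : I -> R) : (forall i, 0 <= z i) ->
  1 + \sum_(i <- s) z i + ((\sum_(i <- s) z i) ^+ 2 - \sum_(i <- s) z i ^+ 2) / 2
    <= \prod_(i <- s) (1 + z i)
  /\ 0 <= (\sum_(i <- s) z i) ^+ 2 - \sum_(i <- s) z i ^+ 2.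
Proof.
move=> z0; elim: s => [|i s [IH1 IH2]]; first by rewrite !big_nil expr0n/=; split; lra.
rewrite !big_cons; set S := \sum_(_ <- _) _ in IH1 IH2 *.
set Q := \sum_(_ <- _) _ in IH1 IH2 *; set P := \prod_(_ <- _) _ in IH1 *.
have S0 : 0 <= S by exact: sumr_ge0.
have zS : 0 <= z i * S by rewrite mulr_ge0.
split; last by rewrite sqrrD; lra.
have : (1 + z i) * (1 + S + (S ^+ 2 - Q) / 2) <= (1 + z i) * P.
  by rewrite ler_wpM2l// addr_ge0.
apply: le_trans; rewrite -subr_ge0.
rewrite (_ : _ - _ = z i * ((S ^+ 2 - Q) / 2)); last by field.
by rewrite mulr_ge0// divr_ge0.
Qed.

Section Spread.
Variables (s : seq nat) (p : nat -> R * R) (y : nat -> R) (V : R).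
Hypotheses (y0 : forall i, 0 <= y i) (yp : forall i, i \in s -> y i <= (p i).1 ^+ 4).
Hypotheses (V0 : 0 < V) (VE : V = \sum_(i <- s) y i).
Hypothesis yV : forall i, i \in s -> y i <= V / 2.

Lemma wprod_sqr (l : seq (R * R)) (t : R) :
  wprod l t ^+ 2 * \prod_(q <- l) (1 + 4 * t ^+ 2 * q.1 ^+ 4) = 1.
Proof.
rewrite /wprod; elim: l => [|q l IH]; first by rewrite !big_nil expr1n mulr1.
rewrite !big_cons exprMn exprVn sqr_sqrtr; last first.
  by rewrite addr_ge0// mulr_ge0 ?exprn_even_ge0// mulr_ge0// sqr_ge0.
rewrite mulrACA IH mulr1 mulVf// gt_eqF// ltr_pwDl// mulr_ge0 ?exprn_even_ge0//.
by rewrite mulr_ge0// sqr_ge0.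
Qed.

(** A single factor decays like 1 / |t|, which is not integrable. When no [y i] exceeds half of the
    total, the second-order term of the product is at least 4 (t^2 V)^2, so the square root of the
    product is of order 1 + 2 V t^2 and a Cauchy kernel results. *)
Lemma wprod_spread (t : R) :
  wprod (map p s) t <= 2 * (1 + (Num.sqrt (2 * V) * t) ^+ 2)^-1.
Proof.
have t0 : 0 <= t ^+ 2 by exact: sqr_ge0.
pose z i := 4 * t ^+ 2 * y i.
have z0 i : 0 <= z i by rewrite mulr_ge0// mulr_ge0.
have [H1 _] := prod1D_ge s z0.
have SE : \sum_(i <- s) z i = 4 * t ^+ 2 * V by rewrite VE mulr_sumr.
have QE : \sum_(i <- s) z i ^+ 2 <= (4 * t ^+ 2) ^+ 2 * (V / 2 * V).
  rewrite [in leRHS]VE !mulr_sumr -VE big_seq [leRHS]big_seq; apply: ler_sum => i si.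
  rewrite /z exprMn ler_wpM2l ?sqr_ge0// expr2 ler_wpM2r//.
  exact: yV.
set w := wprod _ t.
have w0 : 0 <= w by exact: wprod_ge0.
set A := \prod_(q <- map p s) (1 + 4 * t ^+ 2 * q.1 ^+ 4).
have wA : w ^+ 2 * A = 1 by exact: wprod_sqr.
have zA : \prod_(i <- s) (1 + z i) <= A.
  rewrite /A big_map big_seq [leRHS]big_seq; apply: ler_prod => i si.
  rewrite addr_ge0//= lerD2l; apply: ler_wpM2l; first by rewrite mulr_ge0.
  exact: yp.
have e : Num.sqrt (2 * V) ^+ 2 = 2 * V by rewrite sqr_sqrtr// mulr_ge0// ltW.
rewrite exprMn e.
set T := t ^+ 2 in t0 z z0 H1 SE QE w w0 A wA zA *.
set q := 1 + _.
have q1 : 1 <= q by rewrite lerDl mulr_ge0// mulr_ge0// ltW.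
have qA : q ^+ 2 <= 2 * A.
  move: H1; rewrite SE => H1; have := le_trans H1 zA => H2.
  have TV : 0 <= T * V by rewrite mulr_ge0// ltW.
  have := sqr_ge0 (1 - 2 * (T * V)); rewrite /q.
  have -> : (1 + 2 * V * T) = 1 + 2 * (T * V) by ring.
  move: H2 QE TV; have -> : 4 * T * V = 4 * (T * V) by ring.
  have -> : (4 * T) ^+ 2 * (V / 2 * V) = 8 * (T * V) ^+ 2 by field.
  set u := T * V; rewrite !expr2; nra.
rewrite ler_pdivlMr; last by lra.
rewrite -(@ler_pXn2r _ 2)// ?nnegrE ?mulr_ge0//; last by lra.
rewrite exprMn; have : w ^+ 2 * q ^+ 2 <= w ^+ 2 * (2 * A) by rewrite ler_wpM2l ?sqr_ge0.
by rewrite [_ * (2 * A)]mulrCA wA mulr1 => /le_trans; apply; rewrite expr2; lra.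
Qed.

Lemma diffI_spread (t m : R) : 0 < t ->
  (diffI (law (map p s)) (fun d => (kt t d)%:E) m <= (8 / Num.sqrt V)%:E)%E.
Proof.
move=> t0; apply: (le_trans (diffI_law_le _ _ t0)).
pose b := Num.sqrt (2 * V).
have b0 : 0 < b by rewrite sqrtr_gt0 mulr_gt0.
have c0 := @cpi_gt0 R; have c1 := @cpi_lt1 R.
apply: (@le_trans _ _ (2%:E * \int[leb]_x ((1 + (b * x) ^+ 2)^-1)%:E)%E).
  rewrite -ge0_integralZl//; last 2 first.
  - by apply/measurable_EFinP; exact: measurable_cauchy.
  - by move=> x _; rewrite lee_fin invr_ge0 addr_ge0// sqr_ge0.
  apply: ge0_le_integral => //.
  - by move=> x _; exact: Psi_arg_ge0.
  - exact: (measurableT_comp (measurable_Psi_arg (map p s)) (pair1_measurable (t : TR))).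
  - by apply: emeasurable_funM => //; apply/measurable_EFinP; exact: measurable_cauchy.
  move=> x _; rewrite -EFinM lee_fin; apply: le_trans (wprod_spread x).
  rewrite ler_piMl ?wprod_ge0//; apply: mulr_ile1; [exact: ltW|exact: expR_ge0|exact: ltW|].
  rewrite expR_le1 mulNr oppr_le0; apply: divr_ge0 => //.
  by apply: mulr_ge0; [exact: ltW|exact: sqr_ge0].
(* 2 pi / sqrt (2 V) <= 8 / sqrt V, using only pi < 4. *)
rewrite integral_cauchy_scale// -EFinM lee_fin mulrA.
have pi4 : pi / 2 < 2 :> R by exact: pihalf_lt2.
have pi0 : 0 < pi :> R by exact: pi_gt0.
have bV : Num.sqrt V <= b by apply: ler_wsqrtr; rewrite ler_peMl ?ler1n//; exact: ltW.
apply: ler_pM; [by rewrite mulr_ge0// ltW|by rewrite invr_ge0 ltW|lra|].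
by rewrite lef_pV2// posrE sqrtr_gt0.
Qed.

End Spread.

(** On [-L, L] the kernel [kt (L ^+ 2)] is at least exp (- 1/2) / L, which exceeds 1 / (2 L). *)
Lemma diffI_indic_le mu (D L : R) : 0 < L ->
  (forall t, 0 < t -> (diffI mu (fun d => (kt t d)%:E) 0 <= D%:E)%E) ->
  (diffI mu (fun d => (\1_(`[(- L)%R, L]%classic) d)%:E) 0 <= (2 * L * D)%:E)%E.
Proof.
move=> L0 HD; pose I := `[(- L)%R, L]%classic : set TR.
have mI : measurable I by exact: measurable_itv.
have t0 : 0 < L ^+ 2 by rewrite exprn_gt0.
have mk : measurable_fun [set: TR] (fun d : TR => (kt (L ^+ 2) d)%:E).
  by apply/measurable_EFinP; exact: measurable_kt.
have mk2 := measurable_diff2 0 mk.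
rewrite EFinM; apply: le_trans (lee_wpmul2l _ (HD _ t0)); last first.
  by rewrite lee_fin mulr_ge0// ltW.
rewrite !diffIE//; last 2 first.
- by move=> x; rewrite lee_fin kt_ge0.
- exact: measurable_EFin_indic.
rewrite -ge0_integralZl//; last 2 first.
- by move=> q _; rewrite lee_fin kt_ge0.
- by rewrite lee_fin mulr_ge0// ltW.
apply: ge0_le_integral => //.
- exact: (measurable_diff2 0 (measurable_EFin_indic mI)).
- by apply: emeasurable_funM.
move=> q _; rewrite -EFinM lee_fin; set d := 0 + _.
rewrite indicE mem_setE in_itv/=; case: andP => [[d1 d2]|_]; last first.
  by rewrite !mulr_ge0 ?kt_ge0// ltW.
rewrite /kt sqrtr_sqr gtr0_norm// -mulrA mulVKf ?gt_eqF//.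
have := expR_ge1Dx (- d ^+ 2 / (2 * L ^+ 2)).
have : d ^+ 2 / (2 * L ^+ 2) <= 1 / 2.
  rewrite ler_pdivrMr ?mulr_gt0//.
  have : d ^+ 2 <= L ^+ 2 by rewrite -subr_ge0 subr_sqr mulr_ge0; lra.
  by lra.
by rewrite mulNr /=; lra.
Qed.

Lemma conc_conv_diffI mu nu (D : R) : 0 <= D ->
  (forall t, 0 < t -> (diffI mu (fun d => (kt t d)%:E) 0 <= D%:E)%E) ->
  (forall t, 0 < t -> (diffI nu (fun d => (kt t d)%:E) 0 <= D%:E)%E) ->
  conc (conv mu nu) (5 * D).
Proof.
move=> D0 Hmu Hnu x h h0.
have h20 : 0 < 2 * h by rewrite mulr_gt0.
have := conv_itv_le mu nu x h0.
have := diffI_indic_le h0 Hmu; have := diffI_indic_le h20 Hnu => H1 H2 H3.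
have z2 : (0 <= 2%:E :> \bar R)%E by rewrite lee_fin.
have := le_trans H3 (leeD H2 (lee_wpmul2l z2 H1)).
rewrite -EFinM -EFinD => H4.
rewrite -(@lee_pmul2l _ 2%:E)// ?lte_fin//; apply: (le_trans H4).
by rewrite -EFinM lee_fin le_eqVlt; apply/orP; left; apply/eqP; ring.
Qed.

End SpreadCoordinates.

(** * Finite sums with many small coordinates *)

Section KappaConcentration.
Context {R : realType}.
Notation TR := (measurableTypeR R).

Lemma conc_ext (mu nu : probability TR R) M :
  (forall A, measurable A -> mu A = nu A) -> conc mu M -> conc nu M.
Proof. by move=> e c x h h0; rewrite -e//; exact: c. Qed.

Lemma law_seq1E (p : R * R) (f : TR -> \bar R) : measurable_fun setT f ->
  (forall x, 0 <= f x)%E -> (\int[law [:: p]]_x f x = \int[law1 p]_x f x)%E.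
Proof.
move=> mf f0; rewrite ge0_integral_law_cons//; apply: eq_integral => x _.
rewrite ge0_integral_law_nil ?addr0//.
exact: measurable_shiftR.
Qed.

Lemma conc_law2 (p q : R * R) : 0 < p.1 -> 0 < q.1 ->
  conc (law [:: p; q]) (8 / (p.1 * q.1)).
Proof.
case: p q => [s a] [t b] /= s0 t0.
apply: conc_ext (conc_pair a b s0 t0) => A mA.
have mI := @measurable_EFin_indic R _ _ A mA; have I0 := @indic_ge0 R _ A.
etransitivity; first exact: (convE _ _ mA).
apply/esym; etransitivity; first exact: (prob_indic _ mA).
etransitivity; first exact: (ge0_integral_law_cons (s, a) [:: (t, b)] mI I0).
apply: eq_integral => x _.
exact: (law_seq1E _ (measurable_shiftR x mI) (fun y => I0 _)).
Qed.

Section FiniteCases.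
Variables (lam : nat -> R) (p : nat -> R * R).
Hypotheses (lam0 : forall i, 0 <= lam i) (lamD : forall i j, (i <= j)%N -> lam j <= lam i).

(** Scales are bounded below and shifts are free, so that one concentration bound covers all the
    mixed sums met while coordinates are replaced one at a time. *)
Definition dominates (s : seq nat) : Prop :=
  forall i, i \in s -> 0 <= (p i).1 /\ lam i <= (p i).1 ^+ 2.

(** Serves to show that the terms of even rank and those of odd rank have nearly equal sums. *)
Lemma alt_sum (y : nat -> R) (m k : nat) : (forall i, 0 <= y i) ->
  (forall i j, (i <= j)%N -> y j <= y i) ->
  0 <= \sum_(i <- iota k m) (-1) ^+ (i - k)%N * y i <= y k.
Proof.
move=> y0 yD; elim: m k => [|m IH] k; first by rewrite big_nil lexx y0.
rewrite /= big_cons subnn expr0 mul1r.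
have -> : \sum_(j <- iota k.+1 m) (-1) ^+ (j - k)%N * y j =
    - \sum_(j <- iota k.+1 m) (-1) ^+ (j - k.+1)%N * y j.
  rewrite -sumrN big_seq [RHS]big_seq; apply: eq_bigr => j.
  rewrite mem_iota => /andP[kj _].
  by rewrite (_ : (j - k)%N = (j - k.+1).+1) ?exprS ?mulN1r ?mulNr// -subSn.
have /andP[h1 h2] := IH k.+1; have := yD _ _ (leqnSn k).
by move=> h3; apply/andP; split; lra.
Qed.

(* If the first two coordinates do not suffice, alternately splitting the remaining ones
   gives two independent groups, each carrying a fixed proportion of V. *)
Lemma conc_spread (k m : nat) (V : R) : dominates (iota k m) -> 0 < V ->
  V = \sum_(i <- iota k m) lam i ^+ 2 -> lam k ^+ 2 <= 2 / 5 * V ->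
  conc (law (map p (iota k m))) (80 / Num.sqrt V).
Proof.
move=> dom V0 VE kV.
have sV : 0 < Num.sqrt V by rewrite sqrtr_gt0.
case: m dom VE => [|[|m]] dom VE.
- by move: V0; rewrite VE big_nil ltxx.
- by move: kV; rewrite VE big_seq1; rewrite VE big_seq1 in V0; lra.
have [kk|kk] := leP (V / 10) (lam k * lam k.+1).
  have [d1 d2] : 0 <= (p k).1 /\ lam k <= (p k).1 ^+ 2.
    by apply: dom; rewrite inE eqxx.
  have [d3 d4] : 0 <= (p k.+1).1 /\ lam k.+1 <= (p k.+1).1 ^+ 2.
    by apply: dom; rewrite !inE eqxx orbT.
  have l1 := lam0 k; have l2 := lam0 k.+1.
  have q : V / 10 <= ((p k).1 * (p k.+1).1) ^+ 2.
    by rewrite exprMn (le_trans kk)// ler_pM.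
  have q0 : 0 < (p k).1 * (p k.+1).1.
    rewrite lt_neqAle mulr_ge0// andbT; apply/eqP => e.
    by move: q; rewrite -e expr0n/=; lra.
  have p1 : 0 < (p k).1 by rewrite lt_neqAle d1 andbT; apply/eqP => e; move: q0; rewrite -e mul0r ltxx.
  have p2 : 0 < (p k.+1).1 by rewrite lt_neqAle d3 andbT; apply/eqP => e; move: q0; rewrite -e mulr0 ltxx.
  rewrite (_ : map p _ = [:: p k; p k.+1] ++ map p (iota k.+2 m))//.
  apply/conc_catl/(conc_le _ (conc_law2 p1 p2)).
  rewrite ler_pdivlMr// mulrAC ler_pdivrMr//.
  suff : Num.sqrt V <= 10 * ((p k).1 * (p k.+1).1) by lra.
  rewrite -(@ler_pXn2r _ 2)// ?nnegrE ?mulr_ge0// ?sqrtr_ge0// sqr_sqrtr ?ltW//.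
  by rewrite exprMn; lra.
pose y i := lam i ^+ 2.
have y0 i : 0 <= y i by exact: sqr_ge0.
have yD i j : (i <= j)%N -> y j <= y i.
  by move=> ij; rewrite /y ler_pXn2r ?nnegrE//; exact: lamD.
have yk1 : y k.+1 <= V / 10.
  have := lamD (leqnSn k) => h; have := lam0 k.+1 => h0.
  by rewrite /y expr2; apply: le_trans (ltW kk); rewrite ler_wpM2r.
pose s := iota k.+1 m.+1.
pose f i := ~~ odd (i - k.+1)%N.
pose A := seq.filter f s; pose B := seq.filter (predC f) s.
have pAB : perm_eq (A ++ B) s by rewrite perm_filterC.
pose VA := \sum_(i <- A) y i; pose VB := \sum_(i <- B) y i.
have sAB : VA + VB = V - y k.
  have -> : V - y k = \sum_(i <- s) y i by rewrite VE [iota k _]/= big_cons addrC addKr.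
  by rewrite -(perm_big _ pAB) big_cat.
have dAB : VA - VB = \sum_(i <- s) (-1) ^+ (i - k.+1)%N * y i.
  rewrite -(perm_big _ pAB) big_cat /=; congr (_ + _).
    rewrite /VA big_filter [RHS]big_filter; apply: eq_bigr => i; rewrite /f => /negbTE fi.
    by rewrite -signr_odd fi expr0 mul1r.
  rewrite /VB -sumrN big_filter [RHS]big_filter; apply: eq_bigr => i /=; rewrite /f negbK => fi.
  by rewrite -signr_odd fi expr1 mulN1r.
have /andP[dAB0 dAB1] := alt_sum m.+1 k.+1 y0 yD.
rewrite -dAB in dAB0 dAB1.
have yle i : i \in s -> y i <= V / 10.
  by rewrite mem_iota => /andP[ki _]; apply: le_trans yk1; exact: yD.
(* The two sums add up to at least 3 V / 5 and differ by at most V / 10, so each is at least V / 4.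
   Every single square is at most V / 10 <= V / 8, half of that, as [diffI_spread] requires. *)
have VB4 : V / 4 <= VB by rewrite /y in kV sAB yk1 dAB0 dAB1; lra.
have VA4 : V / 4 <= VA by lra.
have domy i : i \in s -> y i <= (p i).1 ^+ 4.
  move=> si; have [d1 d2] : 0 <= (p i).1 /\ lam i <= (p i).1 ^+ 2.
    by apply: dom; rewrite [iota k _]/= inE si orbT.
  rewrite /y (_ : (p i).1 ^+ 4 = ((p i).1 ^+ 2) ^+ 2); last by rewrite -exprM.
  by rewrite ler_pXn2r ?nnegrE ?sqr_ge0//.
have sub C : {subset seq.filter C s <= s} by move=> i; rewrite mem_filter => /andP[].
have key (C : pred nat) (W : R) : W = \sum_(i <- seq.filter C s) y i -> V / 4 <= W ->
    forall t, 0 < t ->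
    (diffI (law (map p (seq.filter C s))) (fun d => (kt t d)%:E) 0 <= (16 / Num.sqrt V)%:E)%E.
  move=> WE W4 t t0.
  have W0 : 0 < W by lra.
  have yW i : i \in seq.filter C s -> y i <= W / 2.
    by move=> /sub /yle; lra.
  have yd i : i \in seq.filter C s -> y i <= (p i).1 ^+ 4 by move=> /sub /domy.
  apply: (le_trans (diffI_spread y0 yd W0 WE yW 0 t0)).
  have sW : 0 < Num.sqrt W by rewrite sqrtr_gt0.
  rewrite lee_fin ler_pdivrMr// mulrAC ler_pdivlMr//.
  suff : Num.sqrt V <= 2 * Num.sqrt W by lra.
  rewrite -(@ler_pXn2r _ 2)// ?nnegrE ?mulr_ge0 ?sqrtr_ge0// exprMn (sqr_sqrtr (ltW V0)).
  by rewrite (sqr_sqrtr (ltW W0)); lra.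
have D0 : 0 <= 16 / Num.sqrt V by rewrite divr_ge0// ltW.
have cAB := conc_conv_diffI D0 (key f VA erefl VA4) (key (predC f) VB erefl VB4).
rewrite (_ : map p _ = [:: p k] ++ map p s)//; apply: conc_catr.
apply: (@conc_perm _ (map p A ++ map p B)); first by rewrite -map_cat perm_map.
move=> x h h0; rewrite law_catE//; apply: (le_trans (cAB x h h0)).
by rewrite lee_fin mulrA (_ : 5 * 16 = 80 :> R)//; lra.
Qed.

End FiniteCases.
End KappaConcentration.

(** * Changing one coordinate *)

Section GaussianEstimates.
Context {R : realType}.
Notation leb := (@lebesgue_measure R).
Notation TR := (measurableTypeR R).
Notation gam := (@gam R).
Notation cpi := (@cpi R).

Lemma sqr_normr (x : R) : `|x| ^+ 2 = x ^+ 2.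
Proof. by rewrite real_normK// num_real. Qed.

Lemma gam_itv_le_gauss (u v : R) : 0 <= u -> u <= v ->
  (gam `[u, v]%classic <= ((v - u) * expR (- u ^+ 2 / 2))%:E)%E.
Proof.
move=> u0 uv; rewrite /gam/= /normal_prob.
apply: (@le_trans _ _ (\int[leb]_(x in `[u, v]%classic) (expR (- u ^+ 2 / 2))%:E)%E).
  apply: ge0_le_integral => //.
  - by move=> x _; rewrite lee_fin normal_pdf_ge0.
  - by apply/measurable_EFinP; apply: measurable_funTS; exact: measurable_normal_pdf.
  - move=> x /=; rewrite in_itv/= => /andP[ux _]; rewrite lee_fin normal_pdf01.
    rewrite -[leRHS]mul1r; apply: ler_pM; [exact/ltW/cpi_gt0|exact: expR_ge0|exact/ltW/cpi_lt1|].
    rewrite ler_expR ler_pM2r ?invr_gt0// lerN2 ler_pXn2r ?nnegrE//.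
    exact: le_trans ux.
rewrite integral_cst//= lebesgue_measure_itv/= lte_fin.
case: ifPn => _; last by rewrite mule0 lee_fin mulr_ge0 ?subr_ge0 ?expR_ge0.
by rewrite -EFinB -EFinM mulrC.
Qed.

Lemma gam_itv_ge_gauss (u v : R) : 0 <= u -> u <= v ->
  (((v - u) * (cpi * expR (- v ^+ 2 / 2)))%:E <= gam `[u, v]%classic)%E.
Proof.
move=> u0 uv; rewrite /gam/= /normal_prob.
apply: (@le_trans _ _ (\int[leb]_(x in `[u, v]%classic) (cpi * expR (- v ^+ 2 / 2))%:E)%E).
  rewrite integral_cst//= lebesgue_measure_itv/= lte_fin.
  case: ifPn => [_|]; first by rewrite -EFinB -EFinM mulrC.
  by rewrite -leNgt => vu; rewrite (le_anti (introT andP (conj uv vu))) subrr mul0r mule0.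
apply: ge0_le_integral => //.
- by move=> x _; rewrite lee_fin mulr_ge0 ?expR_ge0// ltW ?cpi_gt0.
- by apply/measurable_EFinP; apply: measurable_funTS; exact: measurable_normal_pdf.
- move=> x /=; rewrite in_itv/= => /andP[ux xv]; rewrite lee_fin normal_pdf01.
  rewrite ler_pM2l ?cpi_gt0// ler_expR ler_pM2r ?invr_gt0// lerN2 ler_pXn2r ?nnegrE//.
    exact: le_trans ux.
  exact: le_trans uv.
Qed.

(** On the tail c z^2 <= 3 z^2 / 8 - v^2 / 4, and exp (3 Z^2 / 8) has expectation (1 - 3/4)^(-1/2) =
    2. *)
Lemma gam_weighted_tail (c v : R) : 0 <= c <= 1 / 8 -> 0 <= v ->
  (\int[gam]_z ((\1_(~` `[(- v)%R, v]%classic) z)%:E * (expR (c * z ^+ 2))%:E)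
    <= (2 * expR (- v ^+ 2 / 4))%:E)%E.
Proof.
move=> /andP[c0 c1] v0.
have mI : measurable (~` `[(- v)%R, v]%classic : set TR) by apply: measurableC; exact: measurable_itv.
apply: (@le_trans _ _ (\int[gam]_z ((expR (- v ^+ 2 / 4))%:E * (expR (- ((- (3/4)) * z ^+ 2) / 2))%:E))%E).
  apply: ge0_le_integral => //.
  - by apply: emeasurable_funM; [exact: measurable_EFin_indic|mfun].
  - by apply: emeasurable_funM; [exact: measurable_cst|mfun].
  move=> z _; rewrite -!EFinM lee_fin -expRD.
  rewrite indicE; case: (boolP (z \in _)) => [|_]; last by rewrite mul0r expR_ge0.
  rewrite inE /= in_itv/= => /negP; rewrite -ler_norml -ltNge => vz.
  rewrite mul1r ler_expR.
  have : v ^+ 2 <= z ^+ 2 by rewrite -(sqr_normr z) ler_pXn2r ?nnegrE// ltW.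
  have := sqr_ge0 z; have : c * z ^+ 2 <= 1 / 8 * z ^+ 2 by rewrite ler_wpM2r ?sqr_ge0.
  by lra.
rewrite ge0_integralZl//; last by mfun.
rewrite integral_gam_gauss; last by lra.
rewrite -EFinM lee_fin mulrC ler_pM2r ?expR_gt0//.
rewrite (_ : 1 + - (3 / 4) = 2^-1 ^+ 2 :> R); last by field.
by rewrite sqrtr_sqr ger0_norm// invrK.
Qed.

Lemma expR_taylor (x : R) : `|expR x - 1 - x| <= x ^+ 2 * expR `|x|.
Proof.
have [x0|x0] := leP 0 x.
  rewrite !ger0_norm//; last by have := expR_ge1Dx x; lra.
  have e0 := expR_gt0 x; have eN := expRxMexpNx_1 x.
  have h : (1 - x) * expR x <= 1.
    rewrite -eN [leRHS]mulrC ler_pM2r//; have := expR_ge1Dx (- x); lra.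
  have : 0 <= (1 + x) * (1 - (1 - x) * expR x) by rewrite mulr_ge0; lra.
  by rewrite expr2; lra.
have := @expRN_taylor R (- x); rewrite opprK oppr_ge0 => /(_ (ltW x0)).
rewrite sqrrN => /le_trans; apply.
by rewrite ler_peMr ?sqr_ge0// -expR0 ler_expR.
Qed.

(** The quantity bounded is the density of the symmetrized N(b, 1) relative to N(0, 1), minus 1: the
    terms linear in b z cancel between the two exponentials. The remainder grows like exp (3 |z|),
    which exp (z^2 / 8) absorbs; the constant exp 20 comes from (|z| - 12)^2 >= 0. *)
Lemma gauss_shift_bound (b z : R) : `|b| <= 1 ->
  `|expR (- b ^+ 2 / 2) * ((expR (b * z) + expR (- (b * z))) / 2) - 1|
   <= 2 * expR 20 * b ^+ 2 * expR (1 / 8 * z ^+ 2).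
Proof.
move=> b1.
pose x1 := - b ^+ 2 / 2 + b * z; pose x2 := - b ^+ 2 / 2 - b * z.
have -> : expR (- b ^+ 2 / 2) * ((expR (b * z) + expR (- (b * z))) / 2) - 1 =
    ((expR x1 - 1 - x1) + (expR x2 - 1 - x2)) / 2 - b ^+ 2 / 2.
  by rewrite /x1 /x2 !expRD; field.
set q := 1 / 2 + `|z|.
have z0 : 0 <= `|z| by []. have b0 : 0 <= `|b| by [].
have q0 : 0 <= q by rewrite /q; lra.
have b2 : b ^+ 2 <= `|b| by rewrite -sqr_normr expr2 ler_piMl.
have bz : `|b * z| = `|b| * `|z| by rewrite normrM.
have bb : `|- b ^+ 2 / 2| = b ^+ 2 / 2.
  by rewrite mulNr normrN ger0_norm// divr_ge0// sqr_ge0.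
have X1 : `|x1| <= `|b| * q.
  by apply: (le_trans (ler_normD _ _)); rewrite bb bz /q; lra.
have X2 : `|x2| <= `|b| * q.
  by apply: (le_trans (ler_normB _ _)); rewrite bb bz /q; lra.
have bq : `|b| * q <= q by rewrite ler_piMl.
have eq3 : expR (3 * q) = expR q ^+ 3 by rewrite -expRM_natl; congr expR.
have qe : q <= expR q by have := expR_ge1Dx q; lra.
have e1 : 1 <= expR q by rewrite -expR0 ler_expR.
have T x : `|x| <= `|b| * q -> `|expR x - 1 - x| <= b ^+ 2 * expR (3 * q).
  move=> xq; apply: (le_trans (expR_taylor x)).
  have : x ^+ 2 <= b ^+ 2 * q ^+ 2.
    by rewrite -[x ^+ 2]sqr_normr -[b ^+ 2]sqr_normr -exprMn ler_pXn2r ?nnegrE ?mulr_ge0.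
  have : expR `|x| <= expR q by rewrite ler_expR (le_trans xq).
  move=> h1 h2.
  apply: (@le_trans _ _ (b ^+ 2 * q ^+ 2 * expR q)).
    by apply: ler_pM => //; exact: sqr_ge0.
  rewrite -mulrA ler_wpM2l ?sqr_ge0// eq3 (exprSr (expR q)) ler_pM2r ?expR_gt0//.
  by rewrite ler_pXn2r ?nnegrE ?expR_ge0.
have q8 : expR (3 * q) <= expR 20 * expR (1 / 8 * z ^+ 2).
  rewrite -expRD ler_expR /q -[z ^+ 2]sqr_normr.
  by have := sqr_ge0 (`|z| - 12); rewrite sqrrB; lra.
have e3 : 1 <= expR (3 * q) by rewrite eq3 exprn_ege1.
apply: (le_trans (ler_normB _ _)).
rewrite [X in _ + X]ger0_norm ?divr_ge0 ?sqr_ge0//.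
rewrite normrM [X in _ * X]ger0_norm// ?invr_ge0//.
have := le_trans (ler_normD (expR x1 - 1 - x1) (expR x2 - 1 - x2)) (lerD (T _ X1) (T _ X2)).
set N := `|_ + _| => hN.
have b20 : 0 <= b ^+ 2 by exact: sqr_ge0.
have h1 : b ^+ 2 * 1 <= b ^+ 2 * expR (3 * q) by rewrite ler_wpM2l.
have h2 : b ^+ 2 * expR (3 * q) <= b ^+ 2 * (expR 20 * expR (1 / 8 * z ^+ 2)) by rewrite ler_wpM2l.
have -> : 2 * expR 20 * b ^+ 2 * expR (1 / 8 * z ^+ 2) = 2 * (b ^+ 2 * (expR 20 * expR (1 / 8 * z ^+ 2))) by ring.
by lra.
Qed.

End GaussianEstimates.

Section OneStep.
Context {R : realType}.
Notation TR := (measurableTypeR R).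
Notation gam := (@gam R).
Notation cpi := (@cpi R).

Definition outer (v : R) : set TR := ~` `[(- v)%R, v]%classic.

Lemma measurable_outer v : measurable (outer v).
Proof. by apply: measurableC; exact: measurable_itv. Qed.

Lemma outerE v (z : R) : outer v z = (v < `|z|) :> Prop.
Proof.
rewrite /outer /setC /= in_itv/= -ler_norml ltNge; apply/propext.
by split=> /negP.
Qed.

Lemma indic_outerN v (z : R) : \1_(outer v) (- z) = \1_(outer v) z :> R.
Proof.
by rewrite !indicE; congr (_%:R); congr nat_of_bool; apply/idP/idP => /set_mem h;
  apply/mem_set; move: h; rewrite !outerE normrN.
Qed.

Lemma gam_shift (b : R) (f : TR -> \bar R) : measurable_fun setT f -> (forall x, 0 <= f x)%E ->
  (\int[gam]_z f (z - b)%R = \int[gam]_z (f z * (expR (- b ^+ 2 / 2 - b * z))%:E))%E.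
Proof.
move=> mf f0.
have m1 : measurable_fun setT (fun z : TR => f (z - b)%R).
  by apply: (measurableT_comp mf); mfun.
have m2 : measurable_fun setT (fun z : TR => (f z * (expR (- b ^+ 2 / 2 - b * z))%:E)%E).
  by apply: emeasurable_funM => //; mfun.
rewrite integral_gamE// integral_gamE//; last first.
  by move=> z; rewrite mule_ge0// lee_fin expR_ge0.
have m3 : measurable_fun setT (fun z : TR => (f (z - b)%R * (cpi * expR (- z ^+ 2 / 2))%:E)%E).
  by apply: emeasurable_funM => //; mfun.
have g0 (z : TR) : (0 <= f (z - b)%R * (cpi * expR (- z ^+ 2 / 2))%:E)%E.
  by rewrite mule_ge0// lee_fin mulr_ge0 ?expR_ge0// ltW ?cpi_gt0.
rewrite (ge0_integral_subst_affine b ltr01 m3 g0) mul1e.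
apply: eq_integral => z _; rewrite mul1r addrK -muleA -EFinM; congr (_ * EFin _)%E.
by rewrite mulrCA -expRD; congr (_ * expR _); field.
Qed.

(** For an even function the shifts by b and - b give the same integral, so their two densities may
    be averaged. *)
Lemma gam_shift_even (b : R) (f : TR -> \bar R) : measurable_fun setT f ->
  (forall x, 0 <= f x)%E -> (forall x : R, f (- x)%R = f x) ->
  (\int[gam]_z f (z - b)%R =
   \int[gam]_z (f z * (expR (- b ^+ 2 / 2) * ((expR (b * z) + expR (- (b * z))) / 2))%:E))%E.
Proof.
move=> mf f0 fN; rewrite gam_shift//.
set J := (\int[gam]_z _)%E.
pose F (c : R) (z : TR) := (f z * (2^-1 * expR (- b ^+ 2 / 2 + c * z))%:E)%E.
have mF c : measurable_fun setT (F c) by apply: emeasurable_funM => //; mfun.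
have F0 c z : (0 <= F c z)%E by rewrite mule_ge0// lee_fin mulr_ge0// expR_ge0.
have J1 : (\int[gam]_z F (- b)%R z = 2^-1%:E * J)%E.
  rewrite /J -ge0_integralZl//.
  - by apply: eq_integral => z _; rewrite /F [- b * z]mulNr EFinM muleCA.
  - by apply: emeasurable_funM => //; mfun.
  - by move=> z _; rewrite mule_ge0// lee_fin expR_ge0.
have J2 : (\int[gam]_z F b z = \int[gam]_z F (- b)%R z)%E.
  rewrite (gam_sym (mF b) (F0 b)); apply: eq_integral => z _.
  by rewrite /F fN [b * - z]mulrN [- b * z]mulNr.
transitivity (\int[gam]_z (F (- b)%R z + F b z))%E.
  have -> : (\int[gam]_z (F (- b)%R z + F b z) = \int[gam]_z F (- b)%R z + \int[gam]_z F b z)%E.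
    apply: ge0_integralD; [exact: measurableT|by move=> z _; exact: F0|exact: mF
      |by move=> z _; exact: F0|exact: mF].
  rewrite J2 J1 -ge0_muleDl; [|by rewrite lee_fin..].
  have -> : (2^-1%:E + 2^-1%:E = 1 :> \bar R)%E by rewrite -EFinD; congr EFin; field.
  by rewrite mul1e.
apply: eq_integral => z _; rewrite /F -ge0_muleDr; [|by rewrite lee_fin mulr_ge0 ?expR_ge0..].
by rewrite -EFinD; congr (_ * EFin _)%E; rewrite !expRD [- b * z]mulNr; field.
Qed.

Lemma outer_shift (b v : R) : `|b| <= 1 -> 0 <= v ->
  let A := (\int[gam]_z (\1_(outer v) (z - b)%R)%:E)%E in
  let X := (4 * expR 20 * b ^+ 2 * expR (- v ^+ 2 / 4))%:E in
  (A <= gam (outer v) + X)%E /\ (gam (outer v) <= A + X)%E.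
Proof.
move=> b1 v0 A X; have mo := measurable_outer v.
have mi := @measurable_EFin_indic R _ _ _ mo.
have AE : A = (\int[gam]_z ((\1_(outer v) z)%:E * (expR (- b ^+ 2 / 2) * ((expR (b * z) + expR (- (b * z))) / 2))%:E))%E.
  apply: (gam_shift_even b mi); first by move=> x; exact: indic_ge0.
  by move=> x; rewrite indic_outerN.
pose K := 2 * expR 20 * b ^+ 2.
have K0 : 0 <= K by rewrite /K mulr_ge0 ?sqr_ge0// mulr_ge0 ?expR_ge0.
pose W (z : TR) := ((\1_(outer v) z)%:E * (expR (1 / 8 * z ^+ 2))%:E)%E.
have mW : measurable_fun setT W by apply: emeasurable_funM => //; mfun.
have W0 z : (0 <= W z)%E by rewrite mule_ge0 ?indic_ge0// lee_fin expR_ge0.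
have WX : (\int[gam]_z (K%:E * W z) <= X)%E.
  rewrite ge0_integralZl//.
  apply: (@le_trans _ _ (K%:E * (2 * expR (- v ^+ 2 / 4))%:E)%E).
    by rewrite lee_wpmul2l ?lee_fin//; apply: gam_weighted_tail => //; lra.
  by rewrite -EFinM lee_fin le_eqVlt; apply/orP; left; apply/eqP; rewrite /K; ring.
pose E (z : R) := expR (- b ^+ 2 / 2) * ((expR (b * z) + expR (- (b * z))) / 2).
have E0 z : 0 <= E z by rewrite mulr_ge0 ?expR_ge0// divr_ge0 ?addr_ge0 ?expR_ge0.
have mE : measurable_fun [set: TR] (fun z : TR => (E z)%:E) by rewrite /E; mfun.
have mK : measurable_fun setT (fun z => (K%:E * W z)%E) by exact: emeasurable_funM.
have KW0 z : (0 <= K%:E * W z)%E by rewrite mule_ge0 ?lee_fin.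
have mIE : measurable_fun setT (fun z : TR => ((\1_(outer v) z)%:E * (E z)%:E)%E) by exact: emeasurable_funM.
have IE0 z : (0 <= (\1_(outer v) z : R)%:E * (E z)%:E)%E by rewrite mule_ge0 ?indic_ge0 ?lee_fin.
have bd z : `|E z - 1| <= K * expR (1 / 8 * z ^+ 2) by exact: gauss_shift_bound.
split.
  rewrite AE (prob_indic gam mo).
  apply: (@le_trans _ _ (\int[gam]_z ((\1_(outer v) z)%:E + K%:E * W z))%E); last first.
    by rewrite ge0_integralD// leeD2l.
  apply: ge0_le_integral => //.
  - exact: emeasurable_funD.
  move=> z _; rewrite -!EFinM -EFinD lee_fin.
  have /ler_normlP[_ h] := bd z.
  rewrite -/(E z); have i0 : 0 <= \1_(outer v) z :> R by rewrite indicE.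
  by have := ler_wpM2l i0 h; set i := \1_(outer v) z; set e := expR _; lra.
rewrite AE (prob_indic gam mo).
apply: (@le_trans _ _ (\int[gam]_z ((\1_(outer v) z)%:E * (E z)%:E + K%:E * W z))%E); last first.
  by rewrite ge0_integralD// leeD2l.
apply: ge0_le_integral => //.
- exact: emeasurable_funD.
move=> z _; rewrite -!EFinM -EFinD lee_fin.
have /ler_normlP[h _] := bd z.
have i0 : 0 <= \1_(outer v) z :> R by rewrite indicE.
have := ler_wpM2l i0 h; move: (E z) => Ez; set i := \1_(outer v) z; set e := expR _.
by lra.
Qed.

Lemma outer_scale (u v : R) : 0 <= u -> u <= v ->
  (gam (outer v) <= gam (outer u))%E /\
  (gam (outer u) <= gam (outer v) + (2 * (v - u) * expR (- u ^+ 2 / 2))%:E)%E.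
Proof.
move=> u0 uv; split.
  apply: le_measure; rewrite ?inE; [exact: measurable_outer|exact: measurable_outer|].
  by move=> z; rewrite !outerE; exact: le_lt_trans.
have mo := measurable_outer.
have gsym : gam `[(- v)%R, (- u)%R]%classic = gam `[u, v]%classic.
  rewrite !prob_indic// gam_sym//; last exact: measurable_EFin_indic.
  apply: eq_integral => z _; congr EFin; rewrite !indicE !mem_setE !in_itv/=.
  by rewrite !lerN2 andbC.
apply: (@le_trans _ _ (gam (outer v `|` (`[u, v]%classic `|` `[(- v)%R, (- u)%R]%classic)))).
  apply: le_measure; rewrite ?inE//; first by do 2 apply: measurableU => //.
  move=> z; rewrite outerE => uz.
  have [zv|vz] := leP `|z| v; last by left; rewrite outerE.
  right => /=; rewrite !in_itv/=; move: uz zv.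
  have [z0|z0] := leP 0 z; first by rewrite ger0_norm// => /ltW -> ->; left.
  by rewrite ltr0_norm// => h1 h2; right; apply/andP; split; lra.
apply: (le_trans (measureU2 _ _ _)) => //; first exact: measurableU.
rewrite leeD2l//; apply: (le_trans (measureU2 _ _ _)) => //.
have h := gam_itv_le_gauss u0 uv; have h' := h; rewrite -gsym in h'.
apply: (le_trans (leeD h h')).
by rewrite -EFinD lee_fin le_eqVlt; apply/orP; left; apply/eqP; ring.
Qed.

End OneStep.

Section OneStepLaw.
Context {R : realType}.
Notation TR := (measurableTypeR R).
Notation gam := (@gam R).
Notation cpi := (@cpi R).

Lemma law1_tailE (s a y : R) : 0 < s -> 0 <= y ->
  law1 (s, a) `]y, +oo[%classic = (\int[gam]_z (\1_(outer (Num.sqrt y / s)) (z - a / s)%R)%:E)%E.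
Proof.
move=> s0 y0; have mI : measurable (`]y, +oo[%classic : set TR) by exact: measurable_itv.
rewrite (prob_indic _ mI) (ge0_integral_law1 _ (measurable_EFin_indic mI) (@indic_ge0 _ _ _)).
apply: eq_integral => z _; rewrite !indicE; congr (_%:R%:E); congr nat_of_bool.
have e : (y < (s * z - a) ^+ 2) = (Num.sqrt y / s < `|z - a / s|).
  rewrite ltr_pdivrMr// (_ : s * z - a = (z - a / s) * s); last by field; rewrite gt_eqF.
  rewrite exprMn -{1}(sqr_sqrtr y0) -(sqr_normr (z - _)) -exprMn.
  by rewrite ltr_pXn2r ?nnegrE ?sqrtr_ge0// mulr_ge0// ltW.
apply/idP/idP => /set_mem h; apply/mem_set; move: h; rewrite outerE /= in_itv/= andbT.
  by rewrite e.
by rewrite e.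
Qed.

Lemma law1_tail0 (t y : R) : 0 < t -> 0 <= y ->
  law1 (t, 0) `]y, +oo[%classic = gam (outer (Num.sqrt y / t)).
Proof.
move=> t0 y0; rewrite law1_tailE// prob_indic; last exact: measurable_outer.
by apply: eq_integral => z _; rewrite mul0r subr0.
Qed.

Lemma law1_tail_neg (p : R * R) (y : R) : y < 0 -> law1 p `]y, +oo[%classic = 1%E.
Proof.
move=> y0; have := @probability_setT _ _ _ gam; rewrite /= => <-.
rewrite /law1/= /distribution/pushforward/=; congr (gam _).
by apply/seteqP; split=> // z _ /=; rewrite in_itv/= andbT (lt_le_trans y0)// sqr_ge0.
Qed.

(* C1 compensates for exp (2 u - u^2 / 8) <= exp 8 in the lower bound on intervals. *)
Definition C1 : R := 2 * expR (1 / 8) * expR 8 / cpi.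
(** Of the factor 10, 8 pays for the shift of the mean and 2 for the change of scale in
    [law1_tail_smooth]. *)
Definition C2 : R := 10 * expR 20.

Lemma C1_gt0 : 0 < C1.
Proof. by rewrite /C1 divr_gt0 ?(@cpi_gt0 R)// mulr_gt0 ?expR_gt0// mulr_gt0// expR_gt0. Qed.

Lemma C2_gt0 : 0 < C2.
Proof. by rewrite mulr_gt0// expR_gt0. Qed.

(** With u = sqrt y / t, the preimage of the interval contains [u / 2, w / 2] where w^2 = u^2 + h /
    t^2, so that w - u is at least h / t^2 divided by 2 u + 1. The density there is at least of
    order exp (- w^2 / 8), and its advantage over exp (- u^2 / 4) absorbs the factor 2 u + 1. *)
Lemma law1_itv_ge (t y h : R) : 0 < t -> 0 <= y -> 0 < h -> h <= t ^+ 2 ->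
  ((h / t ^+ 2 * expR (- (Num.sqrt y / t) ^+ 2 / 4))%:E
    <= C1%:E * law1 ((2 * t)%R, 0%R) `[y, (y + h)%R]%classic)%E.
Proof.
move=> t0 y0 h0 ht; set u := Num.sqrt y / t; set d := h / t ^+ 2.
have u0 : 0 <= u by rewrite divr_ge0 ?sqrtr_ge0// ltW.
have d0 : 0 < d by rewrite divr_gt0// exprn_gt0.
have d1 : d <= 1 by rewrite ler_pdivrMr ?exprn_gt0// mul1r.
pose w := Num.sqrt (u ^+ 2 + d).
have ud0 : 0 <= u ^+ 2 + d by rewrite addr_ge0 ?sqr_ge0// ltW.
have w2 : w ^+ 2 = u ^+ 2 + d by rewrite sqr_sqrtr.
have w0 : 0 <= w by rewrite sqrtr_ge0.
have uw : u <= w.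
  by rewrite -(ler_pXn2r (n:=2))// ?nnegrE// w2; lra.
have w1 : w <= u + 1.
  rewrite -(ler_pXn2r (n:=2))// ?nnegrE; [|lra].
  by rewrite w2 sqrrD; lra.
have sub : `[(u / 2)%R, (w / 2)%R]%classic `<=` sqf (2 * t) 0 @^-1` `[y, (y + h)%R]%classic.
  move=> z /=; rewrite /sqf !in_itv/= subr0 => /andP[z1 z2].
  have z0 : 0 <= z by apply: le_trans z1; rewrite divr_ge0.
  have u2 : u ^+ 2 * t ^+ 2 = y by rewrite -exprMn /u divfK ?gt_eqF// sqr_sqrtr.
  have wt2 : w ^+ 2 * t ^+ 2 = y + h.
    by rewrite w2 mulrDl u2 /d divfK// expf_neq0// gt_eqF.
  have t0' := ltW t0.
  have tz : 0 <= 2 * t * z by rewrite !mulr_ge0.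
  have ut0 : 0 <= u * t by rewrite mulr_ge0.
  have wt0 : 0 <= w * t by rewrite mulr_ge0.
  rewrite -wt2 -u2 -!exprMn; apply/andP; split; rewrite ler_pXn2r ?nnegrE// [2 * t * z]mulrAC ler_pM2r//; lra.
have le1 : (gam `[(u / 2)%R, (w / 2)%R]%classic <= law1 ((2 * t)%R, 0%R) `[y, (y + h)%R]%classic)%E.
  rewrite /law1/= /distribution/pushforward/=; apply: le_measure => //; rewrite inE.
    exact: measurable_itv.
  by rewrite -[X in measurable X]setTI; apply: (@measurable_sqf R (2 * t) 0) => //; exact: measurable_itv.
have uw2 : u / 2 <= w / 2 by lra.
have u20 : 0 <= u / 2 by lra.
have g := gam_itv_ge_gauss u20 uw2.
apply: (@le_trans _ _ (C1%:E * gam `[(u / 2)%R, (w / 2)%R]%classic)%E); last first.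
  by rewrite lee_wpmul2l// lee_fin ltW// C1_gt0.
apply: (@le_trans _ _ (C1%:E * ((w / 2 - u / 2) * (cpi * expR (- (w / 2) ^+ 2 / 2)))%:E)%E); last first.
  by rewrite lee_wpmul2l// lee_fin ltW// C1_gt0.
rewrite -EFinM lee_fin /C1.
have -> : 2 * expR (1 / 8) * expR 8 / cpi * ((w / 2 - u / 2) * (cpi * expR (- (w / 2) ^+ 2 / 2))) =
   (w - u) * (expR (1 / 8) * (expR 8 * expR (- (w / 2) ^+ 2 / 2))).
  by field; rewrite gt_eqF// (@cpi_gt0 R).
have wu : d <= (w - u) * (2 * u + 1).
  have : (w - u) * (w + u) = d by rewrite -subr_sqr w2; ring.
  have : (w - u) * (w + u) <= (w - u) * (2 * u + 1) by rewrite ler_wpM2l; lra.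
  by lra.
apply: (@le_trans _ _ ((w - u) * (2 * u + 1) * expR (- u ^+ 2 / 4))).
  by rewrite ler_wpM2r ?expR_ge0.
rewrite -mulrA ler_wpM2l ?subr_ge0//.
apply: (@le_trans _ _ (expR (2 * u) * expR (- u ^+ 2 / 4))).
  by rewrite ler_wpM2r ?expR_ge0//; have := expR_ge1Dx (2 * u); lra.
rewrite -!expRD ler_expR [(w / 2) ^+ 2]exprMn w2.
by have := sqr_ge0 (u - 8); rewrite sqrrB exprVn; lra.
Qed.

(** By Cauchy-Schwarz (s z - a)^2 <= (z^2 + 1) (s^2 + a^2) <= (z^2 + 1) t^2, and the exponential
    Markov inequality with exp (z^2 / 4) bounds the tail. It serves when h is comparable with
    t^2. *)
Lemma law1_tail_chernoff (s a h t y : R) : 0 < t -> 0 <= y -> a ^+ 2 <= h ->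
  t ^+ 2 = s ^+ 2 + h ->
  (law1 (s, a) `]y, +oo[%classic <= (2 * expR 20 * expR (- (Num.sqrt y / t) ^+ 2 / 4))%:E)%E.
Proof.
move=> t0 y0 ah tE; set u := Num.sqrt y / t.
have mI : measurable (`]y, +oo[%classic : set TR) by exact: measurable_itv.
rewrite (prob_indic _ mI) (ge0_integral_law1 _ (measurable_EFin_indic mI) (@indic_ge0 _ _ _)).
apply: (@le_trans _ _ (\int[gam]_z ((expR ((1 - u ^+ 2) / 4))%:E * (expR (- ((- 2^-1) * z ^+ 2) / 2))%:E))%E).
  apply: ge0_le_integral => //.
  - have mI' := @measurable_EFin_indic R _ _ _ mI.
    by apply: (measurableT_comp mI'); mfun.
  - by apply: emeasurable_funM; [exact: measurable_cst|mfun].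
  move=> z _; rewrite -!EFinM lee_fin -expRD indicE.
  case: (boolP (_ \in _)) => [|_]; last by rewrite expR_ge0.
  rewrite inE /= in_itv/= andbT => yz.
  have : u ^+ 2 * t ^+ 2 <= (z ^+ 2 + 1) * t ^+ 2.
    rewrite -exprMn /u divfK ?gt_eqF// sqr_sqrtr//.
    apply: (le_trans (ltW yz)).
    apply: (@le_trans _ _ ((z ^+ 2 + 1) * (s ^+ 2 + a ^+ 2))).
      by have := sqr_ge0 (s + a * z); rewrite sqrrD sqrrB !exprMn; nra.
    by rewrite tE ler_wpM2l ?addr_ge0 ?sqr_ge0//; lra.
  rewrite ler_pM2r ?exprn_gt0// => h1.
  by rewrite -[leLHS]expR0 ler_expR; lra.
rewrite ge0_integralZl//; last by mfun.
rewrite integral_gam_gauss; last by lra.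
rewrite -EFinM lee_fin.
have -> : expR ((1 - u ^+ 2) / 4) = expR (1 / 4) * expR (- u ^+ 2 / 4).
  by rewrite -expRD; congr expR; field.
rewrite mulrAC ler_pM2r ?expR_gt0// mulrC; apply: ler_pM; rewrite ?expR_ge0 ?invr_ge0 ?sqrtr_ge0//.
  rewrite -[leRHS]invrK lef_pV2 ?posrE ?invr_gt0// ?sqrtr_gt0; [|lra].
  apply: (@le_trans _ _ (Num.sqrt (2^-1 ^+ 2))); first by rewrite sqrtr_sqr ler_norm.
  by apply: ler_wsqrtr; rewrite expr2; lra.
by rewrite ler_expR; lra.
Qed.

(* Here t and s are comparable, so the tail is that of N(b, 1) outside [-v, v] with b^2 and
   v - u of order h / t^2; evenness removes the term linear in b. *)
Lemma law1_tail_smooth (s a h t y : R) : 0 < s -> 0 < t -> 0 < h -> 0 <= y -> a ^+ 2 <= h ->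
  t ^+ 2 = s ^+ 2 + h -> h / t ^+ 2 <= 1 / 2 ->
  let X := (C2 * (h / t ^+ 2 * expR (- (Num.sqrt y / t) ^+ 2 / 4)))%:E in
  (law1 (s, a) `]y, +oo[%classic <= law1 (t, 0%R) `]y, +oo[%classic + X)%E /\
  (law1 (t, 0%R) `]y, +oo[%classic <= law1 (s, a) `]y, +oo[%classic + X)%E.
Proof.
move=> s0 t0 h0 y0 ah tE.
set u := Num.sqrt y / t; set d := h / t ^+ 2 => d2 X.
have t2 : 0 < t ^+ 2 by rewrite exprn_gt0.
have s2 : 0 < s ^+ 2 by rewrite exprn_gt0.
have u0 : 0 <= u by rewrite divr_ge0 ?sqrtr_ge0// ltW.
have d0 : 0 < d by rewrite divr_gt0.
have hd : h = d * t ^+ 2 by rewrite /d divfK// gt_eqF.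
have sE : s ^+ 2 = t ^+ 2 * (1 - d) by have := tE; rewrite {1}hd; lra.
pose v := Num.sqrt y / s; pose b := a / s.
(* t^2 = s^2 / (1 - d), and (1 + d)^2 (1 - d) >= 1 as long as d <= 1 / 2. *)
have ts : t <= (1 + d) * s.
  rewrite -(ler_pXn2r (n:=2))// ?nnegrE; [|exact: ltW|by rewrite mulr_ge0 ?ltW; lra].
  rewrite exprMn sE mulrCA ler_peMr ?(ltW t2)//.
  have : 0 <= d * (1 - d - d * d) by rewrite mulr_ge0; nra.
  by rewrite sqrrD; lra.
have st : s <= t.
  by rewrite -(ler_pXn2r (n:=2))// ?nnegrE ?ltW// tE; lra.
have uvE : v = u * (t / s) by rewrite /v /u mulrA divfK ?gt_eqF.
have ts1 : 1 <= t / s by rewrite ler_pdivlMr// mul1r.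
have ts2 : t / s <= 1 + d by rewrite ler_pdivrMr.
have uv : u <= v by rewrite uvE ler_peMr.
have vu : v - u <= u * d.
  rewrite uvE (_ : u * (t / s) - u = u * (t / s - 1)); last by ring.
  by rewrite ler_wpM2l//; lra.
have b2 : b ^+ 2 <= 2 * d.
  rewrite /b exprMn exprVn ler_pdivrMr// (le_trans ah)// hd sE.
  rewrite (_ : 2 * d * (t ^+ 2 * (1 - d)) = d * t ^+ 2 * (2 * (1 - d))); last by ring.
  have dt0 : 0 <= d * t ^+ 2 by rewrite -hd ltW.
  have d12 : 1 <= 2 * (1 - d) by lra.
  by rewrite ler_peMr.
have b1 : `|b| <= 1.
  by rewrite -(ler_pXn2r (n:=2))// ?nnegrE// expr1n sqr_normr; lra.
have v0 : 0 <= v by exact: le_trans uv.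
have [A1 A2] := outer_shift b1 v0.
have [B1 B2] := outer_scale u0 uv.
have e20 : 1 <= expR 20 :> R by rewrite -expR0 ler_expR.
have E0 := expR_ge0 (- u ^+ 2 / 4).
have euv : expR (- v ^+ 2 / 4) <= expR (- u ^+ 2 / 4).
  rewrite ler_expR; have : u ^+ 2 <= v ^+ 2 by rewrite ler_pXn2r ?nnegrE.
  by lra.
have X1 : 4 * expR 20 * b ^+ 2 * expR (- v ^+ 2 / 4) <= 8 * expR 20 * (d * expR (- u ^+ 2 / 4)).
  apply: (@le_trans _ _ (4 * expR 20 * (2 * d) * expR (- u ^+ 2 / 4))); last first.
    by rewrite le_eqVlt; apply/orP; left; apply/eqP; ring.
  have f0 : 0 <= 4 * expR 20 :> R by rewrite mulr_ge0// expR_ge0.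
  have fb := mulr_ge0 f0 (sqr_ge0 b).
  by apply: ler_pM => //; exact: ler_wpM2l.
have ue : u * expR (- u ^+ 2 / 4) <= 1.
  rewrite -[leRHS](expRxMexpNx_1 (u ^+ 2 / 4)) [- u ^+ 2 / 4]mulNr ler_wpM2r ?expR_ge0//.
  have := expR_ge1Dx (u ^+ 2 / 4); have := sqr_ge0 (u / 2 - 1); rewrite sqrrB exprMn exprVn; lra.
have X2 : 2 * (v - u) * expR (- u ^+ 2 / 2) <= 2 * expR 20 * (d * expR (- u ^+ 2 / 4)).
  apply: (@le_trans _ _ (2 * (d * expR (- u ^+ 2 / 4)))).
    have -> : expR (- u ^+ 2 / 2) = expR (- u ^+ 2 / 4) * expR (- u ^+ 2 / 4) by rewrite -expRD; congr expR; field.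
    rewrite -mulrA ler_pM2l// mulrA ler_wpM2r//.
    apply: (@le_trans _ _ (u * d * expR (- u ^+ 2 / 4))); first by rewrite ler_wpM2r.
    by rewrite mulrAC ler_piMl// ltW.
  have dE0 : 0 <= d * expR (- u ^+ 2 / 4) by rewrite mulr_ge0// ltW.
  by rewrite -[leRHS]mulrA ler_pM2l// ler_peMl.
have XX : ((4 * expR 20 * b ^+ 2 * expR (- v ^+ 2 / 4))%:E + (2 * (v - u) * expR (- u ^+ 2 / 2))%:E <= X)%E.
  by rewrite -EFinD lee_fin /C2; move: X1 X2; set q := d * _; lra.
have XX0 : ((4 * expR 20 * b ^+ 2 * expR (- v ^+ 2 / 4))%:E <= X)%E.
  apply: le_trans XX; rewrite leeDl// lee_fin mulr_ge0 ?expR_ge0// mulr_ge0// subr_ge0//.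
rewrite (law1_tailE a s0 y0) (law1_tail0 t0 y0) -/u -/v -/b; split.
  by apply: (le_trans A1); apply: leeD.
apply: (le_trans B2); apply: (le_trans (leeD A2 (lexx _))).
by rewrite -addeA leeD2l.
Qed.

Lemma law1_step (s a h t y : R) : 0 <= s -> 0 < t -> 0 < h -> a ^+ 2 <= h -> t ^+ 2 = s ^+ 2 + h ->
  let X := ((C2 * C1)%:E * law1 ((2 * t)%R, 0%R) `[y, (y + h)%R]%classic)%E in
  (law1 (s, a) `]y, +oo[%classic <= law1 (t, 0%R) `]y, +oo[%classic + X)%E /\
  (law1 (t, 0%R) `]y, +oo[%classic <= law1 (s, a) `]y, +oo[%classic + X)%E.
Proof.
move=> s0 t0 h0 ah tE X.
have X0 : (0 <= X)%E by rewrite mule_ge0// lee_fin ltW// mulr_gt0 ?C1_gt0 ?C2_gt0.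
have [y0|y0] := ltP y 0; first by rewrite !law1_tail_neg// leeDl.
have t2 : 0 < t ^+ 2 by rewrite exprn_gt0.
have ht : h <= t ^+ 2 by rewrite tE lerDr sqr_ge0.
have YX : ((C2 * (h / t ^+ 2 * expR (- (Num.sqrt y / t) ^+ 2 / 4)))%:E <= X)%E.
  rewrite /X [(C2 * _)%:E]EFinM [(C2 * C1)%:E]EFinM -muleA.
  by apply: lee_wpmul2l; [rewrite lee_fin (ltW C2_gt0)|exact: law1_itv_ge].
have [d2|d2] := leP (h / t ^+ 2) (1 / 2).
  have s1 : 0 < s.
    rewrite lt_neqAle s0 andbT; apply/negP => /eqP se; move: d2.
    have -> : h = t ^+ 2 by rewrite tE -se expr0n add0r.
    by rewrite divff ?gt_eqF//; lra.
  have [A1 A2] := law1_tail_smooth s1 t0 h0 y0 ah tE d2.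
  by split; [apply: (le_trans A1)|apply: (le_trans A2)]; rewrite leeD2l.
(* Here h / t^2 > 1 / 2: each of the two tails is below [X] by itself, without any cancellation. The
   tail of (t, 0) is the Chernoff bound with increment 0. *)
have big (e : R) : ((2 * expR 20 * expR (- (Num.sqrt y / t) ^+ 2 / 4))%:E <= X)%E.
  apply: le_trans YX; rewrite lee_fin /C2.
  rewrite [leRHS]mulrA ler_wpM2r ?expR_ge0//.
  by have := expR_ge0 (20 : R); nra.
have c00 : (0 : R) ^+ 2 <= h by rewrite expr0n ltW.
split.
  by apply: (le_trans (law1_tail_chernoff t0 y0 ah tE)); apply: (le_trans (big 0)); rewrite leeDr.
have tE' : t ^+ 2 = t ^+ 2 + 0 by rewrite addr0.
have z0 : (0 : R) ^+ 2 <= 0 by rewrite expr0n.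
by apply: (le_trans (law1_tail_chernoff t0 y0 z0 tE')); apply: (le_trans (big 0)); rewrite leeDr.
Qed.

End OneStepLaw.

(** * Changing all coordinates *)

Section Chain.
Context {R : realType}.
Notation TR := (measurableTypeR R).
Notation C0 := (@C2 R * @C1 R).

Lemma law_perm (l1 l2 : seq (R * R)) (A : set TR) : perm_eq l1 l2 -> measurable A ->
  law l1 A = law l2 A.
Proof.
move=> pl mA; rewrite !prob_indic//; apply: ge0_integral_law_perm => //.
exact: measurable_EFin_indic.
Qed.

Lemma integral_indic_shift_ray (mu : probability TR R) (x w : R) :
  (\int[mu]_z (\1_(`]x, +oo[%classic) (w + z)%R)%:E = mu `](x - w)%R, +oo[%classic)%E.
Proof.
have mI : measurable (`](x - w)%R, +oo[%classic : set TR) by exact: measurable_itv.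
rewrite (prob_indic _ mI); apply: eq_integral => z _; rewrite !indicE.
congr (_%:R%:E); congr nat_of_bool.
by apply/idP/idP => /set_mem h; apply/mem_set; move: h; rewrite /= !in_itv/= !andbT; lra.
Qed.

(** The one-coordinate inequality at level x - w is integrated over the value w of the other
    coordinates. The error integrates to the probability of an interval under a full sum, which is
    the form that concentration bounds accept. *)
Lemma law_swap (s a h t x : R) (l : seq (R * R)) :
  0 <= s -> 0 < t -> 0 < h -> a ^+ 2 <= h -> t ^+ 2 = s ^+ 2 + h ->
  let X := (C0%:E * law (((2 * t)%R, 0%R) :: l) `[x, (x + h)%R]%classic)%E in
  (law ((s, a) :: l) `]x, +oo[%classic <= law ((t, 0%R) :: l) `]x, +oo[%classic + X)%E /\
  (law ((t, 0%R) :: l) `]x, +oo[%classic <= law ((s, a) :: l) `]x, +oo[%classic + X)%E.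
Proof.
move=> s0 t0 h0 ah tE X.
have C00 : 0 <= C0 by rewrite ltW// mulr_gt0 ?C1_gt0 ?C2_gt0.
have mI : measurable (`]x, +oo[%classic : set TR) by exact: measurable_itv.
have mJ : measurable (`[x, (x + h)%R]%classic : set TR) by exact: measurable_itv.
pose T p (w : TR) := law1 p `](x - w)%R, +oo[%classic.
pose B (w : TR) := (C0%:E * law1 ((2 * t)%R, 0%R) `[(x - w)%R, (x - w + h)%R]%classic)%E.
have lawT p : law (p :: l) `]x, +oo[%classic = (\int[law l]_w T p w)%E.
  etransitivity; first exact: (convEC (law1 p) (law l) mI).
  by apply: eq_integral => w _; exact: integral_indic_shift_ray.
have mT p : measurable_fun setT (T p).
  have := @measurable_int_indic R (law1 p) _ mI.
  by apply: eq_measurable_fun => w _; rewrite integral_indic_shift_ray.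
have T0 p w : (0 <= T p w)%E by exact: measure_ge0.
have BE w : B w = (C0%:E * \int[law1 ((2 * t)%R, 0%R)]_z (\1_(`[x, (x + h)%R]%classic) (w + z)%R)%:E)%E.
  by rewrite integral_indic_shift /B (_ : x - w + h = x + h - w)//; ring.
have mK := @measurable_int_indic R (law1 ((2 * t)%R, 0%R)) _ mJ.
have mB : measurable_fun setT B.
  apply: (eq_measurable_fun (fun w : TR => (C0%:E * \int[law1 ((2 * t)%R, 0%R)]_z (\1_(`[x, (x + h)%R]%classic) (w + z)%R)%:E)%E)).
    by move=> w _; rewrite BE.
  by apply: emeasurable_funM => //; exact: measurable_cst.
have B0 w : (0 <= B w)%E by rewrite mule_ge0// measure_ge0.
have XB : X = (\int[law l]_w B w)%E.
  rewrite /X [law _ _](convEC (law1 ((2 * t)%R, 0%R)) (law l) mJ).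
  apply: esym; etransitivity; first by apply: eq_integral => w _; exact: BE.
  apply: ge0_integralZl; [exact: measurableT|exact: mK| |by rewrite lee_fin].
  by move=> w _; apply: integral_ge0 => z _; exact: indic_ge0.
have step p q : (forall w, T p w <= T q w + B w)%E ->
    (law (p :: l) `]x, +oo[%classic <= law (q :: l) `]x, +oo[%classic + X)%E.
  move=> pq; rewrite !lawT XB.
  have <- : (\int[law l]_w (T q w + B w) = \int[law l]_w T q w + \int[law l]_w B w)%E.
    by apply: ge0_integralD => //; exact: measurableT.
  apply: ge0_le_integral => //; exact: emeasurable_funD.
by split; apply: step => w; have [] := law1_step (x - w) s0 t0 h0 ah tE.
Qed.

(** [D] collects the coordinates already replaced. At each step the mixed sum, with scale 2 t at the
    current coordinate, still dominates [lam], so the same [M] bounds its concentration and the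
    errors are summed. *)
Lemma law_chain (lam h t : nat -> R) (p : nat -> R * R) (M x : R) (s : seq nat) (D : seq (R * R)) :
  0 <= M -> uniq s -> dominates lam p s ->
  (forall r, dominates lam r s -> conc (law (D ++ map r s)) M) ->
  (forall i, i \in s -> [/\ 0 <= t i, (p i).2 ^+ 2 <= h i & t i ^+ 2 = (p i).1 ^+ 2 + h i]) ->
  let q := fun i => (t i, 0) in
  let E := (C0 * M * \sum_(i <- s) h i)%:E in
  (law (D ++ map p s) `]x, +oo[%classic <= law (D ++ map q s) `]x, +oo[%classic + E)%E /\
  (law (D ++ map q s) `]x, +oo[%classic <= law (D ++ map p s) `]x, +oo[%classic + E)%E.
Proof.
move=> M0; elim: s D => [|i s IH] D /=.
  by move=> _ _ _ _; rewrite big_nil mulr0 adde0.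
move=> /andP[nis us] dom cM hyp.
have C00 : 0 <= C0 by rewrite ltW// mulr_gt0 ?C1_gt0 ?C2_gt0.
have mI : measurable (`]x, +oo[%classic : set TR) by exact: measurable_itv.
have [t0 ah tE] := hyp i (mem_head _ _).
have [s0 ls] := dom i (mem_head _ _).
have h0 : 0 <= h i by apply: le_trans ah; exact: sqr_ge0.
have doms r : dominates lam r s -> forall z, 0 <= z.1 -> lam i <= z.1 ^+ 2 ->
    dominates lam (fun j => if j == i then z else r j) (i :: s).
  move=> dr z z0 lz j; rewrite inE; case: eqP => [-> //|_ /= js]; exact: dr.
have mapE r (z : R * R) : map (fun j => if j == i then z else r j) (i :: s) = z :: map r s.
  rewrite /= eqxx; congr (_ :: _); apply/eq_in_map => j js.
  by case: eqP => // ji; rewrite -ji js in nis.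
have dps : dominates lam p s by move=> j js; apply: dom; rewrite inE js orbT.
have lt : lam i <= t i ^+ 2 by rewrite tE; lra.
pose z := (t i, 0 : R).
have cM' r : dominates lam r s -> conc (law (rcons D z ++ map r s)) M.
  by move=> dr; rewrite cat_rcons -mapE; apply: cM; exact: doms.
have hyp' j : j \in s -> [/\ 0 <= t j, (p j).2 ^+ 2 <= h j & t j ^+ 2 = (p j).1 ^+ 2 + h j].
  by move=> js; apply: hyp; rewrite inE js orbT.
have [A1 A2] := IH (rcons D z) us dps cM' hyp'.
rewrite !cat_rcons in A1 A2.
have B : (law (D ++ p i :: map p s) `]x, +oo[%classic
      <= law (D ++ z :: map p s) `]x, +oo[%classic + (C0 * M * h i)%:E)%E /\
   (law (D ++ z :: map p s) `]x, +oo[%classic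
      <= law (D ++ p i :: map p s) `]x, +oo[%classic + (C0 * M * h i)%:E)%E.
  (* [law_swap] works with h > 0; when h = 0 the coordinate is already the target one. *)
  move: h0; rewrite le_eqVlt => /orP[/eqP h0|h0].
    have -> : p i = z.
      have : (p i).2 ^+ 2 == 0 by rewrite eq_le sqr_ge0 andbT h0.
      rewrite sqrf_eq0 => /eqP a0; move: tE; rewrite -h0 addr0 => tE.
      have ts : t i = (p i).1.
        by apply/eqP; rewrite -(eqrXn2 (n:=2))// tE.
      by rewrite /z ts -a0; case: (p i).
    by rewrite -h0 mulr0 adde0.
  have ti0 : 0 < t i.
    rewrite lt_neqAle t0 andbT; apply/negP => /eqP t00.
    by move: tE; rewrite -t00 expr0n/=; have := sqr_ge0 (p i).1; lra.
  have pe w : perm_eq (D ++ w :: map p s) (w :: D ++ map p s).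
    by rewrite -cat1s -[w :: D ++ _]cat1s perm_catCA.
  rewrite !(law_perm (pe _) mI).
  have [B1 B2] := law_swap x (D ++ map p s) s0 ti0 h0 ah tE.
  have c : (C0%:E * law (((2 * t i)%R, 0%R) :: D ++ map p s) `[x, (x + h i)%R]%classic <= (C0 * M * h i)%:E)%E.
    rewrite -[C0 * M * h i]mulrA [(C0 * (M * h i))%:E]EFinM; apply: lee_wpmul2l => //.
    have mJ : measurable (`[x, (x + h i)%R]%classic : set TR) by exact: measurable_itv.
    rewrite -(law_perm (pe _) mJ) -mapE; apply: cM => //.
    apply: doms => //=; first by rewrite mulr_ge0.
    by apply: (le_trans lt); rewrite ler_pXn2r ?nnegrE ?mulr_ge0//; lra.
  rewrite (surjective_pairing (p i)); split.
    by apply: (le_trans B1); exact: leeD2l.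
  by apply: (le_trans B2); exact: leeD2l.
have [B1 B2] := B.
rewrite big_cons mulrDr; split.
  apply: (le_trans B1); apply: (le_trans (leeD A1 (lexx _))).
  by rewrite -addeA; apply: leeD2l; rewrite -EFinD lee_fin addrC.
apply: (le_trans A2); apply: (le_trans (leeD B2 (lexx _))).
by rewrite -addeA; apply: leeD2l; rewrite -EFinD.
Qed.

(** The leading coordinates (0, sqrt c) and (0, 0) are degenerate and add the constants c and 0.
    Both are replaced by a centered coordinate of variance c, at a cost proportional to c as for any
    other increment. *)
Lemma compare_tails (lam mu a : nat -> R) (c M1 M2 x : R) (n : nat) :
  (forall j, 0 <= lam j) -> (forall j, 0 <= mu j) -> 0 <= c -> 0 <= M1 -> 0 <= M2 ->
  (forall q r, dominates lam r (iota 0 n) -> conc (law (q ++ map r (iota 0 n))) M1) ->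
  (forall q r, dominates mu r (iota 0 n) -> conc (law (q ++ map r (iota 0 n))) M2) ->
  let X := (0, Num.sqrt c) :: map (fun j => (Num.sqrt (lam j), a j)) (iota 0 n) in
  let Y := (0, 0) :: map (fun j => (Num.sqrt (mu j), 0)) (iota 0 n) in
  let E := (C0 * (M1 + M2) * (c + \sum_(j <- iota 0 n) (`|lam j - mu j| + a j ^+ 2)))%:E in
  (law X `]x, +oo[%classic <= law Y `]x, +oo[%classic + E)%E /\
  (law Y `]x, +oo[%classic <= law X `]x, +oo[%classic + E)%E.
Proof.
move=> l0 m0 c0 M10 M20 cM1 cM2 X Y E.
have C00 : 0 <= C0 by rewrite ltW// mulr_gt0 ?C1_gt0 ?C2_gt0.
pose nu j := Num.max (lam j) (mu j) + a j ^+ 2.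
pose t j := Num.sqrt (nu j).
have nul j : lam j + a j ^+ 2 <= nu j by rewrite lerD2r le_max lexx.
have num j : mu j + a j ^+ 2 <= nu j by rewrite lerD2r le_max lexx orbT.
have a0 j : 0 <= a j ^+ 2 by exact: sqr_ge0.
have nu0 j : 0 <= nu j by have := nul j; have := l0 j; have := a0 j; lra.
pose S := \sum_(j <- iota 0 n) (`|lam j - mu j| + a j ^+ 2).
have S0 : 0 <= S by apply: sumr_ge0 => j _; rewrite addr_ge0.
pose N := (Num.sqrt c, 0) :: map (fun j => (t j, 0 : R)) (iota 0 n).
have key (lm : nat -> R) (b : nat -> R) (d M : R) : 0 <= M -> (forall j, 0 <= lm j) -> d ^+ 2 <= c ->
    (forall j, lm j + b j ^+ 2 <= nu j) -> (forall j, nu j - lm j <= `|lam j - mu j| + a j ^+ 2) ->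
    (forall q r, dominates lm r (iota 0 n) -> conc (law (q ++ map r (iota 0 n))) M) ->
    let L := (0, d) :: map (fun j => (Num.sqrt (lm j), b j)) (iota 0 n) in
    let e := (C0 * M * (c + S))%:E in
    (law L `]x, +oo[%classic <= law N `]x, +oo[%classic + e)%E /\
    (law N `]x, +oo[%classic <= law L `]x, +oo[%classic + e)%E.
  move=> M0 lm0 dc lmb lmn cM L e.
  pose p j := (Num.sqrt (lm j), b j).
  have dom : dominates lm p (iota 0 n).
    by move=> i _ /=; rewrite sqrtr_ge0 sqr_sqrtr.
  have hyp i : i \in iota 0 n ->
      [/\ 0 <= t i, (p i).2 ^+ 2 <= nu i - lm i & t i ^+ 2 = (p i).1 ^+ 2 + (nu i - lm i)].
    move=> _; split; [exact: sqrtr_ge0|by have := lmb i => /=; lra|].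
    by rewrite /t /= !sqr_sqrtr//; ring.
  have [A1 A2] := law_chain x M0 (iota_uniq 0 n) dom (cM [:: (Num.sqrt c, 0)]) hyp.
  have [B1 B2] : (law L `]x, +oo[%classic <=
        law ((Num.sqrt c, 0%R) :: map p (iota 0 n)) `]x, +oo[%classic + (C0 * M * c)%:E)%E /\
     (law ((Num.sqrt c, 0%R) :: map p (iota 0 n)) `]x, +oo[%classic <=
        law L `]x, +oo[%classic + (C0 * M * c)%:E)%E.
    have := c0; rewrite le_eqVlt => /orP[/eqP c00|cpos].
      have d0 : d = 0.
        by apply/eqP; rewrite -sqrf_eq0 eq_le sqr_ge0 andbT c00.
      by rewrite /L -c00 d0 sqrtr0 mulr0 adde0.
    have sc : 0 < Num.sqrt c by rewrite sqrtr_gt0.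
    have tE : Num.sqrt c ^+ 2 = 0 ^+ 2 + c by rewrite sqr_sqrtr// expr0n add0r.
    have [B1 B2] := law_swap x (map p (iota 0 n)) (lexx 0) sc cpos dc tE.
    have cc : (C0%:E * law (((2 * Num.sqrt c)%R, 0%R) :: map p (iota 0 n)) `[x, (x + c)%R]%classic <= (C0 * M * c)%:E)%E.
      rewrite -[C0 * M * c]mulrA [(C0 * (M * c))%:E]EFinM; apply: lee_wpmul2l => //.
      by apply: (cM [:: ((2 * Num.sqrt c)%R, 0%R)]).
    by split; [apply: (le_trans B1)|apply: (le_trans B2)]; exact: leeD2l.
  have le : C0 * M * (\sum_(i <- iota 0 n) (nu i - lm i)) + C0 * M * c <= C0 * M * (c + S).
    rewrite -mulrDr; apply: ler_wpM2l; first exact: mulr_ge0.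
    by rewrite addrC; apply: lerD => //; apply: ler_sum => j _; exact: lmn.
  split.
    apply: (le_trans B1); apply: (le_trans (leeD A1 (lexx _))).
    by rewrite -addeA; apply: leeD2l; rewrite -EFinD lee_fin.
  apply: (le_trans A2); apply: (le_trans (leeD B2 (lexx _))).
  by rewrite -addeA; apply: leeD2l; rewrite -EFinD lee_fin addrC.
have lmn j : nu j - lam j <= `|lam j - mu j| + a j ^+ 2.
  rewrite /nu; have [|] := leP (lam j) (mu j); last by have := normr_ge0 (lam j - mu j); lra.
  by have := ler_norm (mu j - lam j); rewrite distrC; lra.
have mmn j : nu j - mu j <= `|lam j - mu j| + a j ^+ 2.
  rewrite /nu; have [|] := leP (lam j) (mu j); first by have := normr_ge0 (lam j - mu j); lra.
  by have := ler_norm (lam j - mu j); lra.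
have sc : Num.sqrt c ^+ 2 <= c by rewrite sqr_sqrtr.
have zc : (0 : R) ^+ 2 <= c by rewrite expr0n.
have num' j : mu j + (0 : R) ^+ 2 <= nu j by rewrite expr0n addr0; have := num j; have := a0 j; lra.
have [A1 A2] := key lam a (Num.sqrt c) M1 M10 l0 sc nul lmn cM1.
have [B1 B2] := key mu (fun=> 0) 0 M2 M20 m0 zc num' mmn cM2.
have EE : ((C0 * M1 * (c + S))%:E + (C0 * M2 * (c + S))%:E = E)%E.
  by rewrite -EFinD; congr EFin; rewrite /S; ring.
split.
  by apply: (le_trans A1); apply: (le_trans (leeD B2 (lexx _))); rewrite -addeA -EE [X in (_ <= _ + X)%E]addeC.
by apply: (le_trans B1); apply: (le_trans (leeD A2 (lexx _))); rewrite -addeA -EE.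
Qed.

End Chain.

(** * From [varkappa] to a concentration bound *)

Section KappaConc.
Context {R : realType}.
Variable lam : nat -> R.
Hypothesis lam0 : forall j, 0 <= lam j.
Hypothesis lamN : forall i j, (i <= j)%N -> lam j <= lam i.

(** Because of the index shift, [Lambda_sq lam k.+1] sums from index [k]. *)
Lemma Lambda_sq_partial (k : nat) (V c : R) : Lambda_sq lam k.+1 = V%:E -> c < V ->
  exists n0, forall n, (n0 <= n)%N -> c <= \sum_(k <= j < n) lam j ^+ 2.
Proof.
move=> LV cV.
have [[n0 h0]|nh] := pselect (exists n0, c <= \sum_(k <= j < n0) lam j ^+ 2).
  exists n0 => n n0n; apply: (le_trans h0).
  have [kn|nk] := leqP k n0; last first.
    by rewrite (big_geq (ltnW nk)); apply: sumr_ge0 => i _; exact: sqr_ge0.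
  rewrite (big_cat_nat kn n0n)/= lerDl.
  by apply: sumr_ge0 => i _; exact: sqr_ge0.
exfalso; have : (Lambda_sq lam k.+1 <= c%:E)%E.
  rewrite /Lambda_sq; apply: lime_le.
    by apply: is_cvg_nneseries => n _ _; rewrite lee_fin sqr_ge0.
  apply: nearW => n; rewrite sumEFin lee_fin leNgt; apply/negP => /ltW h.
  by apply: nh; exists n.
by rewrite LV lee_fin leNgt cV.
Qed.

Lemma conc_tail_spread (k : nat) (V : R) : Lambda_sq lam k.+1 = V%:E -> 0 < V ->
  3 * lam k ^+ 2 <= V ->
  exists n0, forall n r, (n0 <= n)%N -> dominates lam r (iota k (n - k)) ->
    conc (law (map r (iota k (n - k)))) (88 / Num.sqrt V).
Proof.
move=> LV V0 kV.
(* Once the partial sum reaches 5/6 of V, lam k^2 <= V / 3 becomes at most 2/5 of the partial sum,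
   the hypothesis of [conc_spread], and 80 / sqrt (5/6) is below 88. *)
have cV : 5 / 6 * V < V by lra.
have [n0 h] := Lambda_sq_partial LV cV.
exists n0 => n r /h; rewrite /index_iota => hn dom.
have W0 : 0 < \sum_(j <- iota k (n - k)) lam j ^+ 2 by lra.
have kW : lam k ^+ 2 <= 2 / 5 * \sum_(j <- iota k (n - k)) lam j ^+ 2 by lra.
have := conc_spread lam0 lamN dom W0 erefl kW.
apply: conc_le.
move: hn W0 => {kW}; set W := \sum_(j <- _) _ => hn W0.
have sV : 0 < Num.sqrt V by rewrite sqrtr_gt0.
have sW : 0 < Num.sqrt W by rewrite sqrtr_gt0.
rewrite ler_pdivrMr// mulrAC ler_pdivlMr//.
rewrite -(ler_pXn2r (n:=2))// ?nnegrE; [|by rewrite mulr_ge0 ?sqrtr_ge0..].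
by rewrite !exprMn !sqr_sqrtr ?ltW//; lra.
Qed.

Lemma inv_or_ooP (x K : R) : inv_or_oo x = K%:E -> x != 0 /\ K = x^-1.
Proof. by rewrite /inv_or_oo; case: eqP => // _ [->]. Qed.

(** [fine] sends an infinite sum to 0, where [inv_or_oo] returns +oo. In the cases of [varkappa]
    that involve the sum, a finite value therefore makes the sum finite and positive. *)
Lemma fine_Lambda (k : nat) : Num.sqrt (fine (Lambda_sq lam k)) != 0 ->
  exists2 V, 0 < V & Lambda_sq lam k = V%:E.
Proof.
move=> s0; have : 0 < Num.sqrt (fine (Lambda_sq lam k)) by rewrite lt_neqAle eq_sym s0 sqrtr_ge0.
rewrite sqrtr_gt0; case: (Lambda_sq lam k) => [V| |] /=; rewrite ?ltxx// => V0.
by exists V.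
Qed.

Lemma sqrt_dom (s l : R) : 0 <= s -> l <= s ^+ 2 -> Num.sqrt l <= s.
Proof. by move=> s0 ls; rewrite -(ger0_norm s0) -sqrtr_sqr ler_wsqrtr. Qed.

(** The three cases of [varkappa] are a spread sequence, one large coordinate followed by a spread
    tail ([conc_sqrt]), and two large coordinates ([conc_law2]). Their constants 88, 3 sqrt 88 and 8
    are below 100. The index n must be large because the spread shows only in a long enough partial
    sum. *)
Lemma varkappa_conc (K : R) : varkappa lam = K%:E ->
  0 < K /\ exists n0, forall n, (n0 <= n)%N -> forall q r, dominates lam r (iota 0 n) ->
    conc (law (q ++ map r (iota 0 n))) (100 * K).
Proof.
rewrite /varkappa; case: ifPn => [le1|_].
  move/inv_or_ooP => [L0 KE].
  have [V V0 LV] := fine_Lambda L0.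
  rewrite LV lee_fin in le1.
  move: KE; rewrite LV /= => ->.
  have sV : 0 < Num.sqrt V by rewrite sqrtr_gt0.
  split; first by rewrite invr_gt0.
  have [n0 h] := conc_tail_spread LV V0 le1.
  exists n0 => n nn q r dom; apply: conc_catr.
  have := h n r nn; rewrite subn0 => /(_ dom); apply: conc_le.
  by rewrite ler_wpM2r ?invr_ge0 ?sqrtr_ge0//; lra.
have l00 := lam0 0; have l10 := lam0 1.
case: ifPn => [le2|_].
  move/inv_or_ooP; set L2 := Num.sqrt (fine _) => -[L0 ->].
  have LL : 0 < lam 0%N * L2.
    by rewrite -sqrtr_gt0 lt_neqAle eq_sym L0 sqrtr_ge0.
  have L20 : 0 <= L2 by exact: sqrtr_ge0.
  have L2N : L2 != 0 by apply/eqP => e; rewrite e mulr0 ltxx in LL.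
  have L2P : 0 < L2 by rewrite lt_neqAle eq_sym L2N.
  have l0P : 0 < lam 0%N by rewrite -(pmulr_lgt0 _ L2P).
  have [V V0 LV] := fine_Lambda L2N.
  have L2E : L2 = Num.sqrt V by rewrite /L2 LV.
  rewrite LV lee_fin in le2.
  split; first by rewrite invr_gt0 sqrtr_gt0.
  have [n0 h] := conc_tail_spread LV V0 le2.
  exists n0.+1 => -[//|n] nn q r dom; apply: conc_catr.
  have := h n.+1 r (ltnW nn); rewrite subSS subn0.
  have dom1 : dominates lam r (iota 1 n).
    by move=> i ii; apply: dom; rewrite /= inE ii orbT.
  move=> /(_ dom1) c1.
  have [s0 ls] := dom 0%N (mem_head _ _).
  have sP : 0 < (r 0%N).1.
    by apply: lt_le_trans (sqrt_dom s0 ls); rewrite sqrtr_gt0.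
  have M0 : 0 < 88 / Num.sqrt V by rewrite -L2E divr_gt0.
  have c2 : conc (law (map r (iota 0 n.+1))) (3 * Num.sqrt (88 / Num.sqrt V) / (r 0%N).1).
    have := conc_sqrt (r 0%N).2 sP M0 c1.
    by rewrite -surjective_pairing.
  apply: conc_le c2.
  rewrite -L2E sqrtrM// sqrtrM// invfM sqrtrV//.
  have sl : 0 < Num.sqrt (lam 0%N) by rewrite sqrtr_gt0.
  have sL : 0 < Num.sqrt L2 by rewrite sqrtr_gt0.
  have i1 : (r 0%N).1^-1 <= (Num.sqrt (lam 0%N))^-1.
    by rewrite lef_pV2 ?posrE//; exact: sqrt_dom.
  have s88 : Num.sqrt 88 <= 10 :> R.
    by apply: sqrt_dom => //; rewrite expr2; lra.
  have -> : 3 * (Num.sqrt 88 * (Num.sqrt L2)^-1) / (r 0%N).1 =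
     (3 * Num.sqrt 88) * ((r 0%N).1^-1 * (Num.sqrt L2)^-1) by ring.
  apply: ler_pM; rewrite ?mulr_ge0 ?invr_ge0 ?sqrtr_ge0//; first by lra.
  by rewrite ler_wpM2r// invr_ge0 sqrtr_ge0.
move/inv_or_ooP => [L0 ->].
have LL : 0 < lam 0%N * lam 1%N.
  by rewrite -sqrtr_gt0 lt_neqAle eq_sym L0 sqrtr_ge0.
have l1N : lam 1%N != 0 by apply/eqP => e; rewrite e mulr0 ltxx in LL.
have l1P : 0 < lam 1%N by rewrite lt_neqAle eq_sym l1N.
have l0P : 0 < lam 0%N by rewrite -(pmulr_lgt0 _ l1P).
split; first by rewrite invr_gt0 sqrtr_gt0.
exists 2%N => -[//|[//|n]] _ q r dom; apply: conc_catr.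
have [s0 ls0] := dom 0%N (mem_head _ _).
have [s1 ls1] : 0 <= (r 1%N).1 /\ lam 1%N <= (r 1%N).1 ^+ 2 by apply: dom; rewrite /= !inE eqxx orbT.
have q0 := sqrt_dom s0 ls0; have q1 := sqrt_dom s1 ls1.
have sl0 : 0 < Num.sqrt (lam 0%N) by rewrite sqrtr_gt0.
have sl1 : 0 < Num.sqrt (lam 1%N) by rewrite sqrtr_gt0.
have sP0 : 0 < (r 0%N).1 by exact: lt_le_trans q0.
have sP1 : 0 < (r 1%N).1 by exact: lt_le_trans q1.
have -> : map r (iota 0 n.+2) = [:: r 0%N; r 1%N] ++ map r (iota 2 n) by [].
apply: conc_catl; apply: conc_le (conc_law2 sP0 sP1).
apply: ler_pM => //; rewrite ?invr_ge0 ?mulr_ge0//; first by lra.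
rewrite sqrtrM// lef_pV2 ?posrE ?mulr_gt0//.
by apply: ler_pM; rewrite ?sqrtr_ge0.
Qed.

End KappaConc.

(** * Hilbert space geometry *)

Section Hilbert.
Context {R : realType} {H : lmodType R} (ip : H -> H -> R).
Hypothesis Hip : is_separable_hilbert ip.
Notation hnorm := (hnorm ip).

Lemma ipC x y : ip x y = ip y x.
Proof. by case: Hip. Qed.

Lemma ipDZl c x y z : ip (c *: x + y) z = c * ip x z + ip y z.
Proof. by case: Hip. Qed.

Lemma ip0l z : ip 0 z = 0.
Proof. by have := ipDZl 1 0 0 z; rewrite scaler0 addr0 mul1r; lra. Qed.

Lemma ip0r z : ip z 0 = 0.
Proof. by rewrite ipC ip0l. Qed.

Lemma ipZl c x z : ip (c *: x) z = c * ip x z.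
Proof. by have := ipDZl c x 0 z; rewrite addr0 ip0l addr0. Qed.

Lemma ipDl x y z : ip (x + y) z = ip x z + ip y z.
Proof. by have := ipDZl 1 x y z; rewrite scale1r mul1r. Qed.

Lemma ipNl x z : ip (- x) z = - ip x z.
Proof. by rewrite -scaleN1r ipZl mulN1r. Qed.

Lemma ipBl x y z : ip (x - y) z = ip x z - ip y z.
Proof. by rewrite ipDl ipNl. Qed.

Lemma ipZr c x z : ip z (c *: x) = c * ip z x.
Proof. by rewrite ipC ipZl ipC. Qed.

Lemma ipDr x y z : ip z (x + y) = ip z x + ip z y.
Proof. by rewrite ipC ipDl ![ip z _]ipC. Qed.

Lemma ipBr x y z : ip z (x - y) = ip z x - ip z y.
Proof. by rewrite ipC ipBl ![ip z _]ipC. Qed.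

Lemma ip_suml (I : Type) (s : seq I) (f : I -> H) z :
  ip (\sum_(i <- s) f i) z = \sum_(i <- s) ip (f i) z.
Proof. by elim: s => [|i s IH]; rewrite ?big_nil ?ip0l// !big_cons ipDl IH. Qed.

Lemma ip_ge0 x : 0 <= ip x x.
Proof. by case: Hip => _ _ []. Qed.

Lemma ip_eq0 x : ip x x = 0 -> x = 0.
Proof. by case: Hip => _ _ [_ h] _ _; exact: h. Qed.

Lemma hnorm_ge0 x : 0 <= hnorm x.
Proof. exact: sqrtr_ge0. Qed.

Lemma hnorm2 x : hnorm x ^+ 2 = ip x x.
Proof. by rewrite sqr_sqrtr// ip_ge0. Qed.

Lemma hnorm_le x c : 0 <= c -> (hnorm x <= c) = (ip x x <= c ^+ 2).
Proof. by move=> c0; rewrite -hnorm2 ler_pXn2r ?nnegrE ?hnorm_ge0. Qed.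

Lemma hnorm_lt x c : 0 <= c -> (hnorm x < c) = (ip x x < c ^+ 2).
Proof. by move=> c0; rewrite -hnorm2 ltr_pXn2r ?nnegrE ?hnorm_ge0. Qed.

(** Semidefinite forms on a subset stable under combinations, so as to cover both [ip] and the
    covariance form on the residual vectors. *)
Lemma bilin_CS (B : H -> H -> R) (K : H -> Prop) :
  (forall x y, B x y = B y x) -> (forall c x y z, B (c *: x + y) z = c * B x z + B y z) ->
  (forall c x y, K x -> K y -> K (c *: x + y)) -> (forall x, K x -> 0 <= B x x) ->
  forall x y, K x -> K y -> B x y ^+ 2 <= B x x * B y y.
Proof.
move=> BC BL KL B0 x y Kx Ky.
have e (c : R) : B (c *: x + y) (c *: x + y) = c ^+ 2 * B x x + 2 * c * B x y + B y y.
  by rewrite BL BC BL [B y (_ + _)]BC BL [B y x]BC; ring.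
have h (c : R) : 0 <= c ^+ 2 * B x x + 2 * c * B x y + B y y by rewrite -e; apply: B0; exact: KL.
have xx0 := B0 _ Kx; have yy0 := B0 _ Ky.
have [x0|x0] := eqVneq (B x x) 0.
  have : B x y = 0.
    apply/eqP/negPn/negP => bxy.
    have := h (- (B y y + 1) / (2 * B x y)); rewrite x0 mulr0 add0r.
    rewrite (_ : 2 * _ * B x y = - (B y y + 1)); first lra.
    by field.
  by move=> ->; rewrite expr0n x0 mul0r.
have xp : 0 < B x x by rewrite lt_neqAle eq_sym x0.
have := h (- B x y / B x x).
have -> : (- B x y / B x x) ^+ 2 * B x x + 2 * (- B x y / B x x) * B x y + B y y =
   (B x x * B y y - B x y ^+ 2) / B x x by field.
by rewrite pmulr_lge0 ?invr_gt0// subr_ge0.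
Qed.

Lemma ip_CS x y : ip x y ^+ 2 <= ip x x * ip y y.
Proof.
apply: (@bilin_CS ip (fun _ => True)) => //; [exact: ipC|exact: ipDZl|].
by move=> z _; exact: ip_ge0.
Qed.

Lemma ip_le_hnorm x y : `|ip x y| <= hnorm x * hnorm y.
Proof.
rewrite -(ler_pXn2r (n:=2))// ?nnegrE ?mulr_ge0 ?hnorm_ge0//.
by rewrite sqr_normr exprMn !hnorm2 ip_CS.
Qed.

Lemma hnormD x y : hnorm (x + y) <= hnorm x + hnorm y.
Proof.
rewrite hnorm_le ?addr_ge0 ?hnorm_ge0// ipDl !ipDr [ip y x]ipC sqrrD !hnorm2.
by have := ler_norm (ip x y); have := ip_le_hnorm x y; lra.
Qed.

Lemma hnormZ c x : hnorm (c *: x) = `|c| * hnorm x.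
Proof. by rewrite /hnorm ipZl ipZr mulrA -expr2 sqrtrM ?sqr_ge0// sqrtr_sqr. Qed.

Lemma hnormN x : hnorm (- x) = hnorm x.
Proof. by rewrite -scaleN1r hnormZ normrN1 mul1r. Qed.

Lemma hnormB x y : hnorm (x - y) <= hnorm x + hnorm y.
Proof. by rewrite -[hnorm y]hnormN hnormD. Qed.

Definition hcvg (u : nat -> H) (l : H) :=
  forall e : R, 0 < e -> exists N, forall n, (N <= n)%N -> hnorm (u n - l) < e.

Lemma hcomplete (u : nat -> H) :
  (forall e : R, 0 < e -> exists N, forall m n, (N <= m)%N -> (N <= n)%N -> hnorm (u m - u n) < e) ->
  exists l, hcvg u l.
Proof. by case: Hip => _ _ _ + _; exact. Qed.

Lemma hdense : exists d : nat -> H, forall x (e : R), 0 < e -> exists n, hnorm (x - d n) < e.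
Proof. by case: Hip. Qed.

Lemma hcvg_ip u l z : hcvg u l -> (fun n => ip (u n) z) @ \oo --> ip l z.
Proof.
move=> ul; apply/cvgrPdist_lt => e e0.
have z0 : 0 < hnorm z + 1 by have := hnorm_ge0 z; lra.
have [N hN] := ul (e / (hnorm z + 1)) (divr_gt0 e0 z0).
exists N => // n /= /hN h; rewrite distrC -ipBl.
apply: (le_lt_trans (ip_le_hnorm _ _)).
apply: (@le_lt_trans _ _ (hnorm (u n - l) * (hnorm z + 1))).
  by apply: ler_wpM2l; [exact: hnorm_ge0|lra].
by rewrite -ltr_pdivlMr.
Qed.

(** The squared norm of x is the supremum over k of 2 <x, d k> - |d k|^2. Balls thus become
    countable intersections of half-spaces, and their measurability follows from that of the
    coordinates. *)
Lemma ip_dense_sup (d : nat -> H) : (forall x (e : R), 0 < e -> exists n, hnorm (x - d n) < e) ->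
  forall x (c : R), (ip x x <= c) <-> (forall k, 2 * ip x (d k) - ip (d k) (d k) <= c).
Proof.
move=> dd x c; have dE k : ip (x - d k) (x - d k) = ip x x - (2 * ip x (d k) - ip (d k) (d k)).
  by rewrite ipBl !ipBr [ip (d k) x]ipC; ring.
split=> [xc k|h]; first by have := ip_ge0 (x - d k); rewrite dE; lra.
rewrite leNgt; apply/negP => cx.
have e0 : 0 < Num.sqrt (ip x x - c) by rewrite sqrtr_gt0 subr_gt0.
have [k] := dd x _ e0.
rewrite hnorm_lt ?sqrtr_ge0// sqr_sqrtr ?subr_ge0 ?ltW// dE.
by have := h k; lra.
Qed.

(* An orthonormal family padded with zero vectors: [e1] says that each [e i] is zero or a
   unit vector. *)
Section Orthonormal.
Variable e : nat -> H.
Hypothesis eO : forall i j, i != j -> ip (e i) (e j) = 0.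
Hypothesis e1 : forall i x, ip (e i) (e i) * ip x (e i) = ip x (e i).

Definition hproj n x := \sum_(j <- iota 0 n) ip x (e j) *: e j.

Lemma ip_hproj n x y : ip (hproj n x) y = \sum_(j <- iota 0 n) ip x (e j) * ip y (e j).
Proof. by rewrite ip_suml; apply: eq_bigr => j _; rewrite ipZl [ip y _]ipC. Qed.

Lemma ip_hproj_e n x j : (j < n)%N -> ip (hproj n x) (e j) = ip x (e j).
Proof.
move=> jn; rewrite ip_hproj (bigD1_seq j) ?iota_uniq ?mem_iota//= big1 => [|i ij].
  by rewrite addr0 mulrC e1.
by rewrite eO ?mulr0// eq_sym.
Qed.

Lemma ip_hproj2 n x : ip (hproj n x) (hproj n x) = \sum_(j <- iota 0 n) ip x (e j) ^+ 2.
Proof.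
rewrite ip_hproj; apply: eq_big_seq => j; rewrite mem_iota /= => jn.
by rewrite ip_hproj_e// expr2.
Qed.

Lemma ip_hprojr n x y : ip x (hproj n y) = \sum_(j <- iota 0 n) ip x (e j) * ip y (e j).
Proof. by rewrite ipC ip_hproj; apply: eq_bigr => j _; rewrite mulrC. Qed.

Lemma ip_residual n x : ip (x - hproj n x) (x - hproj n x) =
  ip x x - \sum_(j <- iota 0 n) ip x (e j) ^+ 2.
Proof.
rewrite ipBl !ipBr ip_hproj2 ip_hproj ip_hprojr.
have -> : \sum_(j <- iota 0 n) ip x (e j) * ip x (e j) = \sum_(j <- iota 0 n) ip x (e j) ^+ 2.
  by apply: eq_bigr => j _; rewrite expr2.
ring.
Qed.

Lemma bessel n x : \sum_(j <- iota 0 n) ip x (e j) ^+ 2 <= ip x x.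
Proof. by have := ip_ge0 (x - hproj n x); rewrite ip_residual subr_ge0. Qed.

Lemma ip_residual_sym n x y : ip x (y - hproj n y) = ip (x - hproj n x) y.
Proof. by rewrite ipBr ipBl ip_hproj ip_hprojr. Qed.

Lemma cvg_bessel x : cvgn (fun n => \sum_(j <- iota 0 n) ip x (e j) ^+ 2).
Proof.
apply: nondecreasing_is_cvgn.
  move=> i j ij; rewrite -(subnKC ij) iotaD big_cat/= lerDl.
  by apply: sumr_ge0 => k _; exact: sqr_ge0.
by exists (ip x x) => _ [n _ <-]; exact: bessel.
Qed.

(** By Bessel's inequality the projections form a Cauchy sequence; completeness gives the limit,
    which is the component of x orthogonal to all the [e j]. *)
Lemma residual_cvg x : exists2 r, hcvg (fun n => x - hproj n x) r & forall j, ip r (e j) = 0.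
Proof.
have [r hr] : exists r, hcvg (fun n => x - hproj n x) r.
  apply: hcomplete => eps eps0.
  have e2 : 0 < eps ^+ 2 by rewrite exprn_gt0.
  have cb : cvgn (fun n => \sum_(j <- iota 0 n) ip x (e j) ^+ 2) by exact: cvg_bessel.
  move/cvgrPdist_lt : cb => /(_ (eps ^+ 2 / 2)).
  rewrite divr_gt0// => /(_ isT) [N _ hN].
  have wl m n : (N <= m)%N -> (m <= n)%N -> hnorm ((x - hproj m x) - (x - hproj n x)) < eps.
    move=> Nm mn; rewrite hnorm_lt ?ltW//.
    have -> : (x - hproj m x) - (x - hproj n x) = hproj n x - hproj m x.
      by rewrite opprB addrC addrA subrK.
    have -> : ip (hproj n x - hproj m x) (hproj n x - hproj m x) =
       \sum_(j <- iota 0 n) ip x (e j) ^+ 2 - \sum_(j <- iota 0 m) ip x (e j) ^+ 2.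
      rewrite ipBl !ipBr !ip_hproj2 [ip (hproj n x) _]ipC !ip_hproj.
      have -> : \sum_(j <- iota 0 m) ip x (e j) * ip (hproj n x) (e j) =
          \sum_(j <- iota 0 m) ip x (e j) ^+ 2.
        apply: eq_big_seq => j; rewrite mem_iota /= => jm.
        by rewrite ip_hproj_e ?expr2// (leq_trans jm).
      ring.
    have := hN _ Nm; have := hN _ (leq_trans Nm mn) => /=.
    by rewrite !ltr_norml => /andP[? ?] /andP[? ?]; lra.
  exists N => m n Nm Nn; have [mn|/ltnW nm] := leqP m n; first exact: wl.
  by rewrite -hnormN opprB; exact: wl.
exists r => // j.
have /cvg_unique : (fun n => ip (x - hproj n x) (e j)) @ \oo --> ip r (e j) by exact: hcvg_ip.
apply => //; apply: cvg_near_cst; exists j.+1 => // n /= jn.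
by rewrite ipBl ip_hproj_e ?subrr.
Qed.

End Orthonormal.

End Hilbert.

(** * Joint law of the coordinates *)

Section GaussianElement.
Context {R : realType} {H : lmodType R} (ip : H -> H -> R).
Hypothesis Hip : is_separable_hilbert ip.
Context {dd : measure_display} {Omega : measurableType dd} (P : probability Omega R).
Variables (xi : Omega -> H) (Sig : H -> H).
Hypothesis gxi : centered_gaussian_elt ip P xi.
Hypothesis cxi : covariance_operator ip P xi Sig.
Notation TR := (measurableTypeR R).
Notation gam := (@gam R).

Definition coord (h : H) : Omega -> TR := fun w => ip (xi w) h.
Definition cov (h g : H) : R := ip (Sig h) g.

Lemma measurable_coord h : measurable_fun setT (coord h).
Proof. by have [] := gxi h. Qed.

Lemma covC h g : cov h g = cov g h.
Proof.
apply: EFin_inj; rewrite /cov !cxi.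
by apply: eq_integral => w _; rewrite mulrC.
Qed.

Lemma covDZl c x y z : cov (c *: x + y) z = c * cov x z + cov y z.
Proof. by rewrite covC /cov (ipDr Hip) (ipZr Hip) -!/(cov _ _) [cov z x]covC [cov z y]covC. Qed.

Lemma cov_ge0 h : 0 <= cov h h.
Proof.
rewrite -lee_fin /cov cxi; apply: integral_ge0 => w _.
by rewrite lee_fin -expr2 sqr_ge0.
Qed.

(** The parameter [s] of the law is existential in the definition; the second moment identifies its
    square with the covariance. For s = 0 the law is a Dirac mass and the same formula holds. *)
Lemma gauss_coord h : exists s : R, [/\ 0 <= s, s ^+ 2 = cov h h &
  forall f : TR -> \bar R, measurable_fun setT f -> (forall x, 0 <= f x)%E ->
  (\int[P]_w f (coord h w) = \int[gam]_z f (s * z)%R)%E].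
Proof.
have [_ [s [s0 sP]]] := gxi h.
have key (f : TR -> \bar R) : measurable_fun setT f -> (forall x, 0 <= f x)%E ->
    (\int[P]_w f (coord h w) = \int[gam]_z f (s * z)%R)%E.
  move=> mf f0.
  pose X : {mfun Omega >-> TR} := mfun_Sub (mem_set (measurable_coord h) : (coord h : Omega -> TR) \in mfun).
  have -> : (\int[P]_w f (coord h w) = \int[distribution P X]_x f x)%E.
    by rewrite ge0_integral_distribution.
  have [s00|s00] := eqVneq s 0.
    rewrite (eq_measure_integral (\d_(0 : TR))).
      rewrite integral_dirac//= diracT mul1e.
      rewrite -[LHS](integral_prob_cst gam); apply: eq_integral => z _.
      by rewrite s00 mul0r.
    by move=> A mA _; have := sP A mA; rewrite s00 eqxx.
  have sp : 0 < s by rewrite lt_neqAle eq_sym s00.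
  rewrite -integral_normal_prob_scale//; apply: eq_measure_integral => A mA _.
  by have := sP A mA; rewrite (negbTE s00).
exists s; split => //.
apply: EFin_inj; rewrite /cov cxi.
have m2 : measurable_fun [set: TR] (fun x : TR => (x ^+ 2)%:E) by mfun.
have p2 (x : TR) : (0 <= (x ^+ 2)%:E)%E by rewrite lee_fin sqr_ge0.
transitivity (\int[P]_w ((coord h w) ^+ 2)%:E)%E; last first.
  by apply: eq_integral => w _; rewrite expr2.
rewrite (key _ m2 p2).
under eq_integral do rewrite exprMn EFinM.
rewrite (_ : (\int[gam]_x _)%E = ((s ^+ 2)%:E * \int[gam]_x (x ^+ 2)%:E)%E); last first.
  by apply: ge0_integralZl; [exact: measurableT|exact: m2|move=> x _; exact: p2|rewrite lee_fin sqr_ge0].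
rewrite (EFin_Rintegral (@gam_integrable_pow2 R)) gam_var.
by rewrite mule1.
Qed.

Lemma measurable_cos : measurable_fun [set: TR] (cos : TR -> TR).
Proof. exact: (continuous_measurable_fun (@continuous_cos R)). Qed.

Lemma integrable_le1 d (T : measurableType d) (Q : probability T R) (f : T -> TR) :
  measurable_fun setT f -> (forall w, `|f w : R| <= 1) -> Q.-integrable setT (fun w => (f w)%:E).
Proof. by move=> mf f1; exact: (@integrable_bounded _ _ _ _ f 1). Qed.

Lemma cos_le_norm1 (x : R) : `|cos x| <= 1.
Proof. by rewrite ler_norml cos_geN1 cos_le1. Qed.

Lemma integral_1Dcos d (T : measurableType d) (Q : probability T R) (f : T -> TR) :
  measurable_fun setT f ->
  (\int[Q]_w (cos (f w))%:E = \int[Q]_w (1 + cos (f w))%:E - 1)%E.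
Proof.
move=> mf.
have i1 : Q.-integrable setT (fun w => (cos (f w) : R)%:E).
  by apply: integrable_le1 => [|w]; [exact: (measurableT_comp measurable_cos mf)|exact: cos_le_norm1].
have i0 : Q.-integrable setT (fun w : T => (1 : R)%:E).
  by apply: integrable_le1 => [|w]; [exact: measurable_cst|rewrite normr1].
have -> : (\int[Q]_w (1 + cos (f w))%:E = \int[Q]_w 1%:E + \int[Q]_w (cos (f w))%:E)%E.
  by rewrite -integralD//; apply: eq_integral => w _; rewrite EFinD.
have -> : (\int[Q]_w 1%:E = 1 :> \bar R)%E by exact: integral_prob_cst.
by rewrite addeAC subee ?add0e.
Qed.

Lemma gauss_cos h c : (\int[P]_w (cos (coord h w + c))%:E = (cos c * expR (- cov h h / 2))%:E)%E.
Proof.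
have [s [s0 s2 key]] := gauss_coord h.
have ma : measurable_fun [set: TR] (fun x : TR => ((x : R) + c : TR)) by mfun.
rewrite (integral_1Dcos _ (f := fun w => coord h w + c : TR)); last first.
  exact: (measurableT_comp ma (measurable_coord h)).
rewrite (key (fun x : TR => (1 + cos ((x : R) + c))%:E)); last first.
- by move=> x; rewrite lee_fin; have := cos_geN1 ((x : R) + c); lra.
- apply/measurable_EFinP; apply: measurable_funD; first exact: measurable_cst.
  exact: (measurableT_comp measurable_cos ma).
rewrite -(@integral_1Dcos _ _ gam (fun z : TR => s * z + c : TR)); last by mfun.
under eq_integral do rewrite addrC.
by rewrite (EFin_Rintegral (gam_integrable_cos s c)) gam_cos s2 mulNr.
Qed.

End GaussianElement.

Section FubiniBounded.
Context {R : realType}.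
Notation TR := (measurableTypeR R).

Lemma fubini_le1 d1 d2 (T1 : measurableType d1) (T2 : measurableType d2)
  (P : probability T1 R) (Q : probability T2 R) (f : T1 * T2 -> TR) :
  measurable_fun setT f -> (forall p, `|f p : R| <= 1) ->
  (\int[P]_x \int[Q]_y (f (x, y))%:E = \int[Q]_y \int[P]_x (f (x, y))%:E)%E.
Proof.
move=> mf f1; apply: (Fubini (f := fun p => (f p)%:E)).
exact: (integrable_le1 (P \x Q)%E mf f1).
Qed.

End FubiniBounded.

(** * Laplace transform of a sum of squared coordinates *)

Section GaussMix.
Context {R : realType}.
Notation TR := (measurableTypeR R).
Notation gam := (@gam R).

(** Laplace transform at [t] of the square of an N(- a, s^2) variable. *)
Definition sqlap (t s a : R) : R := (\int[gam]_w expR (- (t * (s * w - a) ^+ 2)))%R.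

Lemma expR_sq_le1 (t v : R) : 0 <= t -> 0 <= expR (- (t * v ^+ 2)) <= 1.
Proof. by move=> t0; rewrite expR_ge0 expR_le1 oppr_le0 mulr_ge0// sqr_ge0. Qed.

Lemma EFin_sqlap (t s a : R) : 0 <= t ->
  (\int[gam]_w (expR (- (t * (s * w - a) ^+ 2)))%:E = (sqlap t s a)%:E)%E.
Proof.
move=> t0; apply: EFin_Rintegral; apply: integrable_le1; first by mfun.
by move=> w; have /andP[h1 h2] := expR_sq_le1 (s * w - a) t0; rewrite ger0_norm.
Qed.

(** Linearizes a square: exp (- t v^2) is the characteristic function at v of a normal variable of
    variance 2 t, so v enters linearly under the integral. *)
Lemma gam_cos_sq (t v A : R) : 0 <= t ->
  (\int[gam]_z (cos (A + Num.sqrt (2 * t) * v * z))%:E = (cos A * expR (- (t * v ^+ 2)))%:E)%E.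
Proof.
move=> t0; rewrite (EFin_Rintegral (gam_integrable_cos _ A)) gam_cos.
by rewrite exprMn sqr_sqrtr ?mulr_ge0//; congr (_ * expR _)%:E; field.
Qed.

(** One double integral in two orders. Integrating over w first uses the characteristic function and
    gives the left side; integrating over z first undoes the linearization and gives [sqlap]. *)
Lemma gauss_mix (t s a c : R) : 0 <= t ->
  (\int[gam]_z (cos (c - Num.sqrt (2 * t) * a * z) * expR (- (Num.sqrt (2 * t) * s * z) ^+ 2 / 2))%:E
    = (cos c * sqlap t s a)%:E)%E.
Proof.
move=> t0; set u := Num.sqrt (2 * t).
transitivity (\int[gam]_z \int[gam]_w (cos (c - u * a * z + u * s * z * w))%:E)%E.
  apply: eq_integral => z _.
  by rewrite (EFin_Rintegral (gam_integrable_cos _ _)) gam_cos mulNr.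
pose f (p : TR * TR) : TR := cos (c - u * a * p.1 + u * s * p.1 * p.2).
have mf : measurable_fun setT f by apply: (measurableT_comp measurable_cos); mfun.
rewrite (fubini_le1 gam gam mf (fun p => cos_le_norm1 _)).
transitivity (\int[gam]_w ((cos c)%:E * (expR (- (t * (s * w - a) ^+ 2)))%:E))%E.
  apply: eq_integral => w _; rewrite -EFinM -gam_cos_sq//.
  by apply: eq_integral => z _; rewrite /f /=; congr (cos _)%:E; rewrite -/u; ring.
under eq_integral do rewrite -EFinM.
have i1 : gam.-integrable setT (fun w : TR => (expR (- (t * (s * w - a) ^+ 2)))%:E).
  apply: integrable_le1; first by mfun.
  by move=> w; have /andP[h1 h2] := expR_sq_le1 (s * w - a) t0; rewrite ger0_norm.
under eq_integral do rewrite EFinM.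
by rewrite (integralZl measurableT i1) EFin_sqlap.
Qed.

End GaussMix.

Section Laplace.
Context {R : realType} {H : lmodType R} (ip : H -> H -> R).
Hypothesis Hip : is_separable_hilbert ip.
Context {dd : measure_display} {Omega : measurableType dd} (P : probability Omega R).
Variables (xi : Omega -> H) (Sig : H -> H).
Hypothesis gxi : centered_gaussian_elt ip P xi.
Hypothesis cxi : covariance_operator ip P xi Sig.
Notation TR := (measurableTypeR R).
Notation gam := (@gam R).
Notation coord := (coord ip xi).
Notation cov := (cov ip Sig).
Variables (e : nat -> H) (lam a : nat -> R) (t : R).
Hypothesis t0 : 0 <= t.
Hypothesis lam0 : forall j, 0 <= lam j.
Hypothesis ecov : forall i j, cov (e i) (e j) = lam i * (i == j)%:R.

Definition sqexp (s : seq nat) (w : Omega) : TR :=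
  \prod_(j <- s) expR (- (t * (coord (e j) w - a j) ^+ 2)).

Lemma measurable_sqexp s : measurable_fun setT (sqexp s).
Proof.
apply: measurable_prod => j _.
have m : measurable_fun [set: TR] (fun x : TR => expR (- (t * ((x : R) - a j) ^+ 2)) : TR) by mfun.
exact: (measurableT_comp m (measurable_coord gxi (e j))).
Qed.

Lemma sqexp01 s w : 0 <= sqexp s w <= 1.
Proof.
rewrite /sqexp; elim: s => [|j s IH]; first by rewrite big_nil ler01 lexx.
rewrite big_cons; have /andP[h1 h2] := expR_sq_le1 (coord (e j) w - a j) t0.
by case/andP: IH => h3 h4; rewrite mulr_ge0//= mulr_ile1.
Qed.

(* The cosine factor makes the induction go through: exp (- t v^2) is a Gaussian average of
   cos (sqrt (2 t) v z), so that each new factor is absorbed in the linear functional h. *)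
Lemma laplace_cos (s : seq nat) (h : H) (c : R) : uniq s ->
  (forall j, j \in s -> cov h (e j) = 0) ->
  (\int[P]_w (cos (coord h w + c) * sqexp s w)%:E =
   (cos c * expR (- cov h h / 2) * \prod_(j <- s) sqlap t (Num.sqrt (lam j)) (a j))%:E)%E.
Proof.
elim: s h c => [|i s IH] h c /=.
  move=> _ _; under eq_integral do rewrite /sqexp big_nil mulr1.
  by rewrite (gauss_cos gxi cxi) big_nil mulr1.
move=> /andP[nis us] hs; set u := Num.sqrt (2 * t).
have u2 : u ^+ 2 = 2 * t by rewrite sqr_sqrtr// mulr_ge0.
pose f (p : Omega * TR) : TR :=
  cos (coord h p.1 + c + u * (coord (e i) p.1 - a i) * p.2) * sqexp s p.1.
have m1 g : measurable_fun setT (fun p : Omega * TR => coord g p.1).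
  exact: (measurableT_comp (measurable_coord gxi g) measurable_fst).
have m2 : measurable_fun setT (fun p : Omega * TR => p.2 : TR) by exact: measurable_snd.
have mf : measurable_fun setT f.
  apply: measurable_funM; last exact: (measurableT_comp (measurable_sqexp s) measurable_fst).
  apply: (measurableT_comp measurable_cos).
  apply: measurable_funD.
    by apply: measurable_funD; [exact: m1|exact: measurable_cst].
  apply: measurable_funM => //; apply: measurable_funM; first exact: measurable_cst.
  by apply: measurable_funB; [exact: m1|exact: measurable_cst].
have f1 p : `|f p : R| <= 1.
  rewrite normrM; have /andP[h1 h2] := sqexp01 s p.1.
  by rewrite [X in _ * X]ger0_norm// mulr_ile1// cos_le_norm1.
transitivity (\int[P]_w \int[gam]_z (f (w, z))%:E)%E.
  apply: eq_integral => w _; rewrite /f /=.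
  have -> : (\int[gam]_z (cos (coord h w + c + u * (coord (e i) w - a i) * z) * sqexp s w)%:E =
     \int[gam]_z ((sqexp s w)%:E * (cos (coord h w + c + u * (coord (e i) w - a i) * z))%:E))%E.
    by apply: eq_integral => z _; rewrite -EFinM mulrC.
  rewrite (integralZl measurableT (gam_integrable_cos _ _)) gam_cos_sq// -EFinM.
  by rewrite /sqexp big_cons; congr EFin; ring.
rewrite (fubini_le1 P gam mf f1).
transitivity (\int[gam]_z ((expR (- cov h h / 2) * \prod_(j <- s) sqlap t (Num.sqrt (lam j)) (a j))%:E *
   (cos (c - u * a i * z) * expR (- (u * Num.sqrt (lam i) * z) ^+ 2 / 2))%:E))%E.
  apply: eq_integral => z _.
  (* Still uncorrelated with the remaining [e j]; its variance exceeds that of [h] by lam i (u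
     z)^2. *)
  pose h' := (u * z) *: e i + h.
  have hi : cov h (e i) = 0 by apply: hs; rewrite mem_head.
  have covh' j : cov h' (e j) = (u * z) * cov (e i) (e j) + cov h (e j) by exact: (covDZl Hip cxi).
  have h's j : j \in s -> cov h' (e j) = 0.
    move=> js; rewrite covh' ecov hs ?inE ?js ?orbT// addr0.
    case: eqP => [ij|_]; last by rewrite !mulr0.
    by rewrite ij js in nis.
  have hh' : cov h' h' = cov h h + (u * Num.sqrt (lam i) * z) ^+ 2.
    rewrite {1}/h' (covDZl Hip cxi) [cov (e i) h'](covC cxi) covh' hi ecov eqxx mulr1 addr0.
    rewrite [cov h h'](covC cxi) /h' (covDZl Hip cxi) [cov (e i) h](covC cxi) hi mulr0 add0r.
    by rewrite -{1}(sqr_sqrtr (lam0 i)); ring.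
  transitivity (\int[P]_w (cos (coord h' w + (c - u * a i * z)) * sqexp s w)%:E)%E.
    apply: eq_integral => w _; rewrite /f /=; congr (cos _ * _)%:E.
    by rewrite /coord /h' (ipDr Hip) (ipZr Hip); ring.
  rewrite (IH _ _ us h's) -EFinM; congr EFin; rewrite hh'.
  rewrite (_ : - (cov h h + (u * Num.sqrt (lam i) * z) ^+ 2) / 2 =
    - cov h h / 2 + - (u * Num.sqrt (lam i) * z) ^+ 2 / 2); last by field.
  by rewrite expRD; ring.
have i1 : gam.-integrable setT (fun z : TR => (cos (c - u * a i * z) * expR (- (u * Num.sqrt (lam i) * z) ^+ 2 / 2))%:E).
  apply: (@integrable_le1 R _ _ gam (fun z : TR => cos (c - u * a i * z) * expR (- (u * Num.sqrt (lam i) * z) ^+ 2 / 2) : TR)).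
    by apply: measurable_funM; [apply: (measurableT_comp measurable_cos); mfun|mfun].
  move=> z; rewrite normrM [X in _ * X]ger0_norm ?expR_ge0// mulr_ile1 ?expR_ge0// ?cos_le_norm1//.
  by rewrite expR_le1 mulNr oppr_le0 divr_ge0// sqr_ge0.
rewrite (integralZl measurableT i1) gauss_mix// -EFinM big_cons; congr EFin; ring.
Qed.

End Laplace.

(** * The Laplace transform determines the tails *)

Section LaplaceUniqueness.
Context {R : realType}.
Notation TR := (measurableTypeR R).

Lemma bernoulli (v : R) (m : nat) : -1 <= v -> 1 + m%:R * v <= (1 + v) ^+ m.
Proof.
move=> v1; elim: m => [|m IH]; first by rewrite mul0r addr0 expr0.
rewrite exprS; apply: (@le_trans _ _ ((1 + v) * (1 + m%:R * v))); last first.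
  by rewrite ler_wpM2l//; lra.
have : 0 <= m%:R * v ^+ 2 by rewrite mulr_ge0// sqr_ge0.
by rewrite -natr1 expr2; lra.
Qed.

(* With v = exp (- n L y / y0) and L = ln 2, (1 - v)^(2^n) tends to 0 for y < y0 and to 1 for
   y > y0 (Bernoulli), while its expectation only depends on the Laplace transform. *)
Definition expmix (c b : R) (m : nat) (y : R) : R := expR (- (c * y)) * (1 - expR (- (b * y))) ^+ m.

Lemma measurable_expmix c b m : measurable_fun [set: TR] (expmix c b m : TR -> TR).
Proof.
apply: measurable_funM; first by mfun.
by apply: measurable_funX; apply: measurable_funB; mfun.
Qed.

Lemma expmix_bound c b m y : 0 <= c -> 0 <= b -> 0 <= y -> 0 <= expmix c b m y <= 1.
Proof.
move=> c0 b0 y0.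
have e1 (d : R) : 0 <= d -> 0 <= expR (- (d * y)) <= 1.
  by move=> d0; rewrite expR_ge0 expR_le1 oppr_le0 mulr_ge0.
have /andP[h1 h2] := e1 _ c0; have /andP[h3 h4] := e1 _ b0.
have h5 : 0 <= 1 - expR (- (b * y)) by lra.
have h6 : 1 - expR (- (b * y)) <= 1 by lra.
rewrite /expmix mulr_ge0 ?exprn_ge0//=.
by rewrite mulr_ile1 ?exprn_ge0// exprn_ile1.
Qed.

(** Instead of expanding the power, one factor 1 - exp (- b y) splits [expmix c b m.+1] into the
    difference of the instances [c] and [c + b] with exponent [m]; hence the induction on m leaves
    [c] free. *)
Lemma laplace_expmix d1 d2 (T1 : measurableType d1) (T2 : measurableType d2)
  (P1 : probability T1 R) (P2 : probability T2 R) (Y1 : T1 -> TR) (Y2 : T2 -> TR) :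
  measurable_fun setT Y1 -> measurable_fun setT Y2 ->
  (forall w, 0 <= Y1 w) -> (forall w, 0 <= Y2 w) ->
  (forall t, 0 <= t -> (\int[P1]_w (expR (- (t * Y1 w)))%:E = \int[P2]_w (expR (- (t * Y2 w)))%:E)%E) ->
  forall m c b, 0 <= c -> 0 <= b ->
  (\int[P1]_w (expmix c b m (Y1 w))%:E = \int[P2]_w (expmix c b m (Y2 w))%:E)%E.
Proof.
move=> mY1 mY2 Y10 Y20 eqL.
elim=> [|m IH] c b c0 b0.
  under eq_integral do rewrite /expmix expr0 mulr1.
  by rewrite eqL//; apply: eq_integral => w _; rewrite /expmix expr0 mulr1.
have step d (T : measurableType d) (P : probability T R) (Y : T -> TR) :
    measurable_fun setT Y -> (forall w, 0 <= Y w) ->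
    (\int[P]_w (expmix c b m.+1 (Y w))%:E =
     \int[P]_w (expmix c b m (Y w))%:E - \int[P]_w (expmix (c + b) b m (Y w))%:E)%E.
  move=> mY Y0.
  have bi c' : 0 <= c' -> P.-integrable setT (fun w => (expmix c' b m (Y w))%:E).
    move=> c'0; apply: (@integrable_bounded _ _ _ _ (fun w => expmix c' b m (Y w)) 1).
      exact: (measurableT_comp (measurable_expmix c' b m) mY).
    by move=> w; have /andP[h1 h2] := expmix_bound m c'0 b0 (Y0 w); rewrite ger0_norm.
  rewrite -integralB//; [|exact: bi|by apply: bi; exact: addr_ge0].
  apply: eq_integral => w _; rewrite -EFinB; congr EFin.
  by rewrite /expmix exprS (_ : - ((c + b) * Y w) = - (c * Y w) - b * Y w) ?expRD; ring.
by rewrite (step _ _ P1 Y1 mY1 Y10) (step _ _ P2 Y2 mY2 Y20) (IH _ _ c0 b0) (IH _ _ (addr_ge0 c0 b0) b0).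
Qed.

Lemma laplace_le d1 d2 (T1 : measurableType d1) (T2 : measurableType d2)
  (P1 : probability T1 R) (P2 : probability T2 R) (Y1 : T1 -> TR) (Y2 : T2 -> TR) (x x' : R) :
  measurable_fun setT Y1 -> measurable_fun setT Y2 ->
  (forall w, 0 <= Y1 w) -> (forall w, 0 <= Y2 w) ->
  (forall t, 0 <= t -> (\int[P1]_w (expR (- (t * Y1 w)))%:E = \int[P2]_w (expR (- (t * Y2 w)))%:E)%E) ->
  0 < x -> x < x' ->
  (P2 (Y2 @^-1` `[x', +oo[) <= P1 (Y1 @^-1` `]x, +oo[))%E.
Proof.
move=> mY1 mY2 Y10 Y20 eqL x0 xx'.
pose y := (x + x') / 2.
have xy : x < y by rewrite /y; lra.
have yx : y < x' by rewrite /y; lra.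
have y0 : 0 < y by lra.
pose L := ln (2 : R).
have eL : expR L = 2 by rewrite lnK// posrE.
have L0 : 0 < L by rewrite ln_gt0//; lra.
(* Exponential rate on both sides of y: 2^n v is at least exp (n dl) for Y <= x and at most exp (- n
   dl) for Y >= x'. *)
pose dl := Num.min (L * (x' / y - 1)) (L * (1 - x / y)).
have dl0 : 0 < dl.
  rewrite lt_min !mulr_gt0// subr_gt0; first by rewrite ltr_pdivrMr// mul1r.
  by rewrite ltr_pdivlMr// mul1r.
have b0 (n : nat) : 0 <= n%:R * (L / y) by apply: mulr_ge0 => //; apply: divr_ge0; exact: ltW.
have bnd (n : nat) (Y : R) : 0 <= Y ->
  let q := expmix 0 (n%:R * (L / y)) (2 ^ n) Y in
  (Y <= x -> q <= expR (- (n%:R * dl))) /\ (x' <= Y -> 1 - expR (- (n%:R * dl)) <= q).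
  move=> Y0 q.
  pose v := expR (- (n%:R * (L / y) * Y)).
  have v0 : 0 < v by exact: expR_gt0.
  have v1 : v <= 1 by rewrite expR_le1 oppr_le0; exact: mulr_ge0.
  have qE : q = (1 - v) ^+ (2 ^ n) by rewrite /q /expmix mul0r oppr0 expR0 mul1r.
  have mv : (2 ^ n)%:R * v = expR (n%:R * (L * (1 - Y / y))).
    rewrite natrX -eL -expRM_natl -expRD; congr expR; field.
    by rewrite gt_eqF.
  have n0 : 0 <= n%:R :> R by [].
  split=> [Yx|xY].
    have q0 : 0 <= q by rewrite qE exprn_ge0//; lra.
    (* With N = 2^n, (1 - v)^N (1 + v)^N <= 1 while (1 + v)^N >= N v, so q is at most 1 / (N v). *)
    have h : q * ((2 ^ n)%:R * v) <= 1.
      apply: (@le_trans _ _ (q * (1 + v) ^+ (2 ^ n))).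
        rewrite ler_wpM2l//; have := @bernoulli v (2 ^ n); lra.
      rewrite qE -exprMn exprn_ile1//; last by have := sqr_ge0 v; lra.
      have : 0 <= v * (1 - v) by rewrite mulr_ge0; lra.
      by have := ltW v0; lra.
    rewrite mv in h.
    have mm : expR (n%:R * dl) <= expR (n%:R * (L * (1 - Y / y))).
      rewrite ler_expR ler_wpM2l//; apply: (@le_trans _ _ (L * (1 - x / y))).
        by rewrite /dl ge_min lexx orbT.
      by rewrite ler_pM2l// lerD2l lerN2 ler_pM2r// invr_gt0.
    rewrite expRN -[leRHS]mul1r ler_pdivlMr ?expR_gt0//.
    by apply: le_trans h; rewrite ler_wpM2l.
  apply: (@le_trans _ _ (1 - (2 ^ n)%:R * v)).
    rewrite lerD2l lerN2 mv ler_expR -[- (n%:R * dl)]mulrN ler_wpM2l//.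
    apply: (@le_trans _ _ (- (L * (x' / y - 1)))); last by rewrite lerN2 /dl ge_min lexx.
    rewrite -[- (L * _)]mulrN ler_pM2l// opprB lerD2l lerN2 ler_pM2r// invr_gt0//.
  rewrite qE -mulrN; apply: bernoulli; lra.
pose q n := expmix 0 (n%:R * (L / y)) (2 ^ n).
have q01 n Y : 0 <= Y -> 0 <= q n Y <= 1 by move=> Y0; apply: expmix_bound.
have mq n : measurable_fun [set: TR] (q n : TR -> TR) by exact: measurable_expmix.
have mA : measurable (Y1 @^-1` `]x, +oo[).
  by rewrite -[X in measurable X]setTI; apply: mY1 => //; exact: measurable_itv.
have mB : measurable (Y2 @^-1` `[x', +oo[).
  by rewrite -[X in measurable X]setTI; apply: mY2 => //; exact: measurable_itv.
set p1 := P1 _; set p2 := P2 _.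
have fp1 : p1 \is a fin_num by exact: fin_num_measure.
have fp2 : p2 \is a fin_num by exact: fin_num_measure.
have key (n : nat) : fine p2 - fine p1 <= 2 * expR (- (n%:R * dl)).
  set r := expR _.
  have r0 : 0 <= r by exact: expR_ge0.
  have r1 : r <= 1 by rewrite expR_le1 oppr_le0 mulr_ge0// ltW.
  have up : (\int[P1]_w (q n (Y1 w))%:E <= p1 + r%:E)%E.
    have -> : (p1 + r%:E = \int[P1]_w ((\1_(Y1 @^-1` `]x, +oo[) w)%:E + (cst r%:E) w))%E.
      rewrite ge0_integralD//; last exact: measurable_EFin_indic.
      by rewrite -prob_indic// integral_cst// [X in (r%:E * X)%E]probability_setT mule1.
    apply: ge0_le_integral => //.
    - by move=> w _; have /andP[] := q01 n _ (Y10 w).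
    - by apply/measurable_EFinP; apply: (measurableT_comp (mq n) mY1).
    - apply: emeasurable_funD => //; exact: measurable_EFin_indic.
    move=> w _; rewrite -EFinD lee_fin indicE; case: (boolP (w \in _)) => [_|].
      by have /andP[] := q01 n _ (Y10 w); rewrite /=; lra.
    rewrite notin_setE /= in_itv/= andbT => /negP; rewrite -leNgt => yx'.
    by rewrite add0r; have [h _] := bnd n _ (Y10 w); exact: h.
  have lo : (p2 * (1 - r)%:E <= \int[P2]_w (q n (Y2 w))%:E)%E.
    have -> : (p2 * (1 - r)%:E = \int[P2]_w ((1 - r)%:E * (\1_(Y2 @^-1` `[x', +oo[) w)%:E))%E.
      rewrite ge0_integralZl//; [|exact: measurable_EFin_indic|by rewrite lee_fin subr_ge0].
      by rewrite -prob_indic// muleC.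
    apply: ge0_le_integral => //.
    - by move=> w _; rewrite mule_ge0 ?lee_fin ?subr_ge0.
    - apply: emeasurable_funM => //; exact: measurable_EFin_indic.
    - by apply/measurable_EFinP; apply: (measurableT_comp (mq n) mY2).
    move=> w _; rewrite -EFinM lee_fin indicE; case: (boolP (w \in _)) => [|_].
      rewrite inE /= in_itv/= andbT mulr1 => h'.
      by have [_ h] := bnd n _ (Y20 w); exact: h.
    by rewrite mulr0; have /andP[] := q01 n _ (Y20 w).
  have : (p2 * (1 - r)%:E <= p1 + r%:E)%E.
    apply: (le_trans lo); apply: le_trans up.
    by rewrite /q (laplace_expmix mY1 mY2 Y10 Y20 eqL).
  rewrite -(fineK fp1) -(fineK fp2) -EFinM -EFinD lee_fin.
  have p21 : fine p2 <= 1 by rewrite -lee_fin fineK// probability_le1.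
  have p20 : 0 <= fine p2 by rewrite fine_ge0// measure_ge0.
  by have : fine p2 * r <= r; [rewrite ler_piMl|lra].
rewrite -(fineK fp1) -(fineK fp2) lee_fin leNgt; apply/negP => p12.
pose g := fine p2 - fine p1.
have g0 : 0 < g by rewrite subr_gt0.
pose n := Num.bound (2 / (g * dl)).
have nb : 2 / (g * dl) < n%:R.
  by apply: archi_boundP; rewrite divr_ge0// mulr_ge0// ltW.
rewrite ltr_pdivrMr ?mulr_gt0// in nb.
have := key n; rewrite -/g expRN => h.
have e1 := expR_ge1Dx (n%:R * dl).
have e0 := expR_gt0 (n%:R * dl).
rewrite ler_pdivlMr// in h.
have : g * (n%:R * dl) <= g * expR (n%:R * dl) by rewrite ler_pM2l//; lra.
by lra.
Qed.

(** [laplace_le] leaves a gap between x and x'. Continuity from below along x + 1 / (n + 1) closes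
    it, and exchanging the two variables gives the other inequality. *)
Lemma laplace_cdf d1 d2 (T1 : measurableType d1) (T2 : measurableType d2)
  (P1 : probability T1 R) (P2 : probability T2 R) (Y1 : T1 -> TR) (Y2 : T2 -> TR) (x : R) :
  measurable_fun setT Y1 -> measurable_fun setT Y2 ->
  (forall w, 0 <= Y1 w) -> (forall w, 0 <= Y2 w) ->
  (forall t, 0 <= t -> (\int[P1]_w (expR (- (t * Y1 w)))%:E = \int[P2]_w (expR (- (t * Y2 w)))%:E)%E) ->
  0 < x ->
  P1 (Y1 @^-1` `]x, +oo[) = P2 (Y2 @^-1` `]x, +oo[).
Proof.
have half d d' (T1' : measurableType d) (T2' : measurableType d')
  (P1' : probability T1' R) (P2' : probability T2' R) (Z1 : T1' -> TR) (Z2 : T2' -> TR) :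
  measurable_fun setT Z1 -> measurable_fun setT Z2 ->
  (forall w, 0 <= Z1 w) -> (forall w, 0 <= Z2 w) ->
  (forall t, 0 <= t -> (\int[P1']_w (expR (- (t * Z1 w)))%:E = \int[P2']_w (expR (- (t * Z2 w)))%:E)%E) ->
  0 < x -> (P2' (Z2 @^-1` `]x, +oo[) <= P1' (Z1 @^-1` `]x, +oo[))%E.
  move=> m1 m2 Z10 Z20 eqL x0.
  pose F (n : nat) := Z2 @^-1` `[(x + n.+1%:R^-1)%R, +oo[%classic.
  have mF n : measurable (F n).
    by rewrite -[X in measurable X]setTI; apply: m2 => //; exact: measurable_itv.
  have UF : \bigcup_n F n = Z2 @^-1` `]x, +oo[%classic.
    apply/seteqP; split=> w /=.
      move=> [n _]; rewrite /F /= !in_itv/= !andbT; apply: lt_le_trans.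
      by rewrite ltrDl invr_gt0.
    rewrite in_itv/= andbT => xw.
    pose n := Num.bound ((Z2 w - x)^-1).
    have zx : 0 < Z2 w - x by rewrite subr_gt0.
    have nb : (Z2 w - x)^-1 < n%:R by apply: archi_boundP; rewrite invr_ge0 ltW.
    exists n => //; rewrite /F /= in_itv/= andbT -lerBrDl.
    rewrite -[leRHS]invrK lef_pV2 ?posrE ?invr_gt0//.
    by apply: ltW; apply: (lt_trans nb); rewrite ltr_nat.
  have nd : nondecreasing_seq F.
    move=> i j ij; apply/subsetPset => w; rewrite /F /= !in_itv/= !andbT; apply: le_trans.
    by rewrite lerD2l lef_pV2 ?posrE// ler_nat ltnS.
  have := nondecreasing_cvg_mu mF (bigcup_measurable (fun k _ => mF k)) nd => /(_ _ P2').
  rewrite UF => /cvg_lim <-//.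
  apply: lime_le.
    apply: ereal_nondecreasing_is_cvgn => i j ij; apply: le_measure; rewrite ?inE//.
    by apply/subsetPset; exact: nd.
  apply: nearW => n; apply: (laplace_le m1 m2) => //.
  by rewrite ltrDl invr_gt0.
move=> m1 m2 Y10 Y20 eqL x0; apply/eqP; rewrite eq_le; apply/andP; split; last exact: half.
by apply: half => // t t0; rewrite eqL.
Qed.

End LaplaceUniqueness.

Section LawLaplace.
Context {R : realType}.
Notation TR := (measurableTypeR R).

Lemma law_laplace (l : seq (R * R)) (t : R) : 0 <= t ->
  (\int[law l]_x (expR (- (t * x)))%:E = (\prod_(p <- l) sqlap t p.1 p.2)%:E)%E.
Proof.
move=> t0; elim: l => [|p l IH].
  have mf : measurable_fun [set: TR] (fun x : TR => (expR (- (t * x)))%:E) by mfun.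
  have f0 (x : TR) : (0 <= (expR (- (t * x)))%:E)%E by rewrite lee_fin expR_ge0.
  by rewrite (ge0_integral_law_nil mf f0) big_nil mulr0 oppr0 expR0.
have mf : measurable_fun [set: TR] (fun x : TR => (expR (- (t * x)))%:E) by mfun.
have f0 (x : TR) : (0 <= (expR (- (t * x)))%:E)%E by rewrite lee_fin expR_ge0.
rewrite (ge0_integral_law_cons p l mf f0) big_cons.
transitivity (\int[law1 p]_x ((\prod_(p <- l) sqlap t p.1 p.2)%:E * (expR (- (t * x)))%:E))%E.
  apply: eq_integral => x _; rewrite -IH muleC -ge0_integralZl//.
  by apply: eq_integral => y _; rewrite -EFinM -expRD; congr (expR _)%:E; ring.
have pi0 : 0 <= \prod_(p <- l) sqlap t p.1 p.2.
  by rewrite -lee_fin -IH; apply: integral_ge0 => x _; exact: f0.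
rewrite ge0_integralZl//.
by rewrite (ge0_integral_law1 p mf f0) EFin_sqlap// -EFinM mulrC.
Qed.

(** [laplace_cdf] asks for variables that are nonnegative everywhere; as [law l] is carried by [0,
    oo[, the absolute value can stand for the identity. *)
Lemma ge0_integral_law_norm (l : seq (R * R)) (f : TR -> \bar R) : measurable_fun setT f ->
  (forall x, 0 <= f x)%E -> (\int[law l]_x f x = \int[law l]_x f `|x|%R)%E.
Proof.
have mn : measurable_fun [set: TR] (fun x : TR => `|x| : TR) by exact: normr_measurable.
elim: l f => [|p l IH] f mf f0.
  rewrite ge0_integral_law_nil// (@ge0_integral_law_nil R (fun x : TR => f `|x|))//.
    by rewrite normr0.
  exact: (measurableT_comp mf mn).
have mfn : measurable_fun [set: TR] (fun x : TR => f `|x|) by exact: (measurableT_comp mf mn).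
rewrite (ge0_integral_law_cons p l mf f0) (ge0_integral_law_cons p l mfn (fun x => f0 _)).
rewrite (ge0_integral_law1 p (measurable_int_shift _ mf f0)); last first.
  by move=> x; apply: integral_ge0 => y _; exact: f0.
rewrite (ge0_integral_law1 p (measurable_int_shift _ mfn (fun x => f0 _))); last first.
  by move=> x; apply: integral_ge0 => y _; exact: f0.
apply: eq_integral => z _; set x := (_ ^+ 2)%R.
have x0 : 0 <= x by exact: sqr_ge0.
rewrite (IH _ (measurable_shiftR x mf) (fun y => f0 _)).
rewrite (IH _ (measurable_shiftR x mfn) (fun y => f0 _)).
by apply: eq_integral => y _; rewrite [`|x + `|y| |]ger0_norm// addr_ge0.
Qed.

End LawLaplace.

Section CoordLaw.
Context {R : realType} {H : lmodType R} (ip : H -> H -> R).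
Hypothesis Hip : is_separable_hilbert ip.
Context {dd : measure_display} {Omega : measurableType dd} (P : probability Omega R).
Variables (xi : Omega -> H) (Sig : H -> H).
Hypothesis gxi : centered_gaussian_elt ip P xi.
Hypothesis cxi : covariance_operator ip P xi Sig.
Notation TR := (measurableTypeR R).
Notation coord := (coord ip xi).
Notation cov := (cov ip Sig).
Variables (e : nat -> H) (lam a : nat -> R) (c : R).
Hypothesis c0 : 0 <= c.
Hypothesis lam0 : forall j, 0 <= lam j.
Hypothesis ecov : forall i j, cov (e i) (e j) = lam i * (i == j)%:R.

Definition sqdist (n : nat) (w : Omega) : TR :=
  c + \sum_(j <- iota 0 n) (coord (e j) w - a j) ^+ 2.

Lemma measurable_sqdist n : measurable_fun setT (sqdist n).
Proof.
apply: measurable_funD; first exact: measurable_cst.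
apply: measurable_sum => j.
have m : measurable_fun [set: TR] (fun x : TR => ((x : R) - a j) ^+ 2 : TR) by mfun.
exact: (measurableT_comp m (measurable_coord gxi (e j))).
Qed.

Lemma sqdist_ge0 n w : 0 <= sqdist n w.
Proof. by rewrite addr_ge0// sumr_ge0// => j _; exact: sqr_ge0. Qed.

(** Equality of the laws is read off the Laplace transforms, which factor by [laplace_cos] at h = 0;
    independence of the coordinates enters only through this factorization. *)
Lemma sqdist_law n x : 0 < x ->
  P (sqdist n @^-1` `]x, +oo[) =
  law ((0, Num.sqrt c) :: map (fun j => (Num.sqrt (lam j), a j)) (iota 0 n)) `]x, +oo[%classic.
Proof.
move=> x0; set l := (_ :: _).
have mn : measurable_fun [set: TR] (fun x : TR => `|x| : TR) by exact: normr_measurable.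
rewrite (@laplace_cdf R _ _ _ _ P (law l) (sqdist n) (fun x : TR => `|x| : TR) x
  (measurable_sqdist n) mn (sqdist_ge0 n) (fun x => normr_ge0 _) _ x0).
  have mI : measurable (`]x, +oo[%classic : set TR) by exact: measurable_itv.
  have mA : measurable ((fun x : TR => `|x| : TR) @^-1` `]x, +oo[%classic).
    by rewrite -[X in measurable X]setTI; exact: mn.
  rewrite (prob_indic _ mI) (ge0_integral_law_norm l (measurable_EFin_indic mI) (@indic_ge0 _ _ _)).
  by rewrite (prob_indic _ mA).
move=> t t0.
have mf : measurable_fun [set: TR] (fun x : TR => (expR (- (t * x)))%:E) by mfun.
have f0 (y : TR) : (0 <= (expR (- (t * y)))%:E)%E by rewrite lee_fin expR_ge0.
rewrite -(ge0_integral_law_norm l mf f0) law_laplace//.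
have zj j : j \in iota 0 n -> cov 0 (e j) = 0.
  by move=> _; rewrite (covC cxi) /cov (ip0r Hip).
have := laplace_cos Hip gxi cxi a t0 lam0 ecov 0 (iota_uniq 0 n) zj.
rewrite {1}/cov (ip0r Hip) oppr0 mul0r expR0 cos0 !mul1r => L.
have m1 := measurable_sqexp gxi e a t (iota 0 n).
have i1 : P.-integrable setT (fun w => (sqexp ip xi e a t (iota 0 n) w : R)%:E).
  apply: integrable_le1 => // w.
  by have /andP[h1 h2] := sqexp01 ip xi e a t0 (iota 0 n) w; rewrite ger0_norm.
transitivity (\int[P]_w ((expR (- (t * c)))%:E * (sqexp ip xi e a t (iota 0 n) w)%:E))%E.
  apply: eq_integral => w _; rewrite -EFinM; congr EFin; rewrite /sqdist /sqexp.
  rewrite -expR_sum -expRD; congr expR; rewrite mulrDr opprD; congr (_ + _).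
  by rewrite mulr_sumr -sumrN.
rewrite (integralZl measurableT i1).
have -> : (\int[P]_w (sqexp ip xi e a t (iota 0 n) w)%:E =
  \int[P]_w (cos (coord 0 w + 0) * sqexp ip xi e a t (iota 0 n) w)%:E)%E.
  by apply: eq_integral => w _; rewrite /coord (ip0r Hip) addr0 cos0 mul1r.
rewrite L -EFinM /l big_cons big_map; congr EFin; congr (_ * _).
apply: EFin_inj; rewrite -EFin_sqlap//=.
under eq_integral do rewrite mul0r sub0r sqrrN sqr_sqrtr//.
by rewrite integral_prob_cst.
Qed.

End CoordLaw.

(** * Spectral decomposition *)

Section UltraCauchy.
Context {R : realType}.
Variable G : set_system nat.
Context {UG : UltraFilter G}.

(** Bisection of the range: at each stage the ultrafilter selects one of the two halves, until the
    length is below [rho]. *)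
Lemma ultra_osc (f : nat -> R) (M rho : R) : (forall n, `|f n| <= M) -> 0 < rho ->
  exists2 A, G A & forall n m, A n -> A m -> `|f n - f m| <= rho.
Proof.
move=> fM rho0.
have M0 : 0 <= M by apply: le_trans (fM 0%N).
have bis k : exists2 A, G A & exists c, forall n, A n -> c <= f n <= c + 2 * M / 2 ^+ k.
  elim: k => [|k [A GA [c hc]]].
    exists setT; first exact: filterT.
    exists (- M) => n _; have := fM n; rewrite ler_norml expr0 => /andP[h1 h2].
    by apply/andP; split; lra.
  set r := 2 * M / 2 ^+ k in hc.
  have rE : 2 * M / 2 ^+ k.+1 = r / 2 by rewrite /r exprS invfM; ring.
  have [GB|GB] := in_ultra_setVsetC [set n | f n <= c + r / 2] UG.
    exists (A `&` [set n | f n <= c + r / 2]); first exact: filterI.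
    exists c => n [/hc /andP[h1 h2] /= h3]; rewrite rE; apply/andP; split; lra.
  exists (A `&` ~` [set n | f n <= c + r / 2]); first exact: filterI.
  exists (c + r / 2) => n [/hc /andP[h1 h2] /= /negP]; rewrite -ltNge => h3.
  by rewrite rE; apply/andP; split; lra.
pose k := Num.bound (2 * M / rho).
have kb : 2 * M / rho < k%:R by apply: archi_boundP; rewrite divr_ge0 ?mulr_ge0// ltW.
have [A GA [c hc]] := bis k.
exists A => // n m /hc /andP[n1 n2] /hc /andP[m1 m2].
have : 2 * M / 2 ^+ k <= rho.
  rewrite ler_pdivrMr ?exprn_gt0//; rewrite ltr_pdivrMr// in kb.
  have k2 : k%:R <= 2 ^+ k :> R by rewrite -natrX ler_nat ltnW// ltn_expl.
  by have : k%:R * rho <= 2 ^+ k * rho; [rewrite ler_pM2r|lra].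
by rewrite ler_norml => h; apply/andP; split; lra.
Qed.

Lemma ultra_osc_fin (N : nat) (f : nat -> nat -> R) (M : nat -> R) (rho : R) :
  (forall k n, `|f k n| <= M k) -> 0 < rho ->
  exists2 A, G A & forall k n m, (k < N)%N -> A n -> A m -> `|f k n - f k m| <= rho.
Proof.
move=> fM rho0; elim: N => [|N [A GA hA]]; first by exists setT => //; exact: filterT.
have [B GB hB] := ultra_osc (fM N) rho0.
exists (A `&` B); first exact: filterI.
move=> k n m; rewrite ltnS leq_eqVlt => /orP[/eqP ->|kN] [An Bn] [Am Bm]; first exact: hB.
exact: hA.
Qed.

(** The ultrafilter does the work of a diagonal extraction. Choosing phi i beyond i and in the first
    i + 1 of the sets attached to the tolerances 1 / (k + 1) gives a Cauchy sequence whose indices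
    tend to infinity. *)
Lemma ultra_cauchy (D : nat -> nat -> R) : \oo `<=` G ->
  (forall eps, 0 < eps -> exists2 A, G A & forall n m, A n -> A m -> D n m < eps) ->
  exists phi : nat -> nat, (forall i, (i <= phi i)%N) /\
    forall eps, 0 < eps -> exists N, forall n m, (N <= n)%N -> (N <= m)%N -> D (phi n) (phi m) < eps.
Proof.
move=> ooG hD.
have hA i : exists A, G A /\ forall n m, A n -> A m -> D n m < i.+1%:R^-1.
  have i0 : 0 < i.+1%:R^-1 :> R by rewrite invr_gt0.
  by have [A GA h] := hD _ i0; exists A.
have [A AP] := choice hA.
have GB i : G (\bigcap_(k in `I_i.+1) A k `&` [set n | (i <= n)%N]).
  apply: filterI; last by apply: ooG; exists i.
  move: i.+1 => m; elim: m => [|m IHm].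
    by apply: (@filterS _ _ _ setT); [move=> ? _ ?|exact: filterT].
  have [GAm _] := AP m; apply: filterS (filterI IHm GAm) => n [h1 h2] k /=.
  by rewrite ltnS leq_eqVlt => /orP[/eqP -> //|km]; exact: h1.
have ne i : exists n, (\bigcap_(k in `I_i.+1) A k `&` [set n | (i <= n)%N]) n.
  exact: filter_ex (GB i).
have [phi phiP] := choice ne.
exists phi; split=> [i|eps eps0]; first by have [] := phiP i.
pose N := Num.bound (eps^-1).
have Nb : eps^-1 < N%:R by apply: archi_boundP; rewrite invr_ge0 ltW.
exists N => n m Nn Nm; apply: (@lt_trans _ _ (N.+1%:R^-1)).
  by have [_ h] := AP N; apply: h; [have [h _] := phiP n|have [h _] := phiP m]; apply: h => /=; rewrite ltnS.
rewrite -[ltRHS]invrK ltf_pV2 ?posrE ?invr_gt0//.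
by apply: (lt_trans Nb); rewrite ltr_nat.
Qed.

End UltraCauchy.

Section Spectral.
Context {R : realType} {H : lmodType R} (ip : H -> H -> R).
Hypothesis Hip : is_separable_hilbert ip.
Context {dd : measure_display} {Omega : measurableType dd} (P : probability Omega R).
Variables (xi : Omega -> H) (Sig : H -> H).
Hypothesis gxi : centered_gaussian_elt ip P xi.
Hypothesis cxi : covariance_operator ip P xi Sig.
Notation TR := (measurableTypeR R).
Notation gam := (@gam R).
Notation coord := (coord ip xi).
Notation cov := (cov ip Sig).
Notation hnorm := (hnorm ip).
Variable d : nat -> H.
Hypothesis dense_d : forall x (e : R), 0 < e -> exists n, hnorm (x - d n) < e.

Lemma measurable_hball (g : H) (r : R) : 0 <= r ->
  measurable [set w | hnorm (xi w - g) <= r].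
Proof.
move=> r0.
have -> : [set w | hnorm (xi w - g) <= r] =
  \bigcap_k (coord (d k) @^-1` `]-oo, ((r ^+ 2 + ip (d k) (d k) + 2 * ip g (d k)) / 2)%R]%classic).
  apply/seteqP; split=> w /=.
    rewrite (hnorm_le Hip)// (ip_dense_sup Hip dense_d) => h k _ /=.
    rewrite in_itv/= /coord; have := h k; rewrite (ipBl Hip); lra.
  move=> h; rewrite (hnorm_le Hip)//; apply/(ip_dense_sup Hip dense_d) => k.
  have := h k I; rewrite /= in_itv/= /coord (ipBl Hip); lra.
apply: bigcap_measurable => [|k _]; first by exists 0%N.
by rewrite -[X in measurable X]setTI; exact: (measurable_coord gxi).
Qed.

(* xi is close to one of finitely many points with probability 3/4, hence so is <xi, h>
   to 0; this is the compactness of the covariance operator. *)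
Lemma cov_small_ball (rho : R) : 0 < rho -> exists N, forall h B,
  ip h h <= 1 -> 0 <= B -> (forall k, (k < N)%N -> `|ip (d k) h| <= B) ->
  cov h h <= (3 * (B + rho)) ^+ 2.
Proof.
move=> rho0.
pose A N := \bigcup_(k in `I_N) [set w | hnorm (xi w - d k) <= rho].
have mA N : measurable (A N).
  by apply: bigcup_measurable => k _; apply: measurable_hball; exact: ltW.
have UA : \bigcup_N A N = setT.
  apply/seteqP; split=> // w _; have [k hk] := dense_d (xi w) rho0.
  by exists k.+1 => //; exists k => //=; exact: ltW.
have nd : nondecreasing_seq A.
  move=> i j ij; apply/subsetPset => w [k /= ki hk]; exists k => //=.
  exact: leq_trans ij.
have [N hN] : exists N, ((3 / 4)%:E <= P (A N))%E.
  apply: contrapT => nN.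
  have : (lim ((P \o A) n @[n --> \oo]) <= (3 / 4)%:E)%E.
    apply: lime_le.
      apply: ereal_nondecreasing_is_cvgn => i j ij; apply: le_measure; rewrite ?inE//.
      by apply/subsetPset; exact: nd.
    apply: nearW => n /=; rewrite leNgt; apply/negP => /ltW h; apply: nN; by exists n.
  have := nondecreasing_cvg_mu mA (bigcup_measurable (fun k _ => mA k)) nd.
  move=> /(_ _ P) /cvg_lim ->//.
  rewrite UA; have := @probability_setT _ _ _ P => /= ->.
  by rewrite lee_fin; lra.
exists N => h B h1 B0 hB.
have [s [s0 s2 key]] := gauss_coord gxi cxi h.
have [s00|s00] := eqVneq s 0; first by rewrite -s2 s00 expr0n sqr_ge0.
have sp : 0 < s by rewrite lt_neqAle eq_sym s00.
set C := B + rho; have C0 : 0 < C by rewrite /C; lra.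
have mI : measurable (`[(- C)%R, C]%classic : set TR) by exact: measurable_itv.
have mc : measurable (coord h @^-1` `[(- C)%R, C]%classic).
  by rewrite -[X in measurable X]setTI; exact: (measurable_coord gxi).
have h1' : hnorm h <= 1 by rewrite (hnorm_le Hip)// expr1n.
have : (P (A N) <= P (coord h @^-1` `[(- C)%R, C]%classic))%E.
  apply: le_measure; rewrite ?inE// => w [k /= kN hk].
  rewrite in_itv/= -ler_norml /coord.
  rewrite (_ : ip (xi w) h = ip (d k) h + ip (xi w - d k) h); last by rewrite (ipBl Hip); ring.
  apply: (le_trans (ler_normD _ _)); apply: lerD; first exact: hB.
  apply: (le_trans (ip_le_hnorm Hip _ _)).
  have := hnorm_ge0 ip (xi w - d k); have := hnorm_ge0 ip h => u0 v0.
  by apply: (le_trans (ler_wpM2l v0 h1')); rewrite mulr1.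
move=> /(le_trans hN) hP.
(* The probability that |s Z| <= C is at most 2 C / s; being at least 3/4, it forces s <= 8 C / 3 <=
   3 C. *)
have : ((3 / 4)%:E <= (2 * C / s)%:E)%E.
  apply: (le_trans hP); rewrite (prob_indic _ mc).
  have := key _ (measurable_EFin_indic mI) (@indic_ge0 _ _ _) => /= k1.
  rewrite (_ : (\int[P]_x _)%E = (\int[gam]_z (\1_(`[(- C)%R, C]%classic) (s * z)%R)%:E)%E); last first.
    by rewrite -k1; apply: eq_integral.
  have mJ : measurable (`[(- (C / s))%R, (C / s)%R]%classic : set TR) by exact: measurable_itv.
  rewrite (_ : (\int[gam]_z _)%E = gam `[(- (C / s))%R, (C / s)%R]%classic).
    have Cs : - (C / s) <= C / s.
      by have : 0 <= C / s; [rewrite divr_ge0 ?ltW|lra].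
    apply: (le_trans (gam_itv_le Cs)).
    by rewrite lee_fin le_eqVlt; apply/orP; left; apply/eqP; ring.
  rewrite (prob_indic _ mJ); apply: eq_integral => z _; rewrite !indicE.
  congr (_%:R%:E); congr nat_of_bool.
  have e : (- C <= s * z <= C) = (- (C / s) <= z <= C / s).
    by rewrite -mulNr ler_pdivrMr// ler_pdivlMr// [z * s]mulrC.
  by apply/idP/idP => /set_mem hz; apply/mem_set; move: hz; rewrite /= !in_itv/= e.
rewrite lee_fin ler_pdivlMr// => hs.
by rewrite -s2 ler_pXn2r ?nnegrE//; lra.
Qed.

Variables (lam : nat -> R) (e : nat -> H).
Hypothesis eS : forall j, 0 < lam j -> Sig (e j) = lam j *: e j.
Hypothesis eC : forall (mu : R) (v : H), 0 < mu -> Sig v = mu *: v ->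
  (forall j, lam j = mu -> ip v (e j) = 0) -> v = 0.

Definition residual (h : H) := forall j, 0 < lam j -> ip h (e j) = 0.

Lemma residualDZ c x y : residual x -> residual y -> residual (c *: x + y).
Proof. by move=> rx ry j l0; rewrite (ipDZl Hip) rx// ry// mulr0 addr0. Qed.

Lemma residual_Sig h : residual h -> residual (Sig h).
Proof.
move=> rh j l0; rewrite -/(cov h (e j)) (covC cxi) /cov eS// (ipZl Hip) (ipC Hip) rh//.
by rewrite mulr0.
Qed.

(** Inherited from the bilinearity of the covariance, since [ip] is definite. *)
Lemma SigB x y : Sig (x - y) = Sig x - Sig y.
Proof.
apply/eqP; rewrite -subr_eq0; apply/eqP; apply: (ip_eq0 Hip).
set z := _ - _.
have E w : ip (Sig (x - y) - (Sig x - Sig y)) w = 0.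
  rewrite !(ipBl Hip) -!/(cov _ w) (_ : x - y = (-1) *: y + x); last by rewrite scaleN1r addrC.
  by rewrite (covDZl Hip cxi); ring.
exact: E.
Qed.

(* Otherwise a maximizing sequence for <Sig h, h> on the orthogonal of the e_j would have
   a subsequence whose image under Sig converges to a further eigenvector. *)
Lemma cov_residual h : residual h -> cov h h = 0.
Proof.
move=> rh0; apply/eqP; rewrite eq_le (cov_ge0 cxi) andbT leNgt; apply/negP => q0.
pose E := [set q | exists g, [/\ residual g, ip g g <= 1 & q = cov g g]].
have scal g : residual g -> 0 < ip g g -> E (cov g g / ip g g).
  move=> rg gg; pose c := (Num.sqrt (ip g g))^-1.
  have c2 : c ^+ 2 = (ip g g)^-1 by rewrite exprVn sqr_sqrtr// ltW.
  have r0 : residual 0 by move=> j _; rewrite (ip0l Hip).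
  have cc z : cov (c *: g + 0) z = c * cov g z.
    by rewrite (covDZl Hip cxi) [cov 0 z](covC cxi) /cov (ip0r Hip) addr0.
  exists (c *: g + 0); split.
  - exact: residualDZ.
  - by rewrite addr0 (ipZl Hip) (ipZr Hip) mulrA -expr2 c2 mulVf// gt_eqF.
  - by rewrite cc (covC cxi) cc mulrA -expr2 c2 mulrC.
have ipgt g : 0 < cov g g -> 0 < ip g g.
  move=> qg; rewrite lt_neqAle (ip_ge0 Hip) andbT; apply/negP => /eqP g0.
  by move: qg; rewrite (ip_eq0 Hip (esym g0)) /cov (ip0r Hip) ltxx.
have [N1 hN1] := cov_small_ball ltr01.
pose B1 := \sum_(k < N1) hnorm (d k).
have B10 : 0 <= B1 by apply: sumr_ge0 => k _; exact: hnorm_ge0.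
have supE : has_sup E.
  split; first by exists (cov h h / ip h h); apply: scal => //; exact: ipgt.
  exists ((3 * (B1 + 1)) ^+ 2) => _ [g [rg g1 ->]].
  apply: hN1 => // k kN; apply: (le_trans (ip_le_hnorm Hip _ _)).
  have g1' : hnorm g <= 1 by rewrite (hnorm_le Hip)// expr1n.
  apply: (le_trans (ler_wpM2l (hnorm_ge0 ip _) g1')); rewrite mulr1.
  rewrite /B1 (bigD1 (Ordinal kN))//= lerDl.
  by apply: sumr_ge0 => i _; exact: hnorm_ge0.
pose S := sup E.
have covS g : residual g -> cov g g <= S * ip g g.
  move=> rg; have [g0|g0] := eqVneq (ip g g) 0.
    by rewrite g0 mulr0 (ip_eq0 Hip g0) /cov (ip0r Hip).
  have gp : 0 < ip g g by rewrite lt_neqAle eq_sym g0 (ip_ge0 Hip).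
  by rewrite -ler_pdivrMr//; apply: (sup_upper_bound supE); exact: scal.
have S0 : 0 < S.
  have := covS h rh0 => hS; have := ipgt h q0 => hp.
  by rewrite -(pmulr_lgt0 _ hp); exact: lt_le_trans hS.
(* Cauchy-Schwarz for the covariance form: |Sig g|^4 = cov (g, Sig g)^2 <= cov (g, g) S |Sig
   g|^2. *)
have SigS g : residual g -> ip (Sig g) (Sig g) <= S * cov g g.
  move=> rg; have rS := residual_Sig rg.
  have := bilin_CS (covC cxi) (covDZl Hip cxi) residualDZ (fun x _ => cov_ge0 cxi x) rg rS.
  rewrite {1}/cov; set n := ip (Sig g) (Sig g) => cs.
  have n0 : 0 <= n by exact: (ip_ge0 Hip).
  have [nz|nz] := eqVneq n 0; first by rewrite nz mulr_ge0// ?(ltW S0)// (cov_ge0 cxi).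
  have np : 0 < n by rewrite lt_neqAle eq_sym nz.
  have cs2 : n ^+ 2 <= cov g g * (S * n).
    apply: (le_trans cs); apply: ler_wpM2l; first exact: (cov_ge0 cxi).
    exact: covS.
  by rewrite -(ler_pM2r np) -expr2; move: cs2; rewrite mulrCA mulrA.
(* Hence near-maximizers of the quadratic form are approximate eigenvectors for [S]. *)
have defect g : residual g -> ip g g <= 1 -> ip (S *: g - Sig g) (S *: g - Sig g) <= S * (S - cov g g).
  move=> rg g1; have := SigS g rg.
  rewrite (ipBl Hip) !(ipBr Hip) !(ipZl Hip) !(ipZr Hip) [ip g (Sig g)](ipC Hip) -/(cov g g).
  have : S * (S * ip g g) <= S * S by rewrite ler_pM2l// ler_piMr// ltW.
  lra.
have seqh (n : nat) : exists g, [/\ residual g, ip g g <= 1 & S - n.+1%:R^-1 < cov g g].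
  have n0 : 0 < n.+1%:R^-1 :> R by rewrite invr_gt0.
  by have [q [g [rg g1 ->]] hq] := sup_adherent n0 supE; exists g.
have [u uP] := choice seqh.
have ru n : residual (u n) by have [] := uP n.
have u1 n : ip (u n) (u n) <= 1 by have [] := uP n.
have uS n : S - n.+1%:R^-1 < cov (u n) (u n) by have [] := uP n.
have [G [UG ooG]] := ultraFilterLemma eventually_filter.
have [phi [phii cau]] : exists phi : nat -> nat, (forall i, (i <= phi i)%N) /\
    forall eps, 0 < eps -> exists N, forall n m, (N <= n)%N -> (N <= m)%N ->
      hnorm (Sig (u (phi n)) - Sig (u (phi m))) < eps.
  apply: (@ultra_cauchy R G UG (fun n m => hnorm (Sig (u n) - Sig (u m)))) => // eps eps0.
  (* The estimates below give S cov (g, g) <= 144 S rho^2 <= (12 (1 + S) rho)^2, which is (eps /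
     2)^2 for this choice. *)
  pose rho := eps / (24 * (1 + S)).
  have rho0 : 0 < rho by rewrite divr_gt0//; lra.
  have [N hN] := cov_small_ball rho0.
  (* Halving keeps the difference of two vectors [u n] in the unit ball, where [cov_small_ball]
     applies. *)
  have bd k n : `|ip (d k) (2^-1 *: u n)| <= hnorm (d k).
    apply: (le_trans (ip_le_hnorm Hip _ _)); rewrite (hnormZ Hip) ler_piMr ?hnorm_ge0//.
    have un1 : hnorm (u n) <= 1 by rewrite (hnorm_le Hip)// expr1n.
    by rewrite ger0_norm//; have := hnorm_ge0 ip (u n); lra.
  have [A GA hA] := @ultra_osc_fin R G UG N (fun k n => ip (d k) (2^-1 *: u n)) _ rho bd rho0.
  exists A => // n m An Am.
  pose g := u n - u m.
  have rg : residual g by move=> j l0; rewrite (ipBl Hip) !ru// subrr.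
  pose v := 2^-1 *: u n - 2^-1 *: u m.
  have vg : v = 2^-1 *: g by rewrite /v -scalerBr.
  have hu k : hnorm (u k) <= 1 by rewrite (hnorm_le Hip)// expr1n.
  have v1 : ip v v <= 1.
    have := hnormB Hip (2^-1 *: u n) (2^-1 *: u m).
    rewrite !(hnormZ Hip) ger0_norm// => h2.
    have : hnorm v <= 1 by have := hu n; have := hu m; move: h2; rewrite -/v; lra.
    by rewrite (hnorm_le Hip)// expr1n.
  have qv : cov v v <= (3 * (rho + rho)) ^+ 2.
    apply: hN => //; first exact: ltW.
    by move=> k kN; rewrite /v (ipBr Hip); exact: hA.
  have qg : cov g g = 4 * cov v v.
    have e1 z : cov v z = 2^-1 * cov g z.
      have -> : v = 2^-1 *: g + 0 by rewrite addr0.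
      by rewrite (covDZl Hip cxi) [cov 0 z](covC cxi) {2}/cov (ip0r Hip) addr0.
    by rewrite e1 (covC cxi) e1; field.
  rewrite -SigB -/g (hnorm_lt Hip) ?ltW//.
  apply: (le_lt_trans (SigS g rg)).
  have le12 : S * cov g g <= (12 * (1 + S) * rho) ^+ 2.
    apply: (@le_trans _ _ (S * (144 * rho ^+ 2))).
      have e36 : (3 * (rho + rho)) ^+ 2 = 36 * rho ^+ 2 by ring.
      by rewrite ler_pM2l// qg; move: qv; rewrite e36; lra.
    have -> : (12 * (1 + S) * rho) ^+ 2 = (144 * rho ^+ 2) * (1 + S) ^+ 2 by ring.
    have r2 : 0 <= 144 * rho ^+ 2 by apply: mulr_ge0 => //; exact: sqr_ge0.
    rewrite mulrC; apply: ler_wpM2l => //.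
    by rewrite sqrrD; have := sqr_ge0 S; have := S0; rewrite expr1n mul1r; lra.
  apply: (le_lt_trans le12).
  have -> : 12 * (1 + S) * rho = eps / 2.
    by rewrite /rho; field; rewrite gt_eqF//; lra.
  rewrite ltr_pXn2r ?nnegrE ?divr_ge0 ?(ltW eps0)//; lra.
have [g hg] := hcomplete Hip cau.
have cvgS : hcvg ip (fun i => S *: u (phi i)) g.
  move=> eps eps0.
  have e2 : 0 < eps / 2 by rewrite divr_gt0.
  have [N hN] := hg _ e2.
  pose K := Num.bound (S / (eps / 2) ^+ 2).
  have Kb : S / (eps / 2) ^+ 2 < K%:R.
    by apply: archi_boundP; rewrite divr_ge0 ?sqr_ge0 ?ltW.
  exists (maxn N K) => n; rewrite geq_max => /andP[Nn Kn].
  have -> : S *: u (phi n) - g = (S *: u (phi n) - Sig (u (phi n))) + (Sig (u (phi n)) - g).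
    by rewrite addrA subrK.
  apply: (le_lt_trans (hnormD Hip _ _)).
  have := hN n Nn => h2.
  suff : hnorm (S *: u (phi n) - Sig (u (phi n))) < eps / 2 by lra.
  rewrite (hnorm_lt Hip) ?ltW//; apply: (le_lt_trans (defect _ (ru _) (u1 _))).
  have := uS (phi n) => h3.
  have i0 : 0 < (phi n).+1%:R :> R by [].
  apply: (@lt_le_trans _ _ (S * (phi n).+1%:R^-1)); first by rewrite ltr_pM2l// ltrBlDl -ltrBlDr.
  rewrite ler_pdivrMr//; move: Kb; rewrite ltr_pdivrMr ?exprn_gt0// => /ltW h4.
  apply: (le_trans h4); rewrite mulrC ler_wpM2l ?sqr_ge0// ler_nat.
  by apply: (leq_trans Kn); apply: (leq_trans (phii n)).
have Sg : Sig g = S *: g.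
  apply/eqP; rewrite -subr_eq0; apply/eqP; apply: (ip_eq0 Hip).
  have ipz z : ip (Sig g) z = S * ip g z.
    rewrite -/(cov g z) (covC cxi) /cov (ipC Hip).
    have l1 := hcvg_ip Hip (z:=Sig z) cvgS.
    have l2 : (fun n => S * ip (Sig (u (phi n))) z) @ \oo --> S * ip g z.
      by apply: cvgM; [exact: cvg_cst|exact: hcvg_ip].
    rewrite (_ : (fun n => ip (S *: u (phi n)) (Sig z)) = (fun n => S * ip (Sig (u (phi n))) z)) in l1.
      exact: (cvg_unique (@Rhausdorff R) l1 l2).
    apply/funext => n.
    by rewrite (ipZl Hip) (ipC Hip _ (Sig z)) -/(cov z _) (covC cxi).
  by rewrite (ipBl Hip) (ipZl Hip) ipz subrr.
have rg : residual g.
  move=> j l0; have l1 := hcvg_ip Hip (z:=e j) hg.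
  apply: (cvg_unique (@Rhausdorff R) l1).
  rewrite (_ : (fun n => _) = fun=> 0); first exact: cvg_cst.
  by apply/funext => n; exact: residual_Sig.
have g0 : g = 0.
  apply: (eC S0 Sg) => j lj; apply: rg; by rewrite lj.
(* With g = 0, |Sig U| < S / 2 far out in the sequence; but |Sig U| >= cov (U, U) > S - 1 / (n + 1)
   for a large index n, hence at least S / 2. *)
have S2 : 0 < S / 2 by rewrite divr_gt0.
have [N hN] := hg _ S2.
pose K := Num.bound (2 / S).
have Kb : 2 / S < K%:R by apply: archi_boundP; rewrite divr_ge0 ?ltW.
have := hN (maxn N K) (leq_maxl _ _); rewrite g0 subr0 => h1.
have := uS (phi (maxn N K)); set U := u _ in h1 *; set r := _^-1 => h4.
have h2 : cov U U <= hnorm (Sig U).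
  apply: (le_trans (ler_norm _)); apply: (le_trans (ip_le_hnorm Hip _ _)).
  rewrite ler_piMr ?hnorm_ge0//.
  by rewrite (hnorm_le Hip)// expr1n; exact: u1.
have h3 : r <= S / 2.
  rewrite /r -[leRHS]invrK lef_pV2 ?posrE ?invr_gt0// invf_div.
  apply: (le_trans (ltW Kb)); rewrite ler_nat.
  by apply: (leq_trans (leq_maxr N K)); apply: (leq_trans (phii _)).
by lra.
Qed.

End Spectral.

(** * Law of the distance to a point *)

Section NormLaw.
Context {R : realType} {H : lmodType R} (ip : H -> H -> R).
Hypothesis Hip : is_separable_hilbert ip.
Notation hnorm := (hnorm ip).

Section Expansion.
Variable d : nat -> H.
Hypothesis dense_d : forall x (e : R), 0 < e -> exists n, hnorm (x - d n) < e.
Variable e : nat -> H.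
Hypothesis eO : forall i j, i != j -> ip (e i) (e j) = 0.
Hypothesis e1 : forall i x, ip (e i) (e i) * ip x (e i) = ip x (e i).
Variable r : nat -> H.
Hypothesis rd : forall k, hcvg ip (fun n => d k - hproj ip e n (d k)) (r k).

(** Orthogonality to the residuals of a dense sequence places x in the closed span of the [e j]. If
    v_n is the n-th residual of x, then |v_n|^2 = <v_n, x - d k> + <v_n, d k>. The first term is
    small by density; the second is the product of x with the n-th residual of [d k], which tends to
    <x, r k> = 0. *)
Lemma residual_norm_cvg0 x : (forall k, ip x (r k) = 0) ->
  (fun n => ip x x - \sum_(j <- iota 0 n) ip x (e j) ^+ 2) @ \oo --> 0.
Proof.
move=> xr; apply/cvgrPdist_lt => eps eps0.
pose v n := x - hproj ip e n x.
have vE n : ip x x - \sum_(j <- iota 0 n) ip x (e j) ^+ 2 = ip (v n) (v n).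
  by rewrite /v (ip_residual Hip eO e1).
have vx n : ip (v n) (v n) = ip (v n) x.
  rewrite {2}/v (ipBr Hip) -[RHS]subr0; congr (_ - _).
  rewrite /v (ipBl Hip) (ip_hproj2 Hip eO e1) (ip_hprojr Hip).
  by apply/eqP; rewrite subr_eq0; apply/eqP/eq_bigr => j _; rewrite expr2.
have vn n : hnorm (v n) <= hnorm x.
  rewrite (hnorm_le Hip) ?hnorm_ge0// (hnorm2 Hip) -vE gerBl.
  by apply: sumr_ge0 => j _; exact: sqr_ge0.
have x0 : 0 < hnorm x + 1 by have := hnorm_ge0 ip x; lra.
have [k hk] := dense_d x (divr_gt0 eps0 (mulr_gt0 (ltr0n R 2 : 0 < 2 :> R) x0)).
have := hcvg_ip Hip (z:=x) (rd k); rewrite (ipC Hip (r k)) xr.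
move=> /cvgrPdist_lt /(_ (eps / 2)); rewrite divr_gt0// => /(_ isT) [N _ hN].
exists N => // n /= Nn; have := hN n Nn.
rewrite sub0r normrN (ipC Hip _ x) (ip_residual_sym Hip) -/(v n) => h.
rewrite sub0r normrN vE ger0_norm ?(ip_ge0 Hip)// vx.
have -> : ip (v n) x = ip (v n) (x - d k) + ip (v n) (d k) by rewrite (ipBr Hip) subrK.
have : ip (v n) (x - d k) <= eps / 2.
  apply: (le_trans (ler_norm _)); apply: (le_trans (ip_le_hnorm Hip _ _)).
  apply: (@le_trans _ _ ((hnorm x + 1) * (eps / (2 * (hnorm x + 1))))).
    apply: ler_pM; [exact: hnorm_ge0|exact: hnorm_ge0| |exact: ltW].
    by have := vn n; lra.
  by rewrite le_eqVlt; apply/orP; left; apply/eqP; field; rewrite gt_eqF.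
by have := ler_norm (ip (v n) (d k)); lra.
Qed.

(** The residuals of x tend to 0, so the part of a outside the span contributes only its squared
    norm c, and the cross term disappears by Cauchy-Schwarz. *)
Lemma sqdist_cvg x a c : (forall k, ip x (r k) = 0) ->
  (fun n => ip a a - \sum_(j <- iota 0 n) ip a (e j) ^+ 2) @ \oo --> c ->
  (fun n => c + \sum_(j <- iota 0 n) (ip x (e j) - ip a (e j)) ^+ 2) @ \oo --> ip (x - a) (x - a).
Proof.
move=> xr ac; have xc := residual_norm_cvg0 xr.
pose v n := x - hproj ip e n x; pose u n := a - hproj ip e n a.
have vE n : ip x x - \sum_(j <- iota 0 n) ip x (e j) ^+ 2 = ip (v n) (v n).
  by rewrite /v (ip_residual Hip eO e1).
have uE n : ip a a - \sum_(j <- iota 0 n) ip a (e j) ^+ 2 = ip (u n) (u n).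
  by rewrite /u (ip_residual Hip eO e1).
rewrite (_ : (fun n => _) = (fun n => ip (v n) (v n))) in xc; last by apply/funext.
rewrite (_ : (fun n => _) = (fun n => ip (u n) (u n))) in ac; last by apply/funext.
have wE n : \sum_(j <- iota 0 n) (ip x (e j) - ip a (e j)) ^+ 2 =
    ip (x - a) (x - a) - (ip (v n) (v n) - 2 * ip (v n) (u n) + ip (u n) (u n)).
  have cr : ip (v n) (u n) = ip x a - \sum_(j <- iota 0 n) ip x (e j) * ip a (e j).
    rewrite /u (ip_residual_sym Hip) -/(v n).
    have -> : v n - hproj ip e n (v n) = v n.
      rewrite /hproj big1_seq ?subr0// => j; rewrite mem_iota/= => jn.
      by rewrite /v (ipBl Hip) (ip_hproj_e Hip eO e1)// subrr scale0r.
    by rewrite /v (ipBl Hip) (ip_hproj Hip).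
  rewrite cr -vE -uE (ipBl Hip) !(ipBr Hip) (ipC Hip a x).
  have -> : \sum_(j <- iota 0 n) (ip x (e j) - ip a (e j)) ^+ 2 =
     \sum_(j <- iota 0 n) ip x (e j) ^+ 2 + \sum_(j <- iota 0 n) ip a (e j) ^+ 2
     - 2 * \sum_(j <- iota 0 n) ip x (e j) * ip a (e j).
    by rewrite mulr_sumr -big_split -sumrB; apply: eq_bigr => j _ /=; ring.
  ring.
have un n : ip (u n) (u n) <= ip a a.
  by rewrite -uE gerBl; apply: sumr_ge0 => j _; exact: sqr_ge0.
have vu : (fun n => ip (v n) (u n)) @ \oo --> 0.
  apply/cvgrPdist_lt => eps eps0.
  have a0 : 0 < ip a a + 1 by have := ip_ge0 Hip a; lra.
  have e2 : 0 < eps ^+ 2 / (ip a a + 1) by rewrite divr_gt0 ?exprn_gt0.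
  move/cvgrPdist_lt : xc => /(_ _ e2) [N _ hN].
  exists N => // n /= /hN; rewrite !sub0r !normrN ger0_norm ?(ip_ge0 Hip)// => h.
  rewrite -(ltr_pXn2r (n:=2))// ?nnegrE ?(ltW eps0)// sqr_normr.
  apply: (le_lt_trans (ip_CS Hip _ _)).
  rewrite ltr_pdivlMr// in h; apply: le_lt_trans h.
  by rewrite ler_wpM2l ?(ip_ge0 Hip)//; have := un n; lra.
rewrite (_ : (fun n => c + _) = (fun n => c + (ip (x - a) (x - a) -
   (ip (v n) (v n) - 2 * ip (v n) (u n) + ip (u n) (u n))))); last first.
  by apply/funext => n; rewrite wE.
rewrite -[X in _ --> X](_ : c + (ip (x - a) (x - a) - (0 - 2 * 0 + c)) = _); last by ring.
apply: cvgD; first exact: cvg_cst.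
apply: cvgB; first exact: cvg_cst.
apply: cvgD => //; apply: cvgB => //.
by apply: cvgM => //; exact: cvg_cst.
Qed.

End Expansion.

Context {dd : measure_display} {Omega : measurableType dd} (P : probability Omega R).
Variables (xi : Omega -> H) (Sig : H -> H).
Hypothesis gxi : centered_gaussian_elt ip P xi.
Hypothesis cxi : covariance_operator ip P xi Sig.
Notation TR := (measurableTypeR R).

Lemma coord_neq0_null h : cov ip Sig h h = 0 -> P (coord ip xi h @^-1` ~` [set 0]) = 0%E.
Proof.
move=> q0; have [s [s0 s2 key]] := gauss_coord gxi cxi h.
have s00 : s = 0 by apply/eqP; rewrite -sqrf_eq0 s2 q0.
have m0 : measurable (~` [set 0] : set TR) by apply: measurableC; exact: measurable_set1.
have mc : measurable (coord ip xi h @^-1` ~` [set 0]).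
  by rewrite -[X in measurable X]setTI; exact: (measurable_coord gxi).
rewrite (prob_indic _ mc).
have := key _ (measurable_EFin_indic m0) (@indic_ge0 _ _ _).
rewrite (_ : (\int[gam]_z _)%E = 0%E).
  by move=> <-; apply: eq_integral.
by apply: integral0_eq => z _; rewrite s00 mul0r indicE memNset//=.
Qed.

(** [c] is the squared norm of the part of a outside the span of the eigenvectors, where xi has
    almost surely no component. The truncated sums increase with n, which yields both the bound
    valid for every n and the convergence; each comparison in the theorem uses the bound for one
    variable and the limit for the other. *)
Lemma norm_law (lam : nat -> R) (a : H) : eigen_seq ip Sig lam ->
  exists (b : nat -> R) (c : R), [/\ 0 <= c,
    (forall n, c + \sum_(j <- iota 0 n) b j ^+ 2 <= ip a a) &
    forall x : R, 0 < x ->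
      let p n := law ((0, Num.sqrt c) :: map (fun j => (Num.sqrt (lam j), b j)) (iota 0 n)) `](x ^+ 2)%R, +oo[%classic in
      (forall n, (p n <= P [set w | (x < hnorm (xi w - a))%R])%E) /\
      p @ \oo --> P [set w | (x < hnorm (xi w - a))%R]].
Proof.
move=> [lam0 [lamN [e0 [eo eS eC]]]].
have [d dense_d] := hdense Hip.
(* [e0 j] is unconstrained when [lam j] is 0; the zero vector makes the family fit the padded
   convention. *)
pose e j := if 0 < lam j then e0 j else 0.
have eO i j : i != j -> ip (e i) (e j) = 0.
  rewrite /e; case: ifPn => li; last by rewrite (ip0l Hip).
  case: ifPn => lj; last by rewrite (ip0r Hip).
  by move=> ij; rewrite eo// (negbTE ij).
have e1 i x : ip (e i) (e i) * ip x (e i) = ip x (e i).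
  rewrite /e; case: ifPn => li; last by rewrite !(ip0r Hip) mulr0.
  by rewrite eo// eqxx mul1r.
have ecov i j : cov ip Sig (e i) (e j) = lam i * (i == j)%:R.
  rewrite {1}/e; case: ifPn => li.
    rewrite /cov eS// (ipZl Hip) /e; case: ifPn => lj; first by rewrite eo.
    rewrite (ip0r Hip); case: eqP => [ij|_]; last by rewrite mulr0.
    by rewrite ij (negbTE lj) in li.
  have -> : lam i = 0 by apply/eqP; rewrite eq_le lam0 andbT leNgt.
  by rewrite (covC cxi) /cov (ip0r Hip) mul0r.
have hr k : exists rk, hcvg ip (fun n => d k - hproj ip e n (d k)) rk /\ forall j, ip rk (e j) = 0.
  by have [rk h1 h2] := residual_cvg Hip eO e1 (d k); exists rk.
have [r rP] := choice hr.
have rd k : hcvg ip (fun n => d k - hproj ip e n (d k)) (r k) by have [] := rP k.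
have cov0 k : cov ip Sig (r k) (r k) = 0.
  apply: (cov_residual Hip gxi cxi dense_d eS eC) => j lj.
  by have [_ /(_ j)] := rP k; rewrite /e lj.
pose b j := ip a (e j).
have cb : cvgn (fun n => \sum_(j <- iota 0 n) ip a (e j) ^+ 2) by exact: (cvg_bessel Hip eO e1).
pose c := ip a a - limn (fun n => \sum_(j <- iota 0 n) ip a (e j) ^+ 2).
have nd : nondecreasing_seq (fun n => \sum_(j <- iota 0 n) ip a (e j) ^+ 2).
  move=> i j ij; rewrite -(subnKC ij) iotaD big_cat/= lerDl.
  by apply: sumr_ge0 => k _; exact: sqr_ge0.
have c0 : 0 <= c.
  by rewrite subr_ge0; apply: limr_le => //; apply: nearW => n; exact: (bessel Hip eO e1).
have ac : (fun n => ip a a - \sum_(j <- iota 0 n) ip a (e j) ^+ 2) @ \oo --> c.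
  by apply: cvgB => //; exact: cvg_cst.
exists b, c; split => //.
  move=> n; have := nondecreasing_cvgn_le nd cb n; rewrite /c /b; lra.
move=> x x0 p.
pose X n := sqdist ip xi e b c n.
have x20 : 0 < x ^+ 2 by rewrite exprn_gt0.
have pE n : p n = P (X n @^-1` `](x ^+ 2)%R, +oo[%classic).
  by rewrite /p /X (sqdist_law Hip gxi cxi b c0 lam0 ecov).
(* Off this null set xi is orthogonal to every [r k], hence in the closed span of the [e j]. The
   union is countable since there is one residual for each point of the dense sequence, each of
   variance 0 by [cov_residual]. *)
pose N := \bigcup_k (coord ip xi (r k) @^-1` ~` [set 0]).
have mN : measurable N.
  apply: bigcup_measurable => k _; rewrite -[X in measurable X]setTI.
  by apply: (measurable_coord gxi) => //; apply: measurableC; exact: measurable_set1.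
have PN : P N = 0%E.
  apply/negligibleP => //; apply: negligible_bigcup => k; apply/negligibleP.
    rewrite -[X in measurable X]setTI.
    by apply: (measurable_coord gxi) => //; apply: measurableC; exact: measurable_set1.
  exact: coord_neq0_null.
pose A n := X n @^-1` `](x ^+ 2)%R, +oo[%classic.
have mA n : measurable (A n).
  by rewrite -[X in measurable X]setTI; apply: (measurable_sqdist gxi) => //; exact: measurable_itv.
have ndX w : nondecreasing_seq (fun n => X n w).
  move=> i j ij; rewrite /X /sqdist lerD2l -(subnKC ij) iotaD big_cat/= lerDl.
  by apply: sumr_ge0 => k _; exact: sqr_ge0.
have ndA : nondecreasing_seq A.
  move=> i j ij; apply/subsetPset => w; rewrite /A /= !in_itv/= !andbT => h.
  exact: lt_le_trans h (ndX w _ _ ij).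
pose B := [set w | x < hnorm (xi w - a)].
have mB : measurable B.
  have -> : B = ~` [set w | hnorm (xi w - a) <= x].
    by apply/seteqP; split=> w; rewrite /B /= ltNge => /negP.
  by apply: measurableC; apply: (measurable_hball Hip gxi dense_d); exact: ltW.
have good w : ~ N w -> (\bigcup_n A n) w <-> B w.
  move=> Nw.
  have xr k : ip (xi w) (r k) = 0.
    by apply: contrapT => h; apply: Nw; exists k.
  have cv := sqdist_cvg dense_d eO e1 rd xr ac.
  have BE : B w <-> x ^+ 2 < ip (xi w - a) (xi w - a).
    by rewrite /B /= ltNge (hnorm_le Hip _ (ltW x0)) -ltNge.
  split.
    move=> [n _]; rewrite /A /= in_itv/= andbT => h; apply/BE; apply: (lt_le_trans h).
    have := nondecreasing_cvgn_le (ndX w) (cvgP _ cv) n.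
    by move/cvg_lim : cv => ->//.
  move=> /BE h; apply: contrapT => nA.
  have : ip (xi w - a) (xi w - a) <= x ^+ 2.
    have <- := cvg_lim (@Rhausdorff R) cv.
    apply: limr_le; first exact: (cvgP _ cv).
    apply: nearW => n; rewrite leNgt; apply/negP => h'; apply: nA; exists n => //.
    by rewrite /A /= in_itv/= andbT.
  by rewrite leNgt h.
have mU : measurable (\bigcup_n A n) by apply: bigcup_measurable => n _; exact: mA.
have PUB : P (\bigcup_n A n) = P B.
  have half (F F' : set Omega) : measurable F -> measurable F' ->
      (forall w, ~ N w -> F w -> F' w) -> (P F <= P F')%E.
    move=> mF mF' h; apply: (@le_trans _ _ (P (F' `|` N))).
      apply: le_measure; rewrite ?inE//; first exact: measurableU.
      by move=> w Fw; have [Nw|Nw] := pselect (N w); [right|left; exact: h].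
    have h2 : (P (F' `|` N) <= P F' + P N)%E by exact: measureU2.
    by rewrite PN adde0 in h2.
  by apply/eqP; rewrite eq_le; apply/andP; split; apply: half => // w /good [].
have cvA : (fun n => P (A n)) @ \oo --> P B.
  by rewrite -PUB; exact: (nondecreasing_cvg_mu mA mU ndA).
split.
  move=> n; rewrite pE -/B -PUB; apply: le_measure; rewrite ?inE//; first exact: (mA n).
  by move=> w Aw; exists n.
by rewrite (_ : p = (fun n => P (A n)))//; apply/funext.
Qed.

End NormLaw.

(** * Assembling the bound *)

Section Kappa.
Context {R : realType}.

Lemma varkappa_ge0 (lam : nat -> R) : (0 <= varkappa lam)%E.
Proof.
have h (x : R) : 0 <= x -> (0 <= inv_or_oo x)%E.
  by move=> x0; rewrite /inv_or_oo; case: ifP => // _; rewrite lee_fin invr_ge0.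
by rewrite /varkappa; do 2 (case: ifP => _; first exact/h/sqrtr_ge0); exact/h/sqrtr_ge0.
Qed.

Lemma varkappa_gt0 (lam : nat -> R) : (forall j, 0 <= lam j) ->
  (forall i j, (i <= j)%N -> lam j <= lam i) -> (0 < varkappa lam)%E.
Proof.
move=> l0 lN; have := varkappa_ge0 lam; case E : (varkappa lam) => [K| |]// _.
by have [K0 _] := varkappa_conc l0 lN E; rewrite lte_fin.
Qed.

Lemma l1dist_ge (lam mu : nat -> R) (n : nat) :
  ((\sum_(j <- iota 0 n) `|lam j - mu j|)%:E <= l1dist lam mu)%E.
Proof.
have -> : iota 0 n = index_iota 0 n by rewrite /index_iota subn0.
rewrite -sumEFin; apply: nneseries_lim_ge => j _ _.
by rewrite lee_fin.
Qed.

Lemma l1dist_ge0 (lam mu : nat -> R) : (0 <= l1dist lam mu)%E.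
Proof. by apply: nneseries_ge0 => j _ _; rewrite lee_fin. Qed.

End Kappa.

Theorem theorem1 (R : realType) :
  exists C : R, 0 < C /\
  forall (H : lmodType R) (ip : H -> H -> R),
  is_separable_hilbert ip ->
  forall (dd : measure_display) (Omega : measurableType dd) (P : probability Omega R)
    (xi eta : Omega -> H) (Sxi Seta : H -> H) (lxi leta : nat -> R),
  centered_gaussian_elt ip P xi -> centered_gaussian_elt ip P eta ->
  covariance_operator ip P xi Sxi -> covariance_operator ip P eta Seta ->
  eigen_seq ip Sxi lxi -> eigen_seq ip Seta leta ->
  forall (a : H) (x : R), 0 < x ->
    (`| P [set w | (hnorm ip (xi w - a) <= x)%R] - P [set w | (hnorm ip (eta w) <= x)%R] |
      <= C%:E * (varkappa lxi + varkappa leta) * (l1dist lxi leta + (hnorm ip a ^+ 2)%:E))%E.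
Proof.
have C00 : 0 < @C2 R * @C1 R by rewrite mulr_gt0 ?C1_gt0 ?C2_gt0.
(* 100 is the constant of [varkappa_conc]; the other two come from [law1_step]. *)
exists (@C2 R * @C1 R * 100); split; first by rewrite mulr_gt0.
move=> H ip Hip dd Omega P xi eta Sxi Seta lxi leta gxi geta cxi ceta exi eeta a x x0.
have [l0 [lN _]] := exi; have [m0 [mN _]] := eeta.
have [b [c [c0 cb hX]]] := norm_law Hip gxi cxi a exi.
have [b' [c' [c'0 cb' hY]]] := norm_law Hip geta ceta 0 eeta.
have [pX cX] := hX x x0; have [pY cY] := hY x x0.
(* For eta the point is 0, and the bound of [norm_law] by its squared norm makes all shift
   parameters vanish. *)
have c'E : c' = 0.
  by have := cb' 0%N; rewrite big_nil addr0 (ip0l Hip) => h; apply/eqP; rewrite eq_le h.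
have b'E : b' = fun=> 0.
  apply/funext => j; have := cb' j.+1; rewrite c'E add0r (ip0l Hip) => h.
  apply/eqP; rewrite -sqrf_eq0 eq_le sqr_ge0 andbT; apply: le_trans h.
  rewrite -(addn1 j) iotaD big_cat/= big_seq1 add0n lerDr.
  by apply: sumr_ge0 => i _; exact: sqr_ge0.
subst b' c'; rewrite sqrtr0 in pY cY.
have [d dense_d] := hdense Hip.
have compl (z : Omega -> H) S' g : centered_gaussian_elt ip P z -> covariance_operator ip P z S' ->
    exists p : R, P [set w | (x < hnorm ip (z w - g))%R] = p%:E /\
      P [set w | (hnorm ip (z w - g) <= x)%R] = (1 - p)%:E.
  move=> gz cz; have mA := measurable_hball Hip gz dense_d g (ltW x0).
  have Cset : [set w | (x < hnorm ip (z w - g))%R] = ~` [set w | (hnorm ip (z w - g) <= x)%R].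
    by apply/seteqP; split=> w /=; rewrite ltNge => /negP.
  have fA : P [set w | (hnorm ip (z w - g) <= x)%R] \is a fin_num by exact: fin_num_measure.
  exists (1 - fine (P [set w | (hnorm ip (z w - g) <= x)%R])).
  split; first by rewrite Cset probability_setC// EFinB fineK.
  by rewrite opprB addrC subrK fineK.
have [p [pE pC]] := compl xi Sxi a gxi cxi.
have [q [qE qC]] := compl eta Seta 0 geta ceta.
have etaE : [set w | (hnorm ip (eta w) <= x)%R] = [set w | (hnorm ip (eta w - 0) <= x)%R].
  by apply/seteqP; split=> w /=; rewrite subr0.
rewrite etaE pC qC -EFinB abse_EFin (_ : 1 - p - (1 - q) = q - p); last by ring.
rewrite pE in pX cX; rewrite qE in pY cY.
rewrite (hnorm2 Hip).
have a0 := ip_ge0 Hip a.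
have L0 := l1dist_ge0 lxi leta.
have kx := varkappa_gt0 l0 lN; have ky := varkappa_gt0 m0 mN.
have Cpos : (0 < (@C2 R * @C1 R * 100)%:E)%E by rewrite lte_fin mulr_gt0.
have kk : (0 < varkappa lxi + varkappa leta)%E by exact: adde_gt0.
set S := (l1dist _ _ + _)%E.
have S0 : (0 <= S)%E by rewrite adde_ge0// lee_fin.
(* If [S] is 0 and [varkappa] is +oo, the right-hand side is 0 by the convention 0 * +oo = 0, so
   this case calls for exact equality of the two probabilities. *)
have [Sz|Sn] := eqVneq S 0%E.
  have [Lz az] : l1dist lxi leta = 0%E /\ ip a a = 0.
    have /eqP := Sz; rewrite /S padde_eq0// ?lee_fin//.
    by move=> /andP[/eqP -> /eqP [->]].
  have lm j : lxi j = leta j.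
    have := l1dist_ge lxi leta j.+1; rewrite Lz lee_fin => h.
    apply/eqP; rewrite -subr_eq0 -normr_le0; apply: le_trans h.
    rewrite -(addn1 j) iotaD big_cat/= big_seq1 add0n lerDr.
    by apply: sumr_ge0.
  have cz : c = 0.
    by have := cb 0%N; rewrite big_nil addr0 az => h; apply/eqP; rewrite eq_le h.
  have bz j : b j = 0.
    have := cb j.+1; rewrite cz add0r az => h.
    apply/eqP; rewrite -sqrf_eq0 eq_le sqr_ge0 andbT; apply: le_trans h.
    rewrite -(addn1 j) iotaD big_cat/= big_seq1 add0n lerDr.
    by apply: sumr_ge0 => i _; exact: sqr_ge0.
  have eqL n : (0, Num.sqrt c) :: map (fun j => (Num.sqrt (lxi j), b j)) (iota 0 n) =
     (0, 0) :: map (fun j => (Num.sqrt (leta j), 0 : R)) (iota 0 n).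
    by rewrite cz sqrtr0; congr (_ :: _); apply: eq_map => j; rewrite lm bz.
  have pq : p%:E = q%:E :> \bar R.
    have fE : (fun n => law ((0, Num.sqrt c) :: map (fun j => (Num.sqrt (lxi j), b j)) (iota 0 n))
        `](x ^+ 2)%R, +oo[%classic) =
      (fun n => law ((0, 0) :: map (fun j => (Num.sqrt (leta j), 0 : R)) (iota 0 n))
        `](x ^+ 2)%R, +oo[%classic) by apply/funext => n; rewrite eqL.
    rewrite fE in cX; exact: (cvg_unique (@ereal_hausdorff R) cX cY).
  by case: pq => ->; rewrite subrr normr0 Sz mule0.
have Sp : (0 < S)%E by rewrite lt_def Sn.
have yN : varkappa leta != -oo%E by move: ky; case: (varkappa leta).
case Ex : (varkappa lxi) kx kk => [K1| |]//= K10; last first.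
  by move=> _; rewrite (addye yN) (gt0_muley Cpos) (gt0_mulye Sp) leey.
case Ey : (varkappa leta) ky => [K2| |]//= K20; last first.
  by move=> _; rewrite addey// (gt0_muley Cpos) (gt0_mulye Sp) leey.
move=> kk; case ES : S Sp => [D| |]// D0; last first.
  by rewrite gt0_muley ?leey// mule_gt0.
have [{}K10 [n1 h1]] := varkappa_conc l0 lN Ex.
have [{}K20 [n2 h2]] := varkappa_conc m0 mN Ey.
have K1' : 0 <= 100 * K1 by rewrite mulr_ge0// ltW.
have K2' : 0 <= 100 * K2 by rewrite mulr_ge0// ltW.
pose E := @C2 R * @C1 R * 100 * (K1 + K2) * D.
have DS n : c + \sum_(j <- iota 0 n) (`|lxi j - leta j| + b j ^+ 2) <= D.
  rewrite big_split/= addrCA -lee_fin -ES /S EFinD.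
  by apply: leeD; [exact: l1dist_ge|rewrite lee_fin; exact: cb].
pose LX n := law ((0, Num.sqrt c) :: map (fun j => (Num.sqrt (lxi j), b j)) (iota 0 n)).
pose LY n := law ((0, 0) :: map (fun j => (Num.sqrt (leta j), 0 : R)) (iota 0 n)).
(* Each truncated tail is compared with the full tail of the other variable, which bounds all its
   truncations; n then tends to infinity on the left only. *)
have step n : (n1 <= n)%N -> (n2 <= n)%N ->
    (LX n `](x ^+ 2)%R, +oo[%classic <= q%:E + E%:E)%E /\
    (LY n `](x ^+ 2)%R, +oo[%classic <= p%:E + E%:E)%E.
  move=> n1n n2n.
  have [A1 A2] := compare_tails b (x ^+ 2) l0 m0 c0 K1' K2' (h1 n n1n) (h2 n n2n).
  set e := (_ * _)%:E in A1 A2.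
  have eE : (e <= E%:E)%E.
    rewrite /e /E lee_fin -mulrDr mulrA; apply: ler_wpM2l; last exact: DS.
    have CC : 0 <= @C2 R * @C1 R * 100 by rewrite mulr_ge0// (ltW C00).
    have KK : 0 <= K1 + K2 by rewrite addr_ge0 ?(ltW K10) ?(ltW K20).
    exact: mulr_ge0.
  split; first by apply: (le_trans A1); apply: leeD => //; exact: pY.
  by apply: (le_trans A2); apply: leeD => //; exact: pX.
have nr : \forall n \near \oo, (n1 <= n)%N /\ (n2 <= n)%N.
  by exists (maxn n1 n2) => // n /=; rewrite geq_max => /andP.
have Hp : (p%:E <= q%:E + E%:E)%E.
  rewrite -(cvg_lim _ cX)//; apply: lime_le; first exact: (cvgP _ cX).
  by apply: filterS nr => n [h h']; have [] := step n h h'.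
have Hq : (q%:E <= p%:E + E%:E)%E.
  rewrite -(cvg_lim _ cY)//; apply: lime_le; first exact: (cvgP _ cY).
  by apply: filterS nr => n [h h']; have [] := step n h h'.
rewrite -EFinD -!EFinM lee_fin -/E ler_norml.
move: Hp Hq; rewrite -!EFinD !lee_fin => Hp Hq.
by apply/andP; split; lra.
Qed.
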